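(* Let $0<s<1$, and let $(a_n)_{n=0}^{\infty}$ be a greedy $s$-energy sequence on $S^1$. Then the sequence $$\left(\frac{U_{N,s}(a_N)-N I_s(\sigma)}{N^s}\right)_{N=1}^{\infty}$$ is bounded and divergent, and we have $$\limsup_{N\to\infty}\frac{U_{N,s}(a_N)-N I_s(\sigma)}{N^s}=(2^s-1)\frac{2\zeta(s)}{(2\pi)^s},$$ $$\liminf_{N\to\infty}\frac{U_{N,s}(a_N)-N I_s(\sigma)}{N^s}=\overline{g}(s)(2^s-1)\frac{2\zeta(s)}{(2\pi)^s}.$$ For each $\vec{\theta}\in\Theta$, the value $G(\vec{\theta};s)(2^s-1)\frac{2\zeta(s)}{(2\pi)^s}$ is a limit point of the sequence $\left(\frac{U_{N,s}(a_N)-N I_s(\sigma)}{N^s}\right)_{N=1}^{\infty}$.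
   Context: $S^1=\{z\in\mathbb{C}:|z|=1\}$. For $s>0$, a sequence $(a_n)_{n=0}^{\infty}\subset S^1$ is a greedy $s$-energy sequence on $S^1$ if for every $n\geq 1$, $\sum_{k=0}^{n-1}|a_n-a_k|^{-s}=\inf_{z\in S^1}\sum_{k=0}^{n-1}|z-a_k|^{-s}$ (with $|z-a_k|^{-s}=+\infty$ when $z=a_k$). For $N\geq 1$, $U_{N,s}(z):=\sum_{k=0}^{N-1}|z-a_k|^{-s}$. $\sigma$ is the normalized arc-length (probability) measure on $S^1$, and $I_s(\sigma)=\iint|x-y|^{-s}\,d\sigma(x)\,d\sigma(y)$ (equal to $\Gamma(1-s)/\Gamma(1-\frac{s}{2})^2$ for $0<s<1$). $\zeta$ is the Riemann zeta function, analytically extended to $\mathbb{C}\setminus\{1\}$. For an integer $N\geq 1$ let $\tau_b(N)$ be the number of $1$'s in the binary representation of $N$. For an integer $p\geq 1$, $\Theta_p$ is the set of all $\vec{\theta}=(\theta_1,\ldots,\theta_p)\in\mathbb{R}^p$ for which there is an infinite sequence $\mathcal{N}$ of positive integers such that every $N\in\mathcal{N}$ satisfies $\tau_b(N)=p$ and, writing $N=2^{n_1}+\cdots+2^{n_p}$ with $n_1>\cdots>n_p\geq 0$ (the $n_k$ depending on $N$), $\lim_{N\in\mathcal{N}}2^{n_k}/N=\theta_k$ for all $1\leq k\leq p$. Set $\Theta=\bigcup_{p\geq 1}\Theta_p$, $G(\vec{\theta};s)=\sum_{k=1}^p\theta_k^s$ for $\vec{\theta}=(\theta_1,\ldots,\theta_p)\in\Theta$,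 and $\overline{g}(s)=\sup_{\vec{\theta}\in\Theta}G(\vec{\theta};s)$ for $0<s<1$. ''Divergent'' means not convergent; a limit point of a sequence is the limit of some convergent subsequence. *)

(* Defs.v *)
From HB Require Import structures.
From mathcomp Require Import all_boot all_order all_algebra.
From mathcomp Require Import all_classical all_reals all_analysis.
From mathcomp Require Import measurable_realfun complex lra.
Set Implicit Arguments.
Unset Strict Implicit.
Unset Printing Implicit Defensive.
Import Order.TTheory GRing.Theory Num.Theory.
Import numFieldNormedType.Exports.
Import ComplexField.Normc.
Local Open Scope classical_set_scope.
Local Open Scope ring_scope.
Local Open Scope complex_scope.

Definition circle (R : realType) : set R[i] := [set z | normc z = 1].

Definition expi (R : realType) (t : R) : R[i] := cos t +i* sin t.

Definition cexp (R : realType) (z : R[i]) : R[i] :=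
  (expR (complex.Re z))%:C * expi (complex.Im z).

(* [MathComp-Analysis] puts the norm topology on the alias [R[i]^o]. *)
Definition analytic_at (R : realType) (f : R[i] -> R[i]) (z0 : R[i]) : Prop :=
  exists (c : nat -> R[i]) (r : R), 0 < r /\
    forall z : R[i], normc (z - z0) < r ->
      series (fun k => c k * (z - z0) ^+ k : R[i]^o) @ \oo --> (f z : R[i]^o).

(* The two clauses determine [zeta] on [C \ {1}] by the identity theorem; the
   value at the pole 1 is left unconstrained. *)
Definition is_riemann_zeta (R : realType) (zeta : R[i] -> R[i]) : Prop :=
  (forall z : R[i], 1 < complex.Re z ->
     series (fun n => cexp (- z * (ln (n.+1%:R : R))%:C) : R[i]^o) @ \oo
       --> (zeta z : R[i]^o)) /\
  (forall z0 : R[i], z0 != 1 -> analytic_at zeta z0).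

Definition borelC (R : realType) := g_sigma_algebraType (@open R[i]^o).

Definition circle_param (R : realType) (t : measurableTypeR R) : borelC R :=
  expi (2 * pi * t).

Lemma continuous_expi (R : realType) :
  continuous (fun t : R => expi (2 * pi * t) : R[i]^o).
Proof.
move=> t; apply/cvgrPdist_le => e e0.
have [er] : exists e' : R, e = e'%:C.
  by exists (complex.Re e); rewrite -(RRe_real (gtr0_real e0)).
move=> eE; move: e0; rewrite eE ltcR => e0.
have h1 : (fun t : R => cos (2 * pi * t)) @ t --> cos (2 * pi * t).
  by apply: continuous_comp; [exact: mulrl_continuous|exact: continuous_cos].
have h2 : (fun t : R => sin (2 * pi * t)) @ t --> sin (2 * pi * t).
  by apply: continuous_comp; [exact: mulrl_continuous|exact: continuous_sin].
have e20 : 0 < er / 2 by rewrite divr_gt0.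
move/cvgrPdist_le: h1 => /(_ _ e20) h1.
move/cvgrPdist_le: h2 => /(_ _ e20) h2.
near=> u.
have k1 : `|cos (2 * pi * t) - cos (2 * pi * u)| <= er / 2 by near: u; exact: h1.
have k2 : `|sin (2 * pi * t) - sin (2 * pi * u)| <= er / 2 by near: u; exact: h2.
rewrite /expi normc_def /= lecR.
set x := cos _ - _ in k1 *; set y := sin _ - _ in k2 *.
rewrite -(ger0_norm (ltW e0)) -sqrtr_sqr ler_wsqrtr//.
rewrite -(real_normK (num_real x)) -(real_normK (num_real y)).
apply: (@le_trans _ _ ((er / 2) ^+ 2 + (er / 2) ^+ 2)).
  by rewrite lerD// lerXn2r// nnegrE// ltW.
by move: e0 => /ltW e0; have := mulr_ge0 e0 e0; rewrite !expr2; lra.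
Unshelve. all: by end_near.
Qed.

Lemma measurable_circle_param (R : realType) :
  measurable_fun [set: measurableTypeR R] (@circle_param R).
Proof.
apply: (@measurability _ _ (measurableTypeR R) (borelC R) setT (@circle_param R)
  (@open R[i]^o)) => // _ [B oB <-].
rewrite setTI; apply: open_measurable; move: oB; apply: open_comp => t _.
exact: continuous_expi.
Qed.

HB.instance Definition _ (R : realType) :=
  isMeasurableFun.Build _ _ (measurableTypeR R) (borelC R) (@circle_param R)
    (@measurable_circle_param R).

(* Law of e^(2 pi i t) with t uniform on [0, 1]. *)
Definition arclength (R : realType) : probability (borelC R) R :=
  distribution (uniform_prob (@ltr01 R))
    (@circle_param R : {mfun measurableTypeR R >-> borelC R}).

Definition riesz (R : realType) (s : R) (z w : R[i]) : \bar R :=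
  if z == w then +oo%E else ((normc (z - w)) `^ (- s))%:E.

Definition energy_I (R : realType) (s : R) : \bar R :=
  (\int[@arclength R]_(x in @circle R)
     \int[@arclength R]_(y in @circle R) riesz s x y)%E.

Definition potential (R : realType) (s : R) (a : nat -> R[i]) (N : nat)
    (z : R[i]) : \bar R :=
  (\sum_(k < N) riesz s z (a k))%E.

Definition greedy (R : realType) (s : R) (a : nat -> R[i]) : Prop :=
  (forall n, @circle R (a n)) /\
  (forall n, (1 <= n)%N ->
     potential s a n (a n) =
     ereal_inf [set potential s a n z | z in @circle R]).

(* The 0th term is a dummy: the sequence of interest starts at N = 1. *)
Definition normalized_potential (R : realType) (s : R) (a : nat -> R[i])
    (N : nat) : \bar R :=
  ((potential s a N (a N) - N%:R%:E * energy_I s)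
     * (((N%:R : R) `^ s)^-1)%:E)%E.

Definition subseq_limit_point (R : realType) (u : nat -> \bar R) (l : \bar R) : Prop :=
  exists phi : nat -> nat,
    {homo phi : m n / (m < n)%N} /\ u (phi n) @[n --> \oo] --> l.

(* Binary digit i of N is [odd (N %/ 2 ^ i)]; it vanishes for i >= N. *)
Definition tau_b (N : nat) : nat := (\sum_(i < N) odd (N %/ 2 ^ i))%N.

(* [nu] enumerates the infinite set of integers; [e j k] is the exponent n_k in
   the binary expansion of [nu j], with k counted from 0. *)
Definition Theta_set (R : realType) (p : nat) (theta : 'I_p -> R) : Prop :=
  exists (nu : nat -> nat) (e : nat -> 'I_p -> nat),
    [/\ {homo nu : i j / (i < j)%N},
        forall j, (0 < nu j)%N /\ tau_b (nu j) = p,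
        forall j (k l : 'I_p), (k < l)%N -> (e j l < e j k)%N,
        forall j, nu j = (\sum_(k < p) 2 ^ e j k)%N
      & forall k, (2 ^+ e j k / (nu j)%:R : R) @[j --> \oo] --> theta k].

Definition G_sum (R : realType) (p : nat) (theta : 'I_p -> R) (s : R) : R :=
  \sum_(k < p) theta k `^ s.

Definition gbar (R : realType) (s : R) : \bar R :=
  ereal_sup [set x | exists (p : nat) (theta : 'I_p -> R),
    [/\ (0 < p)%N, Theta_set theta & x = (G_sum theta s)%:E]].

(* [zeta s] is real for real [s]; [complex.Re] only casts it to [R]. *)
Definition zeta_const (R : realType) (zeta : R[i] -> R[i]) (s : R) : R :=
  (2 `^ s - 1) * ((2 * complex.Re (zeta s%:C)) / (2 * pi) `^ s).

(* Main.v *)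
Require Import Defs.
From mathcomp Require Import all_boot all_order all_algebra.
From mathcomp Require Import all_classical all_reals all_analysis.
From mathcomp Require Import measurable_realfun complex ring lra zify.
Set Implicit Arguments.
Unset Strict Implicit.
Unset Printing Implicit Defensive.
Import Order.TTheory GRing.Theory Num.Theory.
Import numFieldNormedType.Exports.
Import ComplexField.Normc.
Local Open Scope classical_set_scope.
Local Open Scope ring_scope.
Local Open Scope complex_scope.

(** Write [C] for the constant of the statement and [I] for the energy of the
    arc-length measure. The result has one combinatorial and one analytic half,
    and a short argument joins them.

    Combinatorics. The kernel is strictly convex as a function of the angle, so
    the potential of [M] equally spaced points is minimal exactly half-way
    between neighbours ([root_potential]); call the minimum [midpot s M]. It
    follows by induction ([greedy_structure]) that the first [2 ^ n] points of a
    greedy sequence are equally spaced, and that the next ones are greedy among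
    themselves while keeping to the midpoints. Hence, if
    [N = 2 ^ n_1 + ... + 2 ^ n_p] with distinct exponents, the value of the
    potential of the first [N] points at the next one is the sum of the
    [midpot s (2 ^ n_k)] ([greedy_potential]).

    Analysis. [midpot s N] is a midpoint Riemann sum, with [N] cells, of a
    function whose integral is [I] ([energy_cumulative]) and which behaves like
    [(2 pi t) ^ (- s)] near the two ends of its interval. The [K] cells nearest
    to an end produce, after division by [N ^ s], the difference between
    [sum_(k < K) (k + 1/2) ^ (- s)] and [K ^ (1 - s) / (1 - s)]; the other cells
    contribute a telescoping error, because the function is monotone on each
    half. So [(midpot s N - N I) / N ^ s] converges along the even numbers
    ([midpot_asymptotics]), to [2 (2 pi) ^ (- s)] times the limit of these
    differences as [K] grows, which is [(2 ^ s - 1) zeta s]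
    ([midpoint_sum_cvg]).

    The last identity needs the analytic continuation. The alternating series
    [eta] converges normally in the right half-plane, and
    [(1 - 2 ^ (1 - z)) zeta z = eta z] holds where the real part of [z] exceeds
    1. On a horizontal line at height [y <> 0], which avoids the pole, both
    sides are real-analytic functions of the abscissa, so the identity persists
    down to abscissa 0 ([eta_zeta_eq0]); [y] then tends to 0 by continuity
    ([eta_zeta_real]). The same identity gives [zeta s < 0], as [eta s > 0].

    Conclusion. By the two halves, the normalized potential at [N] is
    [C * weight s N + o(1)], where [weight s N = sum_k (2 ^ n_k / N) ^ s] is
    bounded ([defect_weight]). The vector of the ratios [2 ^ n_k / N] belongs to
    Theta, by the sequence of the [N 2 ^ j], and conversely [G] at any vector of
    Theta is a limit of weights. So the least upper bound of the weights is
    [gbar s]; their minimum is 1, attained at the powers of 2, because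
    [x <= x ^ s] on the unit interval. As [C] is negative, the upper limit is [C]
    and the lower limit is [gbar s * C]. These differ, the weight of 3 being
    more than 1. *)

(** * Points of the circle *)

Lemma expiD (R : realType) (x y : R) : expi (x + y) = expi x * expi y.
Proof.
rewrite /expi cosD sinD; apply/eqP; rewrite eq_complex /= eqxx /=.
by rewrite (addrC (sin x * _)).
Qed.

Lemma expi0 (R : realType) : expi (0 : R) = 1.
Proof. by rewrite /expi cos0 sin0. Qed.

Lemma expi_pi (R : realType) : expi (pi : R) = -1.
Proof.
by rewrite /expi cospi sinpi; apply/eqP; rewrite eq_complex /= oppr0 !eqxx.
Qed.

Lemma expi_2pi (R : realType) : expi (2 * pi : R) = 1.
Proof. by rewrite mulr_natl mulr2n expiD expi_pi mulrNN mulr1. Qed.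

Lemma expiN (R : realType) (x : R) : expi x * expi (- x) = 1.
Proof. by rewrite -expiD subrr expi0. Qed.

Lemma expiX (R : realType) (x : R) n : expi x ^+ n = expi (x * n%:R).
Proof.
elim: n => [|n IH]; first by rewrite expr0 mulr0 expi0.
by rewrite exprS IH -natr1 mulrDr mulr1 addrC expiD.
Qed.

Lemma normc_expi (R : realType) (x : R) : normc (expi x) = 1.
Proof. by rewrite /= cos2Dsin2 sqrtr1. Qed.

Lemma circle_expi (R : realType) (x : R) : circle (expi x).
Proof. exact: normc_expi. Qed.

(** The angle is the arc cosine of the abscissa, or its complement to [2 pi] in
    the lower half-plane. *)
Lemma expi_surj (R : realType) (z : R[i]) : circle z ->
  exists2 t : R, 0 <= t < 2 * pi & z = expi t.
Proof.
case: z => x y; rewrite /circle /= => h.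
have hxy : x ^+ 2 + y ^+ 2 = 1.
  by rewrite -[LHS]sqr_sqrtr ?h ?expr1n// addr_ge0// sqr_ge0.
have x1 : -1 <= x <= 1.
  by have := sqr_ge0 y => ?; apply/andP; split; nra.
have siny : sin (acos x) = `|y|.
  by rewrite sin_acos// -hxy addrAC subrr add0r sqrtr_sqr.
have ppi := @pi_gt0 R.
have [y0|y0] := leP 0 y.
  exists (acos x).
    by rewrite acos_ge0//=; have := acos_lepi x1; lra.
  by rewrite /expi acosK ?in_itv//= siny ger0_norm.
exists (2 * pi - acos x).
  have an0 : acos x != 0.
    by apply/eqP => E; move: siny; rewrite E sin0 ltr0_norm// => ?; lra.
  have a0 : 0 < acos x by rewrite lt_neqAle eq_sym an0 acos_ge0.
  by have := acos_lepi x1; lra.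
have : expi (2 * pi - acos x) = expi (- acos x) by rewrite expiD expi_2pi mul1r.
by move=> ->; rewrite /expi cosN sinN acosK ?in_itv//= siny ltr0_norm// opprK.
Qed.

(** Rotating by the bisector of the two points makes them conjugate. *)
Lemma normc_expiB (R : realType) (x y : R) :
  normc (expi x - expi y) = 2 * `|sin ((x - y) / 2)|.
Proof.
pose m := (x + y) / 2; pose d := (x - y) / 2.
have -> : x = m + d by rewrite /m /d; field.
have -> : y = m - d by rewrite /m /d; field.
have -> : (m + d - (m - d)) / 2 = d by field.
rewrite !expiD -mulrBr normcM normc_expi mul1r /expi cosN sinN /=.
have -> : sin d - - sin d = 2 * sin d by ring.
by rewrite subrr expr0n /= add0r sqrtr_sqr normrM ger0_norm.
Qed.

(** * The kernel and its convexity *)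

Definition kern (R : realType) (s x : R) : R := (2 * sin x) `^ (- s).

Lemma kernB (R : realType) (s x : R) : kern s (pi - x) = kern s x.
Proof. by rewrite /kern sinB sinpi cospi mul0r sub0r mulN1r opprK. Qed.

Lemma powRN_decr (R : realType) (s x y : R) : 0 <= s -> 0 < x -> x <= y ->
  y `^ (- s) <= x `^ (- s).
Proof.
move=> s0 x0 xy; have y0 := lt_le_trans x0 xy.
rewrite !powRN lef_pV2 ?posrE ?powR_gt0//.
by apply: ge0_ler_powR => //; rewrite nnegrE ltW.
Qed.

Lemma powRN_sdecr (R : realType) (s x y : R) : 0 < s -> 0 < x -> x < y ->
  y `^ (- s) < x `^ (- s).
Proof.
move=> s0 x0 xy; have y0 := lt_trans x0 xy.
rewrite !powRN ltf_pV2 ?posrE ?powR_gt0//.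
by apply: gt0_ltr_powR => //; rewrite nnegrE ltW.
Qed.

(** Logarithmic concavity of the sine makes the kernel strictly convex: the
    geometric mean of the kernel dominates its value at the middle. *)
Lemma kern_midpoint (R : realType) (s x y : R) : 0 < s -> 0 < x < pi ->
  0 < y < pi -> x != y -> 2 * kern s ((x + y) / 2) < kern s x + kern s y.
Proof.
move=> s0 /andP[x0 xpi] /andP[y0 ypi] xy.
pose m := (x + y) / 2; pose d := (x - y) / 2.
have sx : 0 < 2 * sin x by rewrite mulr_gt0// sin_gt0_pi// x0.
have sy : 0 < 2 * sin y by rewrite mulr_gt0// sin_gt0_pi// y0.
have sm : 0 < 2 * sin m.
  by rewrite mulr_gt0// sin_gt0_pi// /m; apply/andP; split; lra.
have sd : 0 < sin d ^+ 2.
  rewrite exprn_even_gt0//=; have dn : d != 0.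
    by rewrite /d mulf_neq0// subr_eq0.
  have [d0|d0] := ltP 0 d.
    by apply/lt0r_neq0/sin_gt0_pi; rewrite d0 /d; lra.
  rewrite -oppr_eq0 -sinN; apply/lt0r_neq0/sin_gt0_pi.
  by rewrite oppr_gt0 lt_neqAle dn d0 /d; lra.
have lt : (2 * sin x) * (2 * sin y) < (2 * sin m) ^+ 2.
  have -> : x = m + d by rewrite /m /d; field.
  have -> : y = m - d by rewrite /m /d; field.
  rewrite sinD sinB.
  by have := cos2Dsin2 m; have := cos2Dsin2 d; nra.
pose A := (2 * sin x) `^ (- (s / 2)); pose B := (2 * sin y) `^ (- (s / 2)).
have EA (u : R) : 0 < u -> u `^ (- s) = (u `^ (- (s / 2))) ^+ 2.
  by move=> u0; rewrite -powR_mulrn ?powR_ge0// -powRrM; congr (_ `^ _); field.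
have EM : kern s m < A * B.
  have -> : kern s m = ((2 * sin m) ^+ 2) `^ (- (s / 2)).
    by rewrite -powR_mulrn ?(ltW sm)// -powRrM; congr (_ `^ _); field.
  rewrite /A /B -powRM ?(ltW sx) ?(ltW sy)//.
  by apply: powRN_sdecr => //; [rewrite divr_gt0|rewrite mulr_gt0].
have AB : A * B *+ 2 <= A ^+ 2 + B ^+ 2.
  by have := sqr_ge0 (A - B); rewrite sqrrB; lra.
rewrite /kern (EA _ sx) (EA _ sy) -/A -/B; apply: lt_le_trans AB.
by rewrite mulr_natl ltrMn2r.
Qed.

(** * The potential of equally spaced points *)

(** The value of the potential of the [M]-th roots of unity half-way between
    two neighbours. *)
Definition midpot (R : realType) (s : R) (M : nat) : R :=
  \sum_(k < M) kern s (pi * (2 * k%:R + 1) / (2 * M%:R)).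

Lemma riesz_ge0 (R : realType) (s : R) (z w : R[i]) : (0 <= riesz s z w)%E.
Proof. by rewrite /riesz; case: ifP => // _; rewrite lee_fin powR_ge0. Qed.

Lemma riesz_expi (R : realType) (s x y : R) : 0 < (x - y) / 2 < pi ->
  riesz s (expi x) (expi y) = (kern s ((x - y) / 2))%:E.
Proof.
move=> xy; have sxy := sin_gt0_pi xy.
have nE : normc (expi x - expi y) = 2 * sin ((x - y) / 2).
  by rewrite normc_expiB gtr0_norm.
rewrite /riesz ifF ?nE//; apply/negbTE/eqP => E; move: nE.
by rewrite E subrr normc0 => /eqP; rewrite lt_eqF ?mulr_gt0.
Qed.

Lemma riesz_rot (R : realType) (s : R) (u z w : R[i]) : normc u = 1 ->
  riesz s (u * z) (u * w) = riesz s z w.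
Proof.
move=> u1; have u0 : u != 0.
  by apply: contra_eq_neq u1 => ->; rewrite normc0 eq_sym oner_neq0.
by rewrite /riesz (inj_eq (mulfI u0)) -mulrBr normcM u1 mul1r.
Qed.

Lemma circleM (R : realType) (z w : R[i]) : circle z -> circle w -> circle (z * w).
Proof. by rewrite /circle /= normcM => -> ->; rewrite mulr1. Qed.

Lemma circle_neq0 (R : realType) (z : R[i]) : circle z -> z != 0.
Proof.
by rewrite /circle /= => h; apply: contra_eq_neq h => ->; rewrite normc0 eq_sym oner_neq0.
Qed.

Lemma circleX (R : realType) (z : R[i]) n : circle z -> circle (z ^+ n).
Proof.
move=> cz; elim: n => [|n IH]; first by rewrite expr0 /circle /= expr0n addr0 expr1n sqrtr1.
by rewrite exprS; exact: circleM.
Qed.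

Lemma circleV (R : realType) (z : R[i]) : circle z -> circle z^-1.
Proof. by rewrite /circle /= normcV => ->; rewrite invr1. Qed.

Lemma expi_eq (R : realType) (x y : R) : 0 <= x < 2 * pi -> 0 <= y < 2 * pi ->
  expi x = expi y -> x = y.
Proof.
wlog xy : x y / y <= x => [hw hx hy E|hx hy E].
  have [xy|/ltW xy] := leP y x; first exact: hw.
  by apply/esym/hw.
apply/eqP; rewrite eq_le xy andbT leNgt; apply/negP => lt.
have : normc (expi x - expi y) = 0 by rewrite E subrr normc0.
rewrite normc_expiB gtr0_norm; last by apply: sin_gt0_pi; apply/andP; split; lra.
apply/eqP; rewrite gt_eqF// mulr_gt0// sin_gt0_pi//.
by apply/andP; split; lra.
Qed.

(** [M] distinct roots of [X^M - y] are all of its roots, so they can be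
    enumerated clockwise from any one of them. *)
Lemma sum_root_set (R : realType) (M : nat) (c : nat -> R[i]) (y c' : R[i])
    (F : R[i] -> \bar R) : (0 < M)%N -> circle c' ->
  {in gtn M &, injective c} -> (forall i, (i < M)%N -> c i ^+ M = y) ->
  c' ^+ M = y ->
  (\sum_(k < M) F (c k) = \sum_(k < M) F (c' * expi (- (2 * pi * k%:R / M%:R)))%R)%E.
Proof.
move=> M0 cc' injc hc hc'.
pose d k : R[i] := c' * expi (- (2 * pi * k%:R / M%:R)).
have MR : (0 : R) < M%:R by rewrite ltr0n.
have hd i : d i ^+ M = y.
  rewrite exprMn hc' expiX mulNr divfK ?gt_eqF//.
  have := expiN (2 * pi * i%:R : R).
  by rewrite -[X in X * _]expiX expi_2pi expr1n mul1r => ->; rewrite mulr1.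
have injd : {in gtn M &, injective d}.
  move=> i j; rewrite !inE => iM jM /(mulfI (circle_neq0 cc')) E.
  have {}E : expi (2 * pi * i%:R / M%:R : R) = expi (2 * pi * j%:R / M%:R).
    by rewrite -[LHS]mulr1 -(expiN (2 * pi * j%:R / M%:R)) -E mulrCA expiN mulr1.
  have b k : (k < M)%N -> 0 <= (2 * pi * k%:R / M%:R : R) < 2 * pi.
    move=> kM; apply/andP; split.
      by rewrite divr_ge0// !mulr_ge0// pi_ge0.
    have pp0 : 0 < 2 * pi :> R by rewrite mulr_gt0// pi_gt0.
    by rewrite ltr_pdivrMr// (ltr_pM2l pp0) ltr_nat.
  have := expi_eq (b _ iM) (b _ jM) E.
  move/(divIf (lt0r_neq0 MR)); have pp : 2 * pi != 0 :> R.
    by rewrite mulf_neq0// gt_eqF// pi_gt0.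
  by move/(mulfI pp)/eqP; rewrite eqr_nat => /eqP.
pose rs := map c (iota 0 M); pose rs' := map d (iota 0 M).
have urs : uniq rs.
  rewrite map_inj_in_uniq ?iota_uniq// => i j; rewrite !mem_iota !add0n /=.
  exact: injc.
have urs' : uniq rs'.
  rewrite map_inj_in_uniq ?iota_uniq// => i j; rewrite !mem_iota !add0n /=.
  exact: injd.
have sub : {subset rs' <= rs}.
  move=> x /mapP[j]; rewrite mem_iota add0n /= => jM xE; rewrite {x}xE.
  apply/negPn/negP => nin.
  pose p : {poly R[i]} := 'X^M - y%:P.
  have pn0 : p != 0 by rewrite -size_poly_eq0 size_XnsubC.
  have : (size (d j :: rs) < size p)%N.
    apply: max_poly_roots => //=; last by rewrite nin.
    rewrite rootE !hornerE hd subrr eqxx /=.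
    rewrite all_map; apply/allP => i; rewrite mem_iota add0n /= => iM.
    by rewrite rootE !hornerE hc// subrr.
  by rewrite size_XnsubC//= size_map size_iota ltnn.
have [_ eqrs] : (size rs' = size rs) * (rs' =i rs).
  by apply: uniq_min_size => //; rewrite !size_map.
have pe : perm_eq rs rs' by apply: uniq_perm => // x; rewrite eqrs.
have E (e : nat -> R[i]) : (\sum_(k < M) F (e k) = \sum_(x <- map e (iota 0 M)) F x)%E.
  by rewrite big_map -(big_mkord xpredT (fun k => F (e k))) /index_iota subn0.
by rewrite (E c) (E d) (perm_big _ pe).
Qed.

(** The points are symmetric about the middle of the gap, so the potential at [x]
    is also the potential at the mirror image of [x]; the average of these two
    expressions exceeds the value at the middle, term by term. *)
Lemma sum_kern_min (R : realType) (s x : R) (M : nat) : 0 < s -> (0 < M)%N ->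
  0 < x < 2 * pi / M%:R -> x != pi / M%:R ->
  midpot s M < \sum_(k < M) kern s (x / 2 + pi * k%:R / M%:R).
Proof.
move=> s0 M0 /andP[x0 xM] xn.
have MR : (0 : R) < M%:R by rewrite ltr0n.
have ppi := @pi_gt0 R.
set F := \sum_(k < M) _.
have E : F = \sum_(k < M) kern s (pi * (k%:R + 1) / M%:R - x / 2).
  rewrite /F [RHS](reindex_inj rev_ord_inj)/=; apply: eq_bigr => k _.
  rewrite -kernB; congr kern.
  rewrite natrB ?ltn_ord// -natr1; field.
  by rewrite gt_eqF.
have pk k : (k < M)%N -> pi * (k%:R + 1) / M%:R <= pi :> R.
  move=> kM; rewrite ler_pdivrMr// ler_pM2l// natr1 ler_nat//.
have pk0 k : 0 <= pi * k%:R / M%:R :> R.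
  by rewrite divr_ge0// mulr_ge0// pi_ge0.
have pk1 (k : nat) : pi * (k%:R + 1) / M%:R = pi * k%:R / M%:R + pi / M%:R :> R.
  by field; rewrite gt_eqF.
have xM2 : x / 2 < pi / M%:R.
  have -> : pi / M%:R = (2 * pi / M%:R) / 2 :> R by field; rewrite gt_eqF.
  by rewrite ltr_pM2r.
have : 2 * midpot s M < F + F.
  rewrite {2}E /F -big_split /midpot mulr_sumr /=.
  apply: ltr_sum; first by apply/hasP; exists (Ordinal M0) => //; exact: mem_index_enum.
  move=> k _; have kM := ltn_ord k.
  set a := x / 2 + _; set b := _ - x / 2.
  have -> : pi * (2 * k%:R + 1) / (2 * M%:R) = (a + b) / 2 :> R.
    by rewrite /a /b; field; rewrite gt_eqF.
  have := pk _ kM; have := pk0 k; have := pk1 k => e1 e2 e3.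
  apply: kern_midpoint => //; rewrite ?/a ?/b.
  - by apply/andP; split; lra.
  - by apply/andP; split; lra.
  - apply: contraNneq xn => e4; apply/eqP; lra.
by move=> ?; lra.
Qed.

Lemma midpotE (R : realType) (s : R) (M : nat) : (0 < M)%N ->
  midpot s M = \sum_(k < M) kern s (pi / M%:R / 2 + pi * k%:R / M%:R).
Proof.
move=> M0; apply: eq_bigr => k _; congr kern; field.
by rewrite pnatr_eq0 -lt0n.
Qed.

(** Enumerating the points clockwise from the one that precedes [z] places [z] in
    the first gap and makes all the angles involved lie between 0 and [2 pi], where
    [sum_kern_min] applies. The condition [z ^ M = - y] says that [z] is in the
    middle of its gap. *)
Lemma root_potential (R : realType) (s : R) (M : nat) (c : nat -> R[i]) (y z : R[i]) :
  0 < s -> (0 < M)%N -> circle z -> circle y ->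
  {in gtn M &, injective c} -> (forall i, (i < M)%N -> c i ^+ M = y) ->
  (z ^+ M = - y -> potential s c M z = (midpot s M)%:E) /\
  (z ^+ M != - y -> ((midpot s M)%:E < potential s c M z)%E).
Proof.
move=> s0 M0 cz cy injc hc.
have MR : (0 : R) < M%:R by rewrite ltr0n.
have ppi := @pi_gt0 R.
have y0 := circle_neq0 cy.
(* [al / M] is the angle from the preceding point [c'] to [z] *)
have [al /andP[al0 al2] alE] := expi_surj (circleM (circleX M cz) (circleV cy)).
have zM : z ^+ M = y * expi al by rewrite -alE mulrC divfK.
pose x := al / M%:R; pose c' := z * expi (- x).
have xM : x * M%:R = al by rewrite /x divfK// gt_eqF.
have cc' : circle c' by apply: circleM => //; exact: circle_expi.
have hc' : c' ^+ M = y.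
  by rewrite exprMn expiX mulNr xM zM -mulrA expiN mulr1.
have zE : z = c' * expi x by rewrite /c' -mulrA [expi (- x) * _]mulrC expiN mulr1.
have VE : potential s c M z =
    (\sum_(k < M) riesz s (expi x) (expi (- (2 * pi * k%:R / M%:R))))%E.
  rewrite /potential (sum_root_set (fun w => riesz s z w) M0 cc' injc hc hc').
  by apply: eq_bigr => k _; rewrite zE riesz_rot.
have alpi : (z ^+ M == - y) = (al == pi).
  rewrite zM -[- y]mulrN1 (inj_eq (mulfI y0)) -expi_pi.
  apply/eqP/eqP => [|->//]; apply: expi_eq; apply/andP; split; lra.
have [al00|al00] := eqVneq al 0.
  have VI : potential s c M z = +oo%E.
    rewrite VE (bigD1 (Ordinal M0))//= /x al00 mul0r mulr0 mul0r oppr0.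
    rewrite /riesz eqxx addye// gt_eqF//; apply: (@lt_le_trans _ _ 0%E) => //.
    by apply: sume_ge0 => k _; exact: riesz_ge0.
  split; last by rewrite VI ltry.
  by move/eqP; rewrite alpi al00 lt_eqF.
have {al00}al0 : 0 < al by rewrite lt_neqAle eq_sym al00.
have x0 : 0 < x by rewrite divr_gt0.
have x2 : x < 2 * pi / M%:R by rewrite ltr_pM2r ?invr_gt0.
have {}VE : potential s c M z = (\sum_(k < M) kern s (x / 2 + pi * k%:R / M%:R))%:E.
  rewrite VE -sumEFin; apply: eq_bigr => k _.
  have -> : x / 2 + pi * k%:R / M%:R = (x - - (2 * pi * k%:R / M%:R)) / 2.
    by field; rewrite gt_eqF.
  apply: riesz_expi.
  have : 2 * pi * (k%:R + 1) / M%:R <= 2 * pi :> R.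
    by rewrite ler_pdivrMr// ler_pM2l ?mulr_gt0// natr1 ler_nat ltn_ord.
  have : 0 <= 2 * pi * k%:R / M%:R :> R by rewrite divr_ge0// !mulr_ge0// pi_ge0.
  have -> : 2 * pi * (k%:R + 1) / M%:R = 2 * pi * k%:R / M%:R + 2 * pi / M%:R :> R.
    by field; rewrite gt_eqF.
  by move=> ? ?; apply/andP; split; lra.
split.
  move/eqP; rewrite alpi VE => /eqP alp; congr (_%:E).
  by rewrite midpotE// /x alp.
rewrite alpi VE lte_fin => np; apply: sum_kern_min; rewrite ?x0//.
by apply: contraNneq np => e; rewrite -xM e divfK// gt_eqF.
Qed.

(** * Binary digits *)

Definition bit_sum (R : nzRingType) (f : nat -> R) (n m : nat) : R :=
  \sum_(i < n) (odd (m %/ 2 ^ i))%:R * f i.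

Lemma bit_sum_small (R : nzRingType) (f : nat -> R) n n' m : (m < 2 ^ n)%N ->
  (n <= n')%N -> bit_sum f n' m = bit_sum f n m.
Proof.
move=> mn /subnKC <-; rewrite /bit_sum big_split_ord /= [X in _ + X]big1 ?addr0//.
move=> i _; rewrite divn_small ?mul0r//.
by apply: leq_trans mn _; rewrite leq_exp2l// leq_addr.
Qed.

Lemma bit_sum_top (R : nzRingType) (f : nat -> R) n j : (j < 2 ^ n)%N ->
  bit_sum f n.+1 (2 ^ n + j) = f n + bit_sum f n j.
Proof.
move=> jn; rewrite /bit_sum big_ord_recr /= addrC; congr (_ + _).
  by rewrite divnDl ?dvdnn// divnn expn_gt0 divn_small// addn0 mul1r.
apply: eq_bigr => i _; have := ltn_ord i => lin.
have -> : (2 ^ n = 2 ^ (n - i) * 2 ^ i)%N by rewrite -expnD subnK// ltnW.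
by rewrite divnMDl ?expn_gt0// oddD oddX subn_eq0 leqNgt lin.
Qed.

(** * The structure of greedy sequences *)

Definition greedy_upto (R : realType) (s : R) (c : nat -> R[i]) (m : nat) : Prop :=
  (forall i, (i < m)%N -> circle (c i)) /\
  (forall i, (0 < i < m)%N -> forall z, circle z ->
     (potential s c i (c i) <= potential s c i z)%E).

Lemma greedy_greedy_upto (R : realType) (s : R) (a : nat -> R[i]) m :
  greedy s a -> greedy_upto s a m.
Proof.
move=> [ca ga]; split=> [i _|i /andP[i0 _] z cz]; first exact: ca.
by rewrite ga//; apply: ereal_inf_lbound; exists z.
Qed.

Lemma greedy_uptoS (R : realType) (s : R) (c : nat -> R[i]) m m' :
  (m' <= m)%N -> greedy_upto s c m -> greedy_upto s c m'.
Proof.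
move=> mm [cc gc]; split=> [i im|i /andP[i0 im] z cz].
  by apply: cc; exact: leq_trans mm.
by apply: gc => //; rewrite i0 (leq_trans im mm).
Qed.

Lemma potentialD (R : realType) (s : R) (c : nat -> R[i]) M j z :
  (potential s c (M + j) z =
   potential s c M z + potential s (fun i => c (M + i)%N) j z)%E.
Proof. by rewrite /potential big_split_ord. Qed.

(** [A] and [B] are the minima of two functions, both attained at one point, and
    [A'], [B'] are their values at a minimiser of the sum: neither can exceed its
    minimum, since the other one cannot compensate. *)
Lemma common_min (R : realType) (A B A' B' : \bar R) (p q : R) :
  A = p%:E -> B = q%:E -> (A <= A')%E -> (B <= B')%E ->
  (A' + B' <= A + B)%E -> A' = A /\ B' = B.
Proof.
move=> -> ->; case: A' => [a'||]//; case: B' => [b'||]//.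
rewrite -?EFinD !lee_fin => h1 h2 h3; split; congr (_%:E); lra.
Qed.

Lemma expX2 (R : realType) (z : R[i]) n : z ^+ (2 ^ n.+1) = (z ^+ (2 ^ n)) ^+ 2.
Proof. by rewrite -exprM expnSr. Qed.

(** The third clause carries the induction: the next point is known to lie in the
    set of roots only because some minimiser does and minimisers are
    characterised by the potential of the first half. *)
Definition greedy_shape (R : realType) (s : R) n (c : nat -> R[i]) m :=
  [/\ forall i, (i < m)%N -> c i ^+ (2 ^ n) = c 0 ^+ (2 ^ n),
      {in gtn m &, injective c}
    & (m < 2 ^ n)%N -> exists z,
       [/\ circle z, z ^+ (2 ^ n) = c 0 ^+ (2 ^ n),
           potential s c m z = (bit_sum (fun i => midpot s (2 ^ i)) n m)%:E
         & forall z', circle z' -> (potential s c m z <= potential s c m z')%E]].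

(** The first [2 ^ n] points are the solutions of [z ^ (2 ^ n) = c 0 ^ (2 ^ n)];
    their potential is then minimal exactly where [z ^ (2 ^ n)] is the opposite
    of that value. The next [2 ^ n] points can keep to that set while being greedy
    among themselves, so they do. *)
Lemma greedy_structure (R : realType) (s : R) n (c : nat -> R[i]) m : 0 < s ->
  (0 < m <= 2 ^ n)%N -> greedy_upto s c m -> greedy_shape s n c m.
Proof.
move=> s0; elim: n c m => [|n IH] c m.
  rewrite expn0 => /andP[m0 m1] gc; have -> : m = 1%N by lia.
  by split => //; [case|move=> [|i] [|j]].
set M := (2 ^ n)%N; move=> /andP[m0 mM] gc.
have M0 : (0 < M)%N by rewrite expn_gt0.
have c0 : circle (c 0) by apply: gc.1.
pose y := c 0 ^+ M; have cy : circle y by exact: circleX.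
have y0 := circle_neq0 cy.
have [mltM|Mm] := ltnP m M.
  have [h1 h2 h3] := IH c m (introT andP (conj m0 (ltnW mltM))) gc.
  split => // [i im|_]; first by rewrite !expX2 h1.
  have [z [cz zE zV zmin]] := h3 mltM; exists z; split => //.
    by rewrite !expX2 zE.
  by rewrite zV (@bit_sum_small _ _ n)// ltnW.
have gM := greedy_uptoS Mm gc.
have [h1 h2 _] : greedy_shape s n c M by apply: IH => //; rewrite M0 leqnn.
have rootp z (cz : circle z) := @root_potential _ _ _ _ y _ s0 M0 cz cy h2 h1.
have [z1 cz1 z1E] : exists2 z1, circle z1 & z1 ^+ M = - y.
  exists (c 0 * expi (pi / M%:R)); first exact/circleM/circle_expi.
  rewrite exprMn expiX divfK ?pnatr_eq0 -?lt0n// expi_pi mulrN1//.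
have Vmin z : circle z -> ((midpot s M)%:E <= potential s c M z)%E.
  move=> cz; have [e1 e2] := rootp z cz.
  by have [/e1 ->//|/e2/ltW] := eqVneq (z ^+ M) (- y).
have VminP z : circle z -> potential s c M z = (midpot s M)%:E -> z ^+ M = - y.
  move=> cz E; apply/eqP/negPn/negP => /(rootp z cz).2.
  by rewrite E ltxx.
have {}mM : (m <= M + M)%N by rewrite addnn -mul2n -expnS.
case: (ltnP M m) => [{}Mm|mleM]; last first.
  have -> : m = M by lia.
  split => // [i im|_]; first by rewrite !expX2 h1.
  exists z1; split => // [||z' cz'].
  - by rewrite !expX2 z1E sqrrN.
  - rewrite (rootp _ cz1).1//.
    have := @bit_sum_top _ (fun i => midpot s (2 ^ i)) n 0 M0; rewrite addn0 => ->.
    congr (_%:E); rewrite [X in _ + X]big1 ?addr0// => i _.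
    by rewrite div0n mul0r.
  - by rewrite (rootp _ cz1).1// Vmin.
pose j := (m - M)%N; have mE : m = (M + j)%N by rewrite subnKC// ltnW.
have j0 : (0 < j)%N by rewrite subn_gt0.
have jM : (j <= M)%N by rewrite leq_subLR.
rewrite mE in gc *; clearbody j; move=> {mE Mm mM m0 m}.
pose c' i := c (M + i)%N.
have cc' i : (i < j)%N -> circle (c' i) by move=> ij; apply: gc.1; rewrite ltn_add2l.
have c'0 : c' 0 ^+ M = - y.
  apply: VminP; first exact: cc'.
  have ge := Vmin _ (cc' _ j0); apply/eqP; rewrite eq_le ge andbT.
  rewrite -((rootp _ cz1).1 z1E).
  rewrite /c' addn0; apply: gc.2 => //.
  by rewrite M0 -[X in (X < _)%N]addn0 ltn_add2l.
(* A minimiser [z] for the points [c' 0, ..., c' (k - 1)] can be taken with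
   [z ^ M = - y]; it minimises the potential of the first [M] points as well, so
   the point [c' k], which minimises the sum, minimises both. *)
have gc' k : (0 < k <= j)%N -> greedy_upto s c' k.
  elim: k => [//|k IHk] /andP[_ kj].
  split=> [i ik|i /andP[i0]]; first by apply: cc'; exact: leq_trans kj.
  rewrite ltnS leq_eqVlt => /orP[/eqP ik|ik]; last first.
    by move=> z cz; apply: (IHk _).2 => //; [lia|rewrite i0].
  subst i; have gk : greedy_upto s c' k by apply: IHk; lia.
  have [_ _ []] := IH c' k (introT andP (conj i0 (leq_trans (ltnW kj) jM))) gk.
    exact: leq_trans kj jM.
  rewrite c'0 => z [cz zE zV zmin] z' cz'.
  have ck : circle (c' k) by exact: cc'.
  have hk : (potential s c (M + k) (c' k) <= potential s c (M + k) z)%E.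
    by apply: gc.2 => //; rewrite addn_gt0 M0 /= ltn_add2l.
  rewrite !potentialD in hk.
  have zM := (rootp _ cz).1 zE.
  have zle : (potential s c M z <= potential s c M (c' k))%E by rewrite zM Vmin.
  have [_ ->] := common_min zM zV zle (zmin _ ck) hk.
  exact: zmin.
have [k1 k2 k3] : greedy_shape s n c' j.
  by apply: IH; rewrite ?j0//; apply: gc'; rewrite j0 leqnn.
have yNy : y != - y.
  by rewrite -subr_eq0 opprK -mulr2n -mulr_natl mulf_neq0// pnatr_eq0.
have split_lt i : (i < M + j)%N -> (i < M)%N \/ exists2 k, (k < j)%N & i = (M + k)%N.
  move=> ij; case: (ltnP i M) => iM; [by left|right].
  by exists (i - M)%N; [rewrite ltn_subLR|rewrite subnKC].
split.
- move=> i /split_lt[iM|[k kj ->]]; first by rewrite !expX2 h1.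
  by rewrite -/(c' k) !expX2 k1// c'0 sqrrN.
- move=> i i' /split_lt[iM|[k kj ->]] /split_lt[i'M|[k' k'j ->]].
  + exact: h2.
  + move=> /(congr1 (fun z => z ^+ M)).
    by rewrite -/(c' k') h1// (k1 k')// c'0 => /eqP; rewrite (negbTE yNy).
  + move=> /(congr1 (fun z => z ^+ M)) /esym.
    by rewrite -/(c' k) h1// (k1 k)// c'0 => /eqP; rewrite (negbTE yNy).
  + by rewrite -/(c' k) -/(c' k') => /k2 -> //.
- have -> : (M + j < 2 ^ n.+1)%N = (j < M)%N.
    by rewrite expnS mul2n -addnn ltn_add2l.
  move=> /[dup] jlt /k3 [z [cz zE zV zmin]].
  rewrite c'0 in zE; have zM := (rootp _ cz).1 zE.
  exists z; split => // [||z' cz'].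
  + by rewrite !expX2 zE sqrrN.
  + by rewrite potentialD zM zV -EFinD bit_sum_top.
  + by rewrite !potentialD leeD ?zmin// zM Vmin.
Qed.

Theorem greedy_potential (R : realType) (s : R) (a : nat -> R[i]) N : 0 < s ->
  greedy s a -> (0 < N)%N ->
  potential s a N (a N) = (bit_sum (fun i => midpot s (2 ^ i)) N N)%:E.
Proof.
move=> s0 ga N0; have NN : (N < 2 ^ N)%N by exact: ltn_expl.
have [_ _ /(_ NN)[z [cz _ zV zmin]]] : greedy_shape s N a N.
  by apply: greedy_structure => //; [rewrite N0 ltnW|exact: greedy_greedy_upto].
apply/eqP; rewrite eq_le -{1}zV; apply/andP; split.
  by rewrite ga.2//; apply: ereal_inf_lbound; exists z.
by rewrite -zV zmin//; exact: ga.1.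
Qed.

(** * Exchange of limits in series *)

Lemma cvg_eqfun (R : realType) (u v : nat -> R) (l : R) :
  u @ \oo --> l -> u =1 v -> v @ \oo --> l.
Proof. by move=> ul /funext <-. Qed.

Lemma cvg_seq_unique (R : realType) (u : nat -> R) (l l' : R) :
  u @ \oo --> l -> u @ \oo --> l' -> l = l'.
Proof. by move=> /cvg_lim <-// /cvg_lim <-. Qed.

Lemma series_dominated_cvg (R : realType) (v G : nat -> R) (M : R) :
  (forall n, `|v n| <= G n) -> (forall N, series G N <= M) ->
  cvgn (series v).
Proof.
move=> vG GM; apply: normed_cvg.
apply: (@series_le_cvg _ _ G) => //.
- by move=> n; exact: normr_ge0.
- by move=> n; exact: (le_trans (normr_ge0 _) (vG n)).
- apply: nondecreasing_is_cvgn; last by exists M => _ [N _ <-].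
  by apply/nondecreasing_series => n _ _; exact: (le_trans (normr_ge0 _) (vG n)).
Qed.

Lemma series_tail_bound (R : realType) (v G : nat -> R) (l g : R) N :
  (forall n, `|v n| <= G n) -> series v @ \oo --> l -> series G @ \oo --> g ->
  `|l - series v N| <= g - series G N.
Proof.
move=> vG vl Gg.
have h1 : `|series v n - series v N| @[n --> \oo] --> `|l - series v N|.
  by apply: cvg_norm; apply: cvgB => //; exact: cvg_cst.
have h2 : series G n - series G N @[n --> \oo] --> g - series G N.
  by apply: cvgB => //; exact: cvg_cst.
apply: ler_cvg_to h1 h2 _; exists N => // n /= Nn.
rewrite !sub_series_geq//; apply: le_trans (ler_norm_sum _ _ _) _.
by apply: ler_sum => i _.
Qed.

(** Tannery's theorem: the tails are uniformly small, so only finitely many terms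
    have to converge. It serves for the coefficients of a sum of power series and
    for the continuity of the alternating zeta series. *)
Lemma series_dominated_lim (R : realType) (v : nat -> nat -> R) (y G S : nat -> R)
    (M Y : R) :
  (forall K n, `|v K n| <= G n) -> (forall N, series G N <= M) ->
  (forall n, v K n @[K --> \oo] --> y n) ->
  (forall K, series (v K) @ \oo --> S K) -> series y @ \oo --> Y ->
  S @ \oo --> Y.
Proof.
move=> vG GM vy vS yY.
have /cvg_ex[g gE] : cvgn (series G).
  apply: (@series_dominated_cvg _ _ G M) => // n.
  by rewrite ger0_norm//; exact: (le_trans (normr_ge0 _) (vG 0%N n)).
have yG n : `|y n| <= G n.
  apply: ler_cvg_to (cvg_norm (vy n)) (cvg_cst _) _.
  by exists 0%N => // K _; exact: vG.
apply/cvgrPdist_lt => e e0; have e3 : 0 < e / 3 by rewrite divr_gt0.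
have [N _ hN] := (iffLR (cvgrPdist_lt _ _) gE) _ e3.
have {}hN := hN _ (leqnn N).
have tail : g - series G N < e / 3 by apply: le_lt_trans hN; exact: ler_norm.
have fin : series (v K) N @[K --> \oo] --> series y N.
  rewrite /series/=; elim: N {hN tail} => [|N IH].
    under eq_fun do rewrite big_geq//; rewrite big_geq//; exact: cvg_cst.
  under eq_fun do rewrite big_nat_recr//=; rewrite big_nat_recr//=.
  by apply: cvgD => //; exact: vy.
have [K0 _ hK] := (iffLR (cvgrPdist_lt _ _) fin) _ e3.
exists K0 => // K /= KK; have {}hK := hK _ KK.
have h1 := series_tail_bound N yG yY gE.
have h2 := series_tail_bound N (vG K) (vS K) gE.
have -> : Y - S K = (Y - series y N) + (series y N - series (v K) N)
   - (S K - series (v K) N) by ring.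
apply: le_lt_trans (ler_normB _ _) _.
have := ler_normD (Y - series y N) (series y N - series (v K) N).
by move=> h3; simpl in hK; lra.
Qed.

(** * Real-analytic functions *)

(** Normal convergence on a closed interval is part of the definition: it is
    what the products and the sums of analytic functions below require. *)
Definition real_analytic (R : realType) (f : R -> R) (x0 : R) : Prop :=
  exists (r M : R) (c : nat -> R),
    [/\ 0 < r, forall K, series (fun k => `|c k| * r ^+ k) K <= M
      & forall u, `|u| <= r -> series (fun k => c k * u ^+ k) @ \oo --> f (x0 + u)].

Lemma abs_series_smaller (R : realType) (c : nat -> R) (r r' M : R) :
  0 <= r' <= r -> (forall K, series (fun k => `|c k| * r ^+ k) K <= M) ->
  forall K, series (fun k => `|c k| * r' ^+ k) K <= M.
Proof.
move=> /andP[r0 rr] h K; apply: le_trans (h K); apply: ler_sum => k _.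
by rewrite ler_wpM2l// lerXn2r// nnegrE// (le_trans r0).
Qed.

Lemma real_analytic_common (R : realType) (f g : R -> R) x0 :
  real_analytic f x0 -> real_analytic g x0 ->
  exists (r M : R) (c d : nat -> R),
    [/\ 0 < r, forall K, series (fun k => `|c k| * r ^+ k) K <= M,
        forall K, series (fun k => `|d k| * r ^+ k) K <= M,
        forall u, `|u| <= r -> series (fun k => c k * u ^+ k) @ \oo --> f (x0 + u)
      & forall u, `|u| <= r -> series (fun k => d k * u ^+ k) @ \oo --> g (x0 + u)].
Proof.
move=> [r [M [c [r0 hc cf]]]] [r' [M' [d [r'0 hd dg]]]].
exists (Num.min r r'), (Num.max M M'), c, d; split.
- by rewrite lt_min r0.
- move=> K; rewrite le_max; apply/orP; left; apply: abs_series_smaller hc K.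
  by rewrite le_min (ltW r0) (ltW r'0) /= ge_min lexx.
- move=> K; rewrite le_max; apply/orP; right; apply: abs_series_smaller hd K.
  by rewrite le_min (ltW r0) (ltW r'0) /= ge_min lexx orbT.
- by move=> u; rewrite le_min => /andP[+ _]; exact: cf.
- by move=> u; rewrite le_min => /andP[_]; exact: dg.
Qed.

Lemma partial_sumD (R : realType) (f g : nat -> R) n :
  series (fun k => f k + g k) n = series f n + series g n.
Proof. by rewrite /series/= big_split. Qed.

Lemma partial_sumZ (R : realType) (f : nat -> R) a n :
  series (fun k => a * f k) n = a * series f n.
Proof. by rewrite /series/= mulr_sumr. Qed.

Lemma real_analyticD (R : realType) (f g : R -> R) x0 :
  real_analytic f x0 -> real_analytic g x0 -> real_analytic (fun x => f x + g x) x0.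
Proof.
move=> hf hg; have [r [M [c [d [r0 hc hd cf dg]]]]] := real_analytic_common hf hg.
exists r, (M + M), (fun k => c k + d k); split => //.
  move=> K; apply: le_trans (lerD (hc K) (hd K)); rewrite -partial_sumD.
  apply: ler_sum => k _; rewrite -mulrDl ler_wpM2r ?exprn_ge0// ?(ltW r0)//.
  exact: ler_normD.
move=> u ur; apply: (cvg_eqfun (cvgD (cf u ur) (dg u ur))) => K.
rewrite addrfctE -partial_sumD.
by congr (series _ _); apply/funext => k; rewrite mulrDl.
Qed.

Lemma real_analytic_cst (R : realType) (a x0 : R) : real_analytic (fun=> a) x0.
Proof.
pose c k : R := if k is 0%N then a else 0.
have sE (F : nat -> R -> R) K : (forall k x, x = 0 -> F k x = 0) ->
    series (fun k => F k (c k)) K.+1 = F 0%N a.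
  by move=> F0; rewrite /series/= big_nat_recl// big1 ?addr0// => k _; exact: F0.
exists 1, `|a|, c; split => //.
  case=> [|K]; first by rewrite /series/= big_geq.
  rewrite (sE (fun k x => `|x| * 1 ^+ k)) ?expr0 ?mulr1// => k x ->.
  by rewrite normr0 mul0r.
move=> u _; rewrite -cvg_shiftS.
apply: (cvg_eqfun (cvg_cst a)) => K /=.
rewrite (sE (fun k x => x * u ^+ k)) ?expr0 ?mulr1// => k x ->.
by rewrite mul0r.
Qed.

(** A double series: the coefficients of the sum are the sums of the coefficients,
    by Tannery's theorem applied to the partial sums of the power series, whose
    absolute values are at most [G n]. *)
Lemma real_analytic_series (R : realType) (h : nat -> R -> R)
    (b : nat -> nat -> R) (G : nat -> R) (M r x0 : R) (E : R -> R) : 0 < r ->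
  (forall n K, series (fun k => `|b n k| * r ^+ k) K <= G n) ->
  (forall N, series G N <= M) ->
  (forall n u, `|u| <= r -> series (fun k => b n k * u ^+ k) @ \oo --> h n (x0 + u)) ->
  (forall u, `|u| <= r -> series (fun n => h n (x0 + u)) @ \oo --> E (x0 + u)) ->
  real_analytic E x0.
Proof.
move=> r0 bG GM bh hE.
have G0 n : 0 <= G n by have := bG n 0%N; rewrite /series/= big_geq.
have bterm n k : `|b n k| <= G n / r ^+ k.
  rewrite ler_pdivlMr ?exprn_gt0//; apply: le_trans (bG n k.+1).
  rewrite /series/= big_nat_recr//= lerDr sumr_ge0// => i _.
  by rewrite mulr_ge0// exprn_ge0// ltW.
have bcvg k : cvgn (series (fun n => b n k)).
  apply: (@series_dominated_cvg _ _ (fun n => G n / r ^+ k) (M / r ^+ k)) => // N.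
  rewrite /series/= -mulr_suml ler_wpM2r ?invr_ge0 ?exprn_ge0 ?(ltW r0)//.
  exact: GM.
pose c k := limn (series (fun n => b n k)).
have finite K u : series (fun n => series (fun k => b n k * u ^+ k) K) N @[N --> \oo]
    --> series (fun k => c k * u ^+ k) K.
  elim: K => [|K IH].
    rewrite [X in _ --> X](_ : _ = 0); last by rewrite /series/= big_geq.
    apply: cvg_near_cst; apply: nearW => N.
    by rewrite /series/= big1// => n _; rewrite big_geq.
  rewrite [X in _ --> X]/series/= big_nat_recr//=.
  apply: (cvg_eqfun (cvgD IH (cvgM (bcvg K) (cvg_cst (u ^+ K))))) => N.
  rewrite ?addrfctE ?mulrfctE /=.
  rewrite [X in _ + X](_ : _ = series (fun n => b n K * u ^+ K) N); last first.
    by rewrite /series/= mulr_suml.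
  rewrite -partial_sumD; congr (series _ _); apply/funext => n.
  by rewrite [RHS]/series/= big_nat_recr.
exists r, M, c; split => // [K|u ur].
  have absl : series (fun k => `|series (fun n => b n k) N| * r ^+ k) K
      @[N --> \oo] --> series (fun k => `|c k| * r ^+ k) K.
    elim: K => [|K IH].
      rewrite [X in _ --> X](_ : _ = 0); last by rewrite /series/= big_geq.
    apply: cvg_near_cst; apply: nearW => N.
      by rewrite /series/= big_geq.
      rewrite [X in _ --> X]/series/= big_nat_recr//=.
  apply: (cvg_eqfun (cvgD IH (cvgM (cvg_norm (bcvg K)) (cvg_cst (r ^+ K))))) => N.
  rewrite ?addrfctE ?mulrfctE /=.
    by rewrite [RHS]/series/= big_nat_recr.
  apply: ler_cvg_to absl (cvg_cst M) _; apply: nearW => N /=.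
  apply: le_trans (GM N); rewrite /series/=.
  apply: (@le_trans _ _ (\sum_(0 <= k < K) \sum_(0 <= n < N) `|b n k| * r ^+ k)).
    apply: ler_sum => k _; rewrite -mulr_suml ler_wpM2r ?exprn_ge0 ?(ltW r0)//.
    exact: ler_norm_sum.
  by rewrite exchange_big/=; apply: ler_sum => n _; exact: bG.
apply: (@series_dominated_lim _ (fun K n => series (fun k => b n k * u ^+ k) K)
  (fun n => h n (x0 + u)) G (series (fun k => c k * u ^+ k)) M) => //.
- move=> K n; apply: le_trans (bG n K); apply: le_trans (ler_norm_sum _ _ _) _.
  apply: ler_sum => k _; rewrite normrM normrX ler_wpM2l// lerXn2r// nnegrE//.
  exact: ltW.
- by move=> n; exact: bh.
- exact: hE.
Qed.

(** The product is the series of the functions [c_n (x - x0) ^ n g x], which avoids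
    any rearrangement of the Cauchy product. *)
Lemma real_analyticM (R : realType) (f g : R -> R) x0 :
  real_analytic f x0 -> real_analytic g x0 -> real_analytic (fun x => f x * g x) x0.
Proof.
move=> hf hg; have [r [M [c [d [r0 hc hd cf dg]]]]] := real_analytic_common hf hg.
have r0' := ltW r0.
have M0 : 0 <= M by have := hc 0%N; rewrite /series/= big_geq.
pose b n k : R := if (n <= k)%N then c n * d (k - n)%N else 0.
have shift (w : nat -> R) n K : series (fun k => if (n <= k)%N then w (k - n)%N else 0)
    (n + K) = series w K.
  rewrite /series/= (big_cat_nat _ (n := n)) ?leq_addr//=.
  rewrite big_nat_cond big1 ?add0r; last first.
    by move=> k /andP[/andP[_ kn] _]; rewrite leqNgt kn.
  rewrite -{1}[n]add0n big_addn addKn; apply: eq_bigr => k _.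
  by rewrite leq_addl addnK.
have bE n u : (fun k => b n k * u ^+ k) = (fun k =>
    if (n <= k)%N then c n * u ^+ n * (d (k - n)%N * u ^+ (k - n)) else 0).
  apply/funext => k; rewrite /b; case: ifP => [nk|_]; last by rewrite mul0r.
  by rewrite -[in u ^+ k](subnK nk) exprD; ring.
have nbE n : (fun k => `|b n k| * r ^+ k) = (fun k =>
    if (n <= k)%N then `|c n| * r ^+ n * (`|d (k - n)%N| * r ^+ (k - n)) else 0).
  apply/funext => k; rewrite /b; case: ifP => [nk|_]; last by rewrite normr0 mul0r.
  by rewrite -[in r ^+ k](subnK nk) exprD normrM; ring.
apply: (@real_analytic_series _ (fun n x => c n * (x - x0) ^+ n * g x) b
  (fun n => `|c n| * r ^+ n * M) (M * M) r) => //.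
- move=> n K; apply: (@le_trans _ _ (series (fun k => `|b n k| * r ^+ k) (n + K))).
    apply: nondecreasing_series => [k _ _|]; last exact: leq_addl.
    by rewrite mulr_ge0// exprn_ge0.
  rewrite nbE (shift (fun j => `|c n| * r ^+ n * (`|d j| * r ^+ j))) partial_sumZ.
  by rewrite ler_wpM2l// mulr_ge0// exprn_ge0.
- move=> N; rewrite /series/= -mulr_suml ler_wpM2r//; exact: hc.
- move=> n u ur; rewrite addrAC subrr add0r.
  rewrite -(cvg_shiftn n) /=.
  apply: (cvg_eqfun (cvgM (cvg_cst (c n * u ^+ n)) (dg u ur))) => K.
  rewrite ?addrfctE ?mulrfctE /=.

  by rewrite addnC bE (shift (fun j => c n * u ^+ n * (d j * u ^+ j))) partial_sumZ.
- move=> u ur; apply: (cvg_eqfun (cvgM (cf u ur) (cvg_cst (g (x0 + u))))) => K.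
  rewrite ?addrfctE ?mulrfctE /=.
  by rewrite /series/= mulr_suml addrAC subrr add0r.
Qed.

(** If the first [m] coefficients vanish, the [m]-th one is at most a multiple of
    [u], because the sum is zero and the remainder is of order [u ^ m.+1]. *)
Lemma zero_series_coef (R : realType) (c : nat -> R) (r M : R) : 0 < r ->
  (forall K, series (fun k => `|c k| * r ^+ k) K <= M) ->
  (forall u, 0 < u <= r -> series (fun k => c k * u ^+ k) @ \oo --> 0) ->
  forall m, c m = 0.
Proof.
move=> r0 hM h0; elim/ltn_ind => m IH.
have M0 : 0 <= M by have := hM 0%N; rewrite /series/= big_geq.
have bound u : 0 < u <= r -> `|c m| <= u * (M / r ^+ m.+1).
  move=> /andP[u0 ur]; have /= := h0 u; rewrite u0 ur => /(_ isT) hu.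
  rewrite -(ler_pM2r (exprn_gt0 m u0)).
  have l1 : `|series (fun k => c k * u ^+ k) K - c m * u ^+ m| @[K --> \oo]
      --> `|0 - c m * u ^+ m|.
    by apply: cvg_norm; apply: cvgB => //; exact: cvg_cst.
  have -> : `|c m| * u ^+ m = `|0 - c m * u ^+ m|.
    by rewrite sub0r normrN normrM normrX (gtr0_norm u0).
  apply: ler_cvg_to l1 (cvg_cst _) _; exists m.+1 => // K /= mK.
  rewrite [series _ _]/series/= (big_cat_nat _ (n := m.+1))//= big_nat_recr//=.
  rewrite big_nat_cond big1 ?add0r; last first.
    by move=> k /andP[/andP[_ km] _]; rewrite IH// mul0r.
  rewrite addrAC subrr add0r; apply: le_trans (ler_norm_sum _ _ _) _.
  have -> : u * (M / r ^+ m.+1) * u ^+ m = (u / r) ^+ m.+1 * M.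
    by rewrite exprMn exprVn [u ^+ m.+1]exprS; ring.
  apply: le_trans (ler_wpM2l _ (hM K)); last by rewrite exprn_ge0// divr_ge0// ltW.
  rewrite /series/= mulr_sumr [leRHS](big_cat_nat _ (n := m.+1))//=.
  rewrite -[leLHS]add0r lerD//.
    apply: sumr_ge0 => k _; rewrite mulr_ge0 ?exprn_ge0 ?divr_ge0 ?mulr_ge0//.
    - exact: ltW.
    - exact: ltW.
    - by rewrite exprn_ge0// ltW.
  rewrite big_nat_cond [leRHS]big_nat_cond; apply: ler_sum.
  move=> k /andP[/andP[mk _] _]; rewrite normrM mulrCA ler_wpM2l//.
  rewrite normrX (gtr0_norm u0).
  have -> : u ^+ k = (u / r) ^+ k * r ^+ k by rewrite -exprMn divfK// gt_eqF.
  rewrite ler_wpM2r ?exprn_ge0 ?(ltW r0)//; apply: ler_wiXn2l => //.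
    by rewrite divr_ge0// ltW.
  by rewrite ler_pdivrMr// mul1r.
apply/eqP; rewrite -normr_eq0 eq_le normr_ge0 andbT leNgt; apply/negP => cm0.
pose A := M / r ^+ m.+1.
have A0 : 0 <= A by rewrite divr_ge0// exprn_ge0// ltW.
(* small enough for [u * A < `|c m|], which contradicts the bound *)
pose u := Num.min r (`|c m| / (2 * (A + 1))).
have A1 : 0 < 2 * (A + 1) by lra.
have u0 : 0 < u by rewrite lt_min r0 divr_gt0.
have := bound u; rewrite u0 /= ge_min lexx => /(_ isT); apply/negP.
rewrite -ltNge; apply: (@le_lt_trans _ _ (`|c m| / (2 * (A + 1)) * A)).
  by rewrite ler_wpM2r// ge_min lexx orbT.
rewrite -mulrA gtr_pMr//; rewrite mulrC ltr_pdivrMr//; lra.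
Qed.

(** At the supremum of the points where [f] does not vanish, the power series of
    [f] vanishes on the right, hence has zero coefficients, hence vanishes on the
    left as well. *)
Lemma real_analytic_zero (R : realType) (f : R -> R) (a b : R) : a < b ->
  (forall x, a < x -> real_analytic f x) -> (forall x, b < x -> f x = 0) ->
  forall x, a < x -> f x = 0.
Proof.
move=> ab fa fb x ax; apply/eqP/negPn/negP => fx.
pose S := [set t | a < t /\ f t != 0].
have Sx : S x by [].
have Sub : ubound S b.
  move=> t [at_ ft]; rewrite leNgt; apply/negP => /fb e.
  by rewrite e eqxx in ft.
have hS : has_sup S by split; [exists x|exists b].
pose T := sup S.
have aT : a < T by apply: lt_le_trans ax _; apply: ub_le_sup => //; exists b.
have fT t : T < t -> f t = 0.
  move=> Tt; have at_ := lt_trans aT Tt; apply/eqP/negPn/negP => ft.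
  by move: Tt; rewrite ltNge => /negP; apply; apply: ub_le_sup; first by exists b.
have [r [M [c [r0 hM hc]]]] := fa T aT.
have c0 : forall m, c m = 0.
  apply: (zero_series_coef r0 hM) => u /andP[u0 ur].
  by rewrite -(fT (T + u)) ?ltrDl//; apply: hc; rewrite gtr0_norm.
have f0 u : `|u| <= r -> f (T + u) = 0.
  move=> /hc h; apply: (cvg_seq_unique h); apply: cvg_near_cst; apply: nearW => K.
  by rewrite /series/= big1// => k _; rewrite c0 mul0r.
have [t [at_ ft] Tt] := sup_adherent r0 hS.
have tT : t <= T by apply: ub_le_sup => //; exists b.
move: ft; rewrite -(subrKC T t) f0 ?eqxx//.
by rewrite ler0_norm ?subr_le0//; rewrite -/T in Tt; lra.
Qed.

(** * The alternating zeta series *)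

Lemma cos_lipschitz (R : realType) (x y : R) : `|cos x - cos y| <= `|x - y|.
Proof.
wlog xy : x y / y < x => [hw|].
  have [xy|xy|->] := ltgtP x y; [|exact: hw|by rewrite !subrr].
  by rewrite distrC [leRHS]distrC; exact: hw.
have [c _ ->] : exists2 c, c \in `]y, x[ & cos x - cos y = - sin c * (x - y).
  apply: (@MVT _ cos (fun t => - sin t)) => //.
  by apply: continuous_subspaceT => t; exact: continuous_cos.
by rewrite normrM normrN ler_piMl// sin_max.
Qed.

Lemma expR_series (R : realType) (x : R) :
  series (fun k => x ^+ k / k`!%:R) @ \oo --> expR x.
Proof. exact: is_cvg_series_exp_coeff. Qed.

Lemma expR_partial_sum_le (R : realType) (x : R) K : 0 <= x ->
  series (fun k => x ^+ k / k`!%:R) K <= expR x.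
Proof.
move=> x0; apply: nondecreasing_cvgn_le; last exact: is_cvg_series_exp_coeff.
by apply/nondecreasing_series => k _ _; rewrite divr_ge0// exprn_ge0.
Qed.

Lemma real_analytic_expR (R : realType) (t x0 : R) :
  real_analytic (fun x => expR (- (x * t))) x0.
Proof.
exists 1, (expR (- (x0 * t)) * expR `|t|),
  (fun k => expR (- (x0 * t)) * ((- t) ^+ k / k`!%:R)); split => // [K|u _].
  rewrite (_ : (fun k => _) = fun k => expR (- (x0 * t)) * (`|t| ^+ k / k`!%:R)).
    rewrite (partial_sumZ (fun k => `|t| ^+ k / k`!%:R)).
    by rewrite ler_wpM2l ?expR_ge0// expR_partial_sum_le.
  apply/funext => k; rewrite expr1n mulr1 normrM gtr0_norm ?expR_gt0//.
  by rewrite normrM normrX normrN [X in _ * (_ * X)]ger0_norm ?invr_ge0.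
rewrite mulrDl opprD expRD.
apply: (cvg_eqfun (cvgM (cvg_cst (expR (- (x0 * t)))) (@expR_series _ (- (u * t))))) => K.
rewrite /= -(partial_sumZ (fun k => (- (u * t)) ^+ k / k`!%:R)).
congr (series _ _); apply/funext => k.
have -> : - (u * t) = - t * u by ring.
by rewrite exprMn; ring.
Qed.

Section AlternatingZeta.
Variable R : realType.
Implicit Types (x y t e r : R) (n k : nat).

(** The real part of [m ^ - (x + y i)], as a function of [t = ln m]. *)
Definition power_re y t x : R := expR (- (x * t)) * cos (y * t).

Definition ln_odd n : R := ln n.*2.+1%:R.
Definition ln_even n : R := ln n.*2.+2%:R.

Definition eta_term y n x : R := power_re y (ln_odd n) x - power_re y (ln_even n) x.

Lemma ln_odd_ge0 n : 0 <= ln_odd n.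
Proof. by apply: ln_ge0; rewrite ler1n. Qed.

Lemma ln_odd_even n : ln_odd n <= ln_even n.
Proof. by rewrite /ln_odd /ln_even ler_ln ?posrE ?ltr0n// ler_nat. Qed.

Lemma ln_even_odd n : ln_even n <= ln_odd n.+1.
Proof. by rewrite /ln_odd /ln_even ler_ln ?posrE ?ltr0n// ler_nat doubleS. Qed.

(** Differences of consecutive powers with exponent [- e]. The power
    subtracted in one pair exceeds the leading power of the next pair, so the sum
    telescopes to at most 1. This is the majorant of the paired series and of its
    Taylor coefficients. *)
Definition eta_gap e n : R := expR (- (e * ln_odd n)) - expR (- (e * ln_even n)).

Lemma eta_gap_sum e N : 0 <= e -> series (eta_gap e) N <= 1.
Proof.
move=> e0; suff : series (eta_gap e) N <= 1 - expR (- (e * ln_odd N)).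
  by move/le_trans; apply; rewrite gerBl expR_ge0.
elim: N => [|N IH].
  by rewrite /series/= big_geq// /ln_odd ln1 mulr0 oppr0 expR0 subrr.
rewrite /series/= big_nat_recr//=; have := lerD IH (lexx (eta_gap e N)).
move/le_trans; apply; rewrite /eta_gap.
have : expR (- (e * ln_odd N.+1)) <= expR (- (e * ln_even N)).
  by rewrite ler_expR lerN2 ler_wpM2l// ln_even_odd.
by lra.
Qed.

(** The factor [expR e] comes from [ln_even n - ln_odd n <= 1]. *)
Lemma eta_gap_ge e n : 0 < e ->
  expR (- (e * ln_odd n)) * (ln_even n - ln_odd n) <= expR e / e * eta_gap e n.
Proof.
move=> e0; rewrite /eta_gap; set a := ln_odd n; set b := ln_even n.
have ab : a <= b := ln_odd_even n.
have b1 : b - a <= 1.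
  rewrite lerBlDl -ler_expR expRD /a /b /ln_odd /ln_even.
  rewrite !lnK ?posrE ?ltr0n//; have := @expR_ge1Dx R 1.
  have : (n.*2.+2%:R : R) <= n.*2.+1%:R * 2 by rewrite -natrM ler_nat; lia.
  have : (0 : R) < n.*2.+1%:R by rewrite ltr0n.
  by set p := n.*2.+1%:R; set q := n.*2.+2%:R; nra.
have -> : expR (- (e * a)) = expR (- (e * b)) * expR (e * (b - a)).
  by rewrite -expRD; congr expR; ring.
have h1 : 1 + e * (b - a) <= expR (e * (b - a)) by exact: expR_ge1Dx.
have h2 : expR (e * (b - a)) <= expR e.
  by rewrite ler_expR ler_piMr// ltW.
set E := expR (- (e * b)); set F := expR (e * (b - a)) in h1 h2 *.
have -> : expR e / e * (E * F - E) = E * (expR e / e * (F - 1)) by ring.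
rewrite -mulrA ler_wpM2l ?expR_ge0//.
apply: (@le_trans _ _ (expR e * (b - a))).
  by rewrite ler_wpM2r// subr_ge0.
rewrite -mulrA ler_wpM2l ?expR_ge0// mulrC ler_pdivlMr//; lra.
Qed.

Lemma power_re_diff y x n : 0 <= x ->
  `|eta_term y n x| <= expR (- (x * ln_odd n)) * ((ln_even n - ln_odd n) * (`|y| + x)).
Proof.
move=> x0; rewrite /eta_term /power_re; set a := ln_odd n; set b := ln_even n.
have ab : a <= b := ln_odd_even n.
have -> : expR (- (x * b)) = expR (- (x * a)) * expR (- (x * (b - a))).
  by rewrite -expRD; congr expR; ring.
rewrite -mulrA -mulrBr normrM ger0_norm ?expR_ge0// ler_wpM2l ?expR_ge0//.
set E := expR (- (x * (b - a))).
have E1 : E <= 1 by rewrite /E expR_le1 oppr_le0 mulr_ge0// subr_ge0.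
have E2 : 1 - x * (b - a) <= E by rewrite /E; exact: expR_ge1Dx.
have -> : cos (y * a) - E * cos (y * b) =
  (cos (y * a) - cos (y * b)) + (1 - E) * cos (y * b) by ring.
apply: le_trans (ler_normD _ _) _; rewrite mulrDr; apply: lerD.
  apply: le_trans (cos_lipschitz _ _) _; rewrite -mulrBr normrM mulrC distrC.
  by rewrite (@ger0_norm _ (b - a)) ?subr_ge0.
rewrite normrM ger0_norm ?subr_ge0// mulrC.
apply: (@le_trans _ _ (1 - E)); first by rewrite ler_piMl ?subr_ge0// cos_max.
by rewrite mulrC; lra.
Qed.

Lemma eta_term_bound y x n : 0 < x ->
  `|eta_term y n x| <= (`|y| + x) * (expR x / x) * eta_gap x n.
Proof.
move=> x0; apply: le_trans (power_re_diff y n (ltW x0)) _.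
rewrite mulrA [leLHS]mulrC -mulrA ler_wpM2l ?addr_ge0 ?(ltW x0)//.
exact: eta_gap_ge.
Qed.

Lemma eta_gap_sumZ e W N : 0 <= e -> 0 <= W -> series (fun n => W * eta_gap e n) N <= W.
Proof. by move=> e0 W0; rewrite partial_sumZ ler_piMr// eta_gap_sum. Qed.

(** The real part of the alternating zeta function at [x + y i]. *)
Definition eta_re x y : R := limn (series (fun n => eta_term y n x)).

Lemma eta_re_cvg x y : 0 < x -> series (fun n => eta_term y n x) @ \oo --> eta_re x y.
Proof.
move=> x0; apply: (@series_dominated_cvg _ _
  (fun n => (`|y| + x) * (expR x / x) * eta_gap x n) ((`|y| + x) * (expR x / x))).
  by move=> n; exact: eta_term_bound.
move=> N; apply: eta_gap_sumZ; first exact: ltW.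
by rewrite mulr_ge0 ?divr_ge0 ?expR_ge0 ?addr_ge0// ltW.
Qed.

(** The majorant of the paired series is uniform for heights at most 1. *)
Lemma eta_re_cvg0 x (y_ : nat -> R) : 0 < x -> y_ @ \oo --> 0 ->
  (forall j, `|y_ j| <= 1) -> eta_re x (y_ j) @[j --> \oo] --> eta_re x 0.
Proof.
move=> x0 y0 y1; pose W := (1 + x) * (expR x / x).
have W0 : 0 <= W by rewrite mulr_ge0 ?divr_ge0 ?expR_ge0 ?addr_ge0// ltW.
apply: (@series_dominated_lim _ (fun j n => eta_term (y_ j) n x)
  (fun n => eta_term 0 n x) (fun n => W * eta_gap x n) _ W).
- move=> j n; apply: le_trans (eta_term_bound _ _ x0) _.
  rewrite ler_wpM2r ?ler_wpM2r ?lerD2r ?divr_ge0 ?expR_ge0 ?(ltW x0)//.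
  rewrite /eta_gap subr_ge0 ler_expR lerN2 ler_wpM2l ?(ltW x0)//.
  exact: ln_odd_even.
- by move=> N; exact: eta_gap_sumZ (ltW x0) W0.
- move=> n; have cv t : power_re (y_ j) t x @[j --> \oo] --> power_re 0 t x.
    have yt : y_ j * t @[j --> \oo] --> 0 * t by apply: cvgM => //; exact: cvg_cst.
    have cyt := cvg_comp _ _ yt (@continuous_cos R _).
    exact: cvgM (cvg_cst (expR (- (x * t)))) cyt.
  by apply: cvgB; exact: cv.
- by move=> j; exact: eta_re_cvg.
- exact: eta_re_cvg.
Qed.

(** The coefficients of the [n]-th paired term at [x0] are
    [A (- a) ^ k / k! - B (- b) ^ k / k!]; split as
    [(A - B) a ^ k - B (b ^ k - a ^ k)] up to sign, their absolute sum at radius [e]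
    is a multiple of [expR (- (e * a)) * (b - a)], hence of [eta_gap e n]. The radius
    [e = x0 / 2] leaves the exponent [x0 - e = e] for convergence. *)
Lemma eta_re_analytic y x0 : 0 < x0 -> real_analytic (eta_re^~ y) x0.
Proof.
move=> x00; pose e := x0 / 2; have e0 : 0 < e by rewrite divr_gt0.
have x0E : x0 = e + e by rewrite /e; lra.
clearbody e.
pose A n := power_re y (ln_odd n) x0; pose B n := power_re y (ln_even n) x0.
pose c n k := A n * ((- ln_odd n) ^+ k / k`!%:R) - B n * ((- ln_even n) ^+ k / k`!%:R).
pose W := (`|y| + x0 + e) * (expR e / e).
have W0 : 0 <= W.
  by rewrite mulr_ge0 ?divr_ge0 ?expR_ge0 ?addr_ge0// ltW.
apply: (@real_analytic_series _ (eta_term y) c (fun n => W * eta_gap e n) W e) => //.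
- move=> n K; set a := ln_odd n; set b := ln_even n.
  have a0 : 0 <= a := ln_odd_ge0 n.
  have ab : a <= b := ln_odd_even n.
  have b0 := le_trans a0 ab.
  have cE k : `|c n k| * e ^+ k <= `|A n - B n| * ((a * e) ^+ k / k`!%:R)
      + `|B n| * ((b * e) ^+ k / k`!%:R - (a * e) ^+ k / k`!%:R).
    have abk : a ^+ k <= b ^+ k by rewrite lerXn2r// nnegrE.
    rewrite !exprMn.
    have -> : `|A n - B n| * (a ^+ k * e ^+ k / k`!%:R) +
        `|B n| * (b ^+ k * e ^+ k / k`!%:R - a ^+ k * e ^+ k / k`!%:R) =
        (`|A n - B n| * a ^+ k + `|B n| * (b ^+ k - a ^+ k)) / k`!%:R * e ^+ k.
      by ring.
    rewrite ler_wpM2r ?exprn_ge0 ?(ltW e0)// /c.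
    have -> : A n * ((- a) ^+ k / k`!%:R) - B n * ((- b) ^+ k / k`!%:R) =
        (-1) ^+ k * ((A n - B n) * a ^+ k - B n * (b ^+ k - a ^+ k)) / k`!%:R.
      by rewrite (exprNn a) (exprNn b); ring.
    rewrite normrM [X in _ * X <= _]ger0_norm ?invr_ge0// ler_wpM2r ?invr_ge0//.
    rewrite normrM normrX normrN1 expr1n mul1r; apply: le_trans (ler_normB _ _) _.
    rewrite !normrM (@ger0_norm _ (a ^+ k)) ?exprn_ge0//.
    by rewrite (@ger0_norm _ (b ^+ k - a ^+ k))// subr_ge0.
  apply: (@le_trans _ _ (`|A n - B n| * expR (a * e) + `|B n| * (expR (b * e) - expR (a * e)))).
    apply: (@le_trans _ _ (series (fun k => `|A n - B n| * ((a * e) ^+ k / k`!%:R)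
      + `|B n| * ((b * e) ^+ k / k`!%:R - (a * e) ^+ k / k`!%:R)) K)).
      by apply: ler_sum => k _; exact: cE.
    rewrite (partial_sumD (fun k => `|A n - B n| * ((a * e) ^+ k / k`!%:R))).
    rewrite (partial_sumZ (fun k => (a * e) ^+ k / k`!%:R)).
    rewrite (partial_sumZ (fun k => (b * e) ^+ k / k`!%:R - (a * e) ^+ k / k`!%:R)).
    apply: lerD; rewrite ler_wpM2l// ?expR_partial_sum_le ?mulr_ge0// ?(ltW e0)//.
    have cv : series (fun k => (b * e) ^+ k / k`!%:R - (a * e) ^+ k / k`!%:R) @ \oo
        --> expR (b * e) - expR (a * e).
      apply: (cvg_eqfun (cvgB (@expR_series _ (b * e)) (@expR_series _ (a * e)))) => N.
      by rewrite /series/= sumrB.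
    rewrite -(cvg_lim _ cv)//; apply: nondecreasing_cvgn_le; last first.
      by apply/cvg_ex; eexists; exact: cv.
    apply/nondecreasing_series => k _ _; rewrite subr_ge0 ler_wpM2r ?invr_ge0//.
    by rewrite lerXn2r ?nnegrE ?mulr_ge0 ?ler_wpM2r// ltW.
  have h1 : `|A n - B n| <= expR (- (x0 * a)) * ((b - a) * (`|y| + x0)).
    exact: power_re_diff (ltW x00).
  have h2 : `|B n| <= expR (- (x0 * b)).
    rewrite /B /power_re normrM ger0_norm ?expR_ge0// ler_piMr ?expR_ge0//.
    exact: cos_max.
  have h3 : expR (- (x0 * b)) * (expR (b * e) - expR (a * e)) <=
      expR (- (e * a)) * ((b - a) * e).
    have -> : expR (a * e) = expR (b * e) * expR (- (e * (b - a))).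
      by rewrite -expRD; congr expR; ring.
    set F := expR (- (e * (b - a))).
    have -> : expR (- (x0 * b)) * (expR (b * e) - expR (b * e) * F) =
        expR (- (e * b)) * (1 - F).
      have -> : - (e * b) = - (x0 * b) + b * e by rewrite x0E; ring.
      by rewrite expRD; ring.
    rewrite /F.
    apply: ler_pM; rewrite ?expR_ge0//.
    - by rewrite subr_ge0 expR_le1 oppr_le0 mulr_ge0 ?subr_ge0// ltW.
    - by rewrite ler_expR lerN2 ler_wpM2l// ltW.
    - by have := @expR_ge1Dx R (- (e * (b - a))); rewrite [(b - a) * e]mulrC; lra.
  apply: (@le_trans _ _ (expR (- (e * a)) * ((b - a) * (`|y| + x0 + e)))).
    rewrite [in leRHS]mulrDr mulrDr; apply: lerD.
      apply: (le_trans (ler_wpM2r _ h1)); first exact: expR_ge0.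
      rewrite mulrAC -expRD ler_wpM2r//.
        by rewrite mulr_ge0 ?subr_ge0// addr_ge0// ltW.
      by rewrite ler_expR x0E; lra.
    apply: le_trans h3; rewrite ler_wpM2r// subr_ge0 ler_expR ler_wpM2r// ltW//.
  rewrite mulrA [leLHS]mulrC -mulrA ler_wpM2l//.
    by rewrite !addr_ge0// ltW.
  exact: eta_gap_ge.
- by move=> N; exact: eta_gap_sumZ (ltW e0) W0.
- move=> n u _.
  have cv t : series (fun k => power_re y t x0 * ((- t) ^+ k / k`!%:R) * u ^+ k) @ \oo
      --> power_re y t (x0 + u).
    have -> : power_re y t (x0 + u) = power_re y t x0 * expR (- (u * t)).
      by rewrite /power_re mulrDl opprD expRD; ring.
    apply: (cvg_eqfun (cvgM (cvg_cst (power_re y t x0)) (@expR_series _ (- (u * t))))) => K.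
    rewrite /= -(partial_sumZ (fun k => (- (u * t)) ^+ k / k`!%:R)).
    congr (series _ _); apply/funext => k.
    have -> : - (u * t) = - t * u by ring.
    by rewrite exprMn; ring.
  apply: (cvg_eqfun (cvgB (cv (ln_odd n)) (cv (ln_even n)))) => K.
  rewrite [RHS](_ : _ = \sum_(0 <= k < K)
    (power_re y (ln_odd n) x0 * ((- ln_odd n) ^+ k / k`!%:R) * u ^+ k
     - power_re y (ln_even n) x0 * ((- ln_even n) ^+ k / k`!%:R) * u ^+ k)).
    by rewrite sumrB.
  by apply: eq_bigr => k _; rewrite /c /A /B; ring.
- move=> u ue; apply: eta_re_cvg.
  by move: ue; rewrite ler_norml => /andP[ue _]; lra.
Qed.

End AlternatingZeta.

(** * Continuation of the zeta function to the critical interval *)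

Lemma norm_normc (R : realType) (z : R[i]) : `|z| = (normc z)%:C.
Proof. by case: z. Qed.

Lemma Re_le_normc (R : realType) (z : R[i]) : `|complex.Re z| <= normc z.
Proof. by rewrite -lecR -norm_normc normc_ge_Re. Qed.

Lemma Im_le_normc (R : realType) (z : R[i]) : `|complex.Im z| <= normc z.
Proof.
by case: z => x y /=; rewrite -sqrtr_sqr ler_wsqrtr// lerDr sqr_ge0.
Qed.

Lemma normc_le_ReIm (R : realType) (z : R[i]) :
  normc z <= `|complex.Re z| + `|complex.Im z|.
Proof.
case: z => x y /=; rewrite -[leRHS]ger0_norm ?addr_ge0// -sqrtr_sqr ler_wsqrtr//.
rewrite -(real_normK (num_real x)) -(real_normK (num_real y)).
by have := normr_ge0 x; have := normr_ge0 y; nra.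
Qed.

Lemma normcX (R : realType) (z : R[i]) n : normc (z ^+ n) = normc z ^+ n.
Proof.
elim: n => [|n IH]; last by rewrite !exprS normcM IH.
by rewrite !expr0 /= expr0n addr0 expr1n sqrtr1.
Qed.

Lemma normc_ge0 (R : realType) (z : R[i]) : 0 <= normc z.
Proof. by case: z => x y /=; exact: sqrtr_ge0. Qed.

Lemma cvg_Re_Im (R : realType) (v : nat -> R[i]) (l : R[i]) :
  (v : nat -> R[i]^o) @ \oo --> (l : R[i]^o) ->
  (complex.Re (v n) @[n --> \oo] --> complex.Re l) /\
  (complex.Im (v n) @[n --> \oo] --> complex.Im l).
Proof.
move=> /cvgrPdist_lt h; split; apply/cvgrPdist_lt => e e0.
- have e0' : (0 : R[i]) < e%:C by rewrite ltcR.
  have [N _ hN] := h _ e0'; exists N => // n /hN /=; rewrite norm_normc ltcR.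
  by apply: le_lt_trans; rewrite -raddfB; exact: Re_le_normc.
- have e0' : (0 : R[i]) < e%:C by rewrite ltcR.
  have [N _ hN] := h _ e0'; exists N => // n /hN /=; rewrite norm_normc ltcR.
  by apply: le_lt_trans; rewrite -raddfB; exact: Im_le_normc.
Qed.

Lemma cvg_series_Re_Im (R : realType) (v : nat -> R[i]) (l : R[i]) :
  series (v : nat -> R[i]^o) @ \oo --> (l : R[i]^o) ->
  (series (fun n => complex.Re (v n)) @ \oo --> complex.Re l) /\
  (series (fun n => complex.Im (v n)) @ \oo --> complex.Im l).
Proof.
move=> /cvg_Re_Im[h1 h2]; split.
- by apply: (cvg_eqfun h1) => N; rewrite /series/= raddf_sum.
- by apply: (cvg_eqfun h2) => N; rewrite /series/= raddf_sum.
Qed.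

(** The power series of an analytic function is summed normally on a smaller
    disc, its terms being bounded at the radius of the larger one. *)
Lemma analytic_at_normal (R : realType) (f : R[i] -> R[i]) (z0 : R[i]) :
  analytic_at f z0 -> exists (r M : R) (c : nat -> R[i]),
  [/\ 0 < r, forall K, series (fun k => normc (c k) * r ^+ k) K <= M
    & forall w, normc w <= r ->
      (series (fun k => complex.Re (c k * w ^+ k)) @ \oo --> complex.Re (f (z0 + w))) /\
      (series (fun k => complex.Im (c k * w ^+ k)) @ \oo --> complex.Im (f (z0 + w)))].
Proof.
move=> [c [r [r0 h]]]; pose p := r / 2; have p0 : 0 < p by rewrite divr_gt0.
have cv w : normc w < r ->
   (series (fun k => complex.Re (c k * w ^+ k)) @ \oo --> complex.Re (f (z0 + w))) /\
   (series (fun k => complex.Im (c k * w ^+ k)) @ \oo --> complex.Im (f (z0 + w))).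
  move=> wr; have := h (z0 + w); rewrite addrAC subrr add0r => /(_ wr) hw.
  exact: cvg_series_Re_Im hw.
have np : normc (p%:C : R[i]) = p.
  by rewrite /= expr0n addr0 sqrtr_sqr ger0_norm// ltW.
have pr : p < r by rewrite /p; lra.
have /cv[c1 c2] : normc (p%:C : R[i]) < r by rewrite np.
have pX k : (p%:C : R[i]) ^+ k = (p ^+ k)%:C by rewrite rmorphXn.
have bnd (u : nat -> R) : cvgn (series u) -> exists B, forall k, `|u k| <= B.
  move=> /cvg_series_bounded[B [_ hB]]; exists (B + 1) => k.
  by apply: hB => //; rewrite ltrDl.
have [B1 hB1] : exists B, forall k, `|complex.Re (c k * p%:C ^+ k)| <= B.
  by apply: bnd; apply/cvg_ex; eexists; exact: c1.
have [B2 hB2] : exists B, forall k, `|complex.Im (c k * p%:C ^+ k)| <= B.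
  by apply: bnd; apply/cvg_ex; eexists; exact: c2.
have B0 : 0 <= B1 + B2.
  apply: addr_ge0; [exact: le_trans (normr_ge0 _) (hB1 0%N)|].
  exact: le_trans (normr_ge0 _) (hB2 0%N).
exists (p / 2), ((B1 + B2) * 2), c; split.
- by rewrite divr_gt0.
- move=> K; apply: (@le_trans _ _ (series (fun k => (B1 + B2) * 2^-1 ^+ k) K)).
    apply: ler_sum => k _; rewrite exprMn mulrA ler_wpM2r ?exprn_ge0 ?invr_ge0//.
    have -> : normc (c k) * p ^+ k = normc (c k * p%:C ^+ k).
      by rewrite normcM normcX np.
    by apply: le_trans (normc_le_ReIm _) _; apply: lerD.
  rewrite partial_sumZ ler_wpM2l//.
  suff -> : series (fun k => 2^-1 ^+ k) K = 2 - 2 * 2^-1 ^+ K :> R.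
    by rewrite gerBl mulr_ge0// exprn_ge0// invr_ge0.
  elim: K => [|K IH]; first by rewrite /series/= big_geq// expr0 mulr1 subrr.
  rewrite [LHS](_ : _ = series (fun k => 2^-1 ^+ k) K + 2^-1 ^+ K).
    by rewrite IH exprS; field.
  by rewrite /series/= big_nat_recr.
- move=> w wp; apply: cv; apply: le_lt_trans wp _; rewrite /p; lra.
Qed.

Lemma Re_mulr_real (R : realType) (z : R[i]) (u : R) :
  complex.Re (z * u%:C) = complex.Re z * u.
Proof. by case: z => x y /=; rewrite mulr0 subr0. Qed.

Lemma Im_mulr_real (R : realType) (z : R[i]) (u : R) :
  complex.Im (z * u%:C) = complex.Im z * u.
Proof. by case: z => x y /=; rewrite mulr0 add0r. Qed.

Lemma analytic_at_horizontal (R : realType) (f : R[i] -> R[i]) (x0 y : R) :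
  analytic_at f (x0 +i* y) ->
  real_analytic (fun x => complex.Re (f (x +i* y))) x0 /\
  real_analytic (fun x => complex.Im (f (x +i* y))) x0.
Proof.
move=> /analytic_at_normal[r [M [c [r0 hM hc]]]].
have nu (u : R) : normc (u%:C : R[i]) = `|u|.
  by rewrite /= expr0n addr0 sqrtr_sqr.
have shift (u : R) : (x0 +i* y) + u%:C = (x0 + u) +i* y :> R[i].
  by apply/eqP; rewrite eq_complex /= addr0 !eqxx.
split.
- exists r, M, (fun k => complex.Re (c k)); split => // [K|u ur].
    apply: le_trans (hM K); apply: ler_sum => k _.
    by rewrite ler_wpM2r ?exprn_ge0 ?(ltW r0)// Re_le_normc.
  have [|h _] := hc u%:C; first by rewrite nu.
  rewrite -shift; apply: (cvg_eqfun h) => K.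
  by apply: eq_bigr => k _; rewrite -rmorphXn Re_mulr_real.
- exists r, M, (fun k => complex.Im (c k)); split => // [K|u ur].
    apply: le_trans (hM K); apply: ler_sum => k _.
    by rewrite ler_wpM2r ?exprn_ge0 ?(ltW r0)// Im_le_normc.
  have [|_ h] := hc u%:C; first by rewrite nu.
  rewrite -shift; apply: (cvg_eqfun h) => K.
  by apply: eq_bigr => k _; rewrite -rmorphXn Im_mulr_real.
Qed.

(** All terms but the first have a factor [w], and the rest is bounded by the
    normal convergence. *)
Lemma analytic_at_continuous (R : realType) (f : R[i] -> R[i]) (z0 : R[i]) :
  analytic_at f z0 -> exists (r M : R), 0 < r /\ forall w, normc w <= r ->
  `|complex.Re (f (z0 + w)) - complex.Re (f z0)| <= M * normc w /\
  `|complex.Im (f (z0 + w)) - complex.Im (f z0)| <= M * normc w.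
Proof.
move=> /analytic_at_normal[r [M [c [r0 hM hc]]]]; exists r, (M / r); split=> // w wr.
have w0 := normc_ge0 w.
have n0 : normc (0 : R[i]) <= r by rewrite normc0 ltW.
have tail (g : R[i] -> R) : (forall x, `|g x| <= normc x) -> forall K,
    `|series (fun k => g (c k * w ^+ k)) K.+1 - g (c 0%N)| <= M / r * normc w.
  move=> gn K; rewrite /series/= big_nat_recl// expr0 mulr1 addrAC subrr add0r.
  apply: le_trans (ler_norm_sum _ _ _) _.
  have -> : M / r * normc w = normc w / r * M by ring.
  apply: le_trans (ler_wpM2l _ (hM K.+1)); last by rewrite divr_ge0// ltW.
  rewrite /series/= big_nat_recl// mulrDr.
  rewrite -[leLHS]add0r lerD//.
    by rewrite !mulr_ge0 ?normc_ge0 ?exprn_ge0 ?invr_ge0// ltW.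
  rewrite mulr_sumr; apply: ler_sum => k _; apply: le_trans (gn _) _.
  rewrite normcM normcX mulrCA ler_wpM2l ?normc_ge0//.
  rewrite exprS [r ^+ _]exprS mulrA divfK ?gt_eqF// ler_wpM2l//.
  by rewrite lerXn2r// nnegrE ltW.
have at0 (g : R[i] -> R) : g 0 = 0 -> forall l,
    series (fun k => g (c k * 0 ^+ k)) @ \oo --> l -> l = g (c 0%N).
  move=> g0 l hl; apply: (cvg_seq_unique hl); rewrite -cvg_shiftS.
  apply: (cvg_eqfun (cvg_cst (g (c 0%N)))) => K /=.
  rewrite /series/= big_nat_recl// expr0 mulr1 big1 ?addr0// => k _.
  by rewrite expr0n mulr0.
have [r1 i1] := hc _ n0; rewrite addr0 in r1 i1.
have [r2 i2] := hc _ wr.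
have close (g : R[i] -> R) l : (forall x, `|g x| <= normc x) ->
    series (fun k => g (c k * w ^+ k)) @ \oo --> l -> `|l - g (c 0%N)| <= M / r * normc w.
  move=> gn hl.
  have cv : `|series (fun k => g (c k * w ^+ k)) K - g (c 0%N)| @[K --> \oo]
      --> `|l - g (c 0%N)|.
    by apply: cvg_norm; apply: cvgB => //; exact: cvg_cst.
  apply: ler_cvg_to cv (cvg_cst _) _; exists 1%N => // -[//|K] _.
  exact: tail.
split.
- rewrite (at0 _ (raddf0 _) _ r1); apply: close r2.
  exact: Re_le_normc.
- rewrite (at0 _ (raddf0 _) _ i1); apply: close i2.
  exact: Im_le_normc.
Qed.

Section CriticalInterval.
Variables (R : realType) (zeta : R[i] -> R[i]).
Hypothesis zetaP : is_riemann_zeta zeta.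
Implicit Types (x y t s : R).

Definition power_im y t x : R := expR (- (x * t)) * - sin (y * t).

Lemma cexp_power y t x :
  cexp (- (x +i* y) * t%:C) = power_re y t x +i* power_im y t x.
Proof.
have -> : - (x +i* y) * t%:C = (- (x * t)) +i* (- (y * t)) :> R[i].
  by apply/eqP; rewrite eq_complex /= !mulr0 subr0 add0r !mulNr !eqxx.
rewrite /cexp /expi /= cosN sinN /power_re /power_im.
by apply/eqP; rewrite eq_complex /= !mul0r subr0 addr0 !eqxx.
Qed.

(** The real part of [(1 - 2 ^ (1 - z)) * zeta z - eta z]. *)
Definition eta_zeta y x : R :=
  complex.Re (zeta (x +i* y)) - 2 * power_re y (ln 2) x * complex.Re (zeta (x +i* y))
  + 2 * power_im y (ln 2) x * complex.Im (zeta (x +i* y)) - eta_re x y.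

(** In the half-plane of convergence, the partial sums of [eta] are those of the
    Dirichlet series, taken twice as far, minus twice the even terms. *)
Lemma eta_zeta_gt1 y x : 1 < x -> eta_zeta y x = 0.
Proof.
move=> x1; have [/(_ (x +i* y) x1)/cvg_series_Re_Im[hr hi] _] := zetaP.
pose X := series (fun n => power_re y (ln n.+1%:R) x).
pose Y := series (fun n => power_im y (ln n.+1%:R) x).
have {}hr : X @ \oo --> complex.Re (zeta (x +i* y)).
  by apply: (cvg_eqfun hr) => N; apply: eq_bigr => n _; rewrite cexp_power.
have {}hi : Y @ \oo --> complex.Im (zeta (x +i* y)).
  by apply: (cvg_eqfun hi) => N; apply: eq_bigr => n _; rewrite cexp_power.
pose P := power_re y (ln 2) x; pose Q := power_im y (ln 2) x.
have h2 : X N.*2 @[N --> \oo] --> complex.Re (zeta (x +i* y)).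
  have -> : (fun N => X N.*2) = X \o muln 2 by apply/funext => N /=; rewrite mul2n.
  exact: (cvg_comp _ _ (@cvg_mulnl 2 isT) hr).
apply/eqP; rewrite subr_eq0; apply/eqP.
have x0 : 0 < x by lra.
have hL : X N.*2 - 2 * P * X N + 2 * Q * Y N @[N --> \oo] -->
    complex.Re (zeta (x +i* y)) - 2 * P * complex.Re (zeta (x +i* y))
    + 2 * Q * complex.Im (zeta (x +i* y)).
  exact: (cvgD (cvgB h2 (cvgM (cvg_cst (2 * P)) hr)) (cvgM (cvg_cst (2 * Q)) hi)).
apply: (cvg_seq_unique _ (@eta_re_cvg R x y x0)); apply: (cvg_eqfun hL) => N.

have recr (f : nat -> R) K : series f K.+1 = series f K + f K.
  by rewrite /series/= big_nat_recr.
rewrite /X /Y; elim: N => [|N IH]; first by rewrite /series/= !big_geq//; ring.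
rewrite doubleS !recr -{}IH /=.
rewrite /eta_term /ln_odd /ln_even.
have -> : ln N.*2.+2%:R = ln 2 + ln N.+1%:R :> R.
  by rewrite -lnM ?posrE// ?ltr0n// -natrM mul2n.
rewrite /P /Q /power_re /power_im.
rewrite [y * (ln 2 + _)]mulrDr cosD.
have -> : - (x * (ln 2 + ln N.+1%:R)) = - (x * ln 2) + - (x * ln N.+1%:R) :> R by ring.
rewrite expRD; ring.
Qed.

Lemma zeta_analytic_off1 y x : y != 0 -> analytic_at zeta (x +i* y).
Proof.
by move=> y0; apply: zetaP.2; rewrite eq_complex /= negb_and y0 orbT.
Qed.

Lemma real_analytic_power_re y t x : real_analytic (power_re y t) x.
Proof.
by apply: real_analyticM; [exact: real_analytic_expR|exact: real_analytic_cst].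
Qed.

Lemma real_analytic_power_im y t x : real_analytic (power_im y t) x.
Proof.
by apply: real_analyticM; [exact: real_analytic_expR|exact: real_analytic_cst].
Qed.

Lemma eta_zeta_eq0 y x : y != 0 -> 0 < x -> eta_zeta y x = 0.
Proof.
move=> y0 x0; have := @real_analytic_zero R (eta_zeta y) 0 1.
apply => //; last by move=> {x0}x; exact: eta_zeta_gt1.
move=> {x0} x x0; have [hr hi] := analytic_at_horizontal (zeta_analytic_off1 x y0).
have rP := real_analytic_power_re y (ln 2) x.
have rQ := real_analytic_power_im y (ln 2) x.
have rc (a : R) := real_analytic_cst a x.
have rE := real_analyticM (rc (-1)) (eta_re_analytic y x0).
have r2 := real_analyticM (real_analyticM (rc (-2)) rP) hr.
have r3 := real_analyticM (real_analyticM (rc 2) rQ) hi.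
have := real_analyticD (real_analyticD (real_analyticD hr r2) r3) rE.
congr real_analytic; apply/funext => t; rewrite /eta_zeta; ring.
Qed.

(** The point [s] is the limit of [s + y i] as [y] decreases to 0, and both sides of
    the identity are continuous there; at height 0 itself the line would meet the
    pole. *)
Lemma eta_zeta_real s : 0 < s -> s != 1 ->
  (1 - 2 * expR (- (s * ln 2))) * complex.Re (zeta s%:C) = eta_re s 0.
Proof.
move=> s0 s1; have sn : (s%:C : R[i]) != 1.
  by rewrite eq_complex /= negb_and s1.
have [r [M [r0 hM]]] := analytic_at_continuous (zetaP.2 _ sn).
pose y_ (j : nat) : R := j.+1%:R^-1.
have y0 : y_ @ \oo --> 0.
  exact: cvg_harmonic.
have ygt0 j : 0 < y_ j by rewrite invr_gt0.
have near_r : \forall j \near \oo, y_ j <= r.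
  have [N _ hN] := (iffLR (cvgrPdist_lt _ _) y0) _ r0; exists N => // j /hN /=.
  by rewrite sub0r normrN gtr0_norm// => /ltW.
have sE j : (s +i* y_ j) = s%:C + (0 +i* y_ j) :> R[i].
  by apply/eqP; rewrite eq_complex /= addr0 add0r !eqxx.
have nE j : normc (0 +i* y_ j : R[i]) = y_ j.
  by rewrite /= expr0n add0r sqrtr_sqr gtr0_norm.
have My : M * y_ j @[j --> \oo] --> 0.
  by rewrite -(mulr0 M); apply: cvgM => //; exact: cvg_cst.
have lim (g : R[i] -> R) : (forall w, normc w <= r ->
     `|g (s%:C + w) - g s%:C| <= M * normc w) ->
    g (s +i* y_ j) @[j --> \oo] --> g s%:C.
  move=> hg; apply/cvgrPdist_lt => e e0.
  have [N _ hN] := (iffLR (cvgrPdist_lt _ _) My) _ e0; near=> j.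
  rewrite distrC sE; apply: (le_lt_trans (hg _ _)).
    by rewrite nE; near: j.
  rewrite nE; apply: le_lt_trans (ler_norm _) _.
  rewrite -normrN -sub0r; near: j; exists N => //.
have lr := lim (fun z => complex.Re (zeta z)) (fun w hw => (hM w hw).1).
have li := lim (fun z => complex.Im (zeta z)) (fun w hw => (hM w hw).2).
have y1 j : `|y_ j| <= 1 by rewrite gtr0_norm// invf_le1// ler1n.
have le := eta_re_cvg0 s0 y0 y1.
have yl : y_ j * ln 2 @[j --> \oo] --> 0 * ln 2 by apply: cvgM => //; exact: cvg_cst.
have lP : power_re (y_ j) (ln 2) s @[j --> \oo] --> power_re 0 (ln 2) s.
  exact: cvgM (cvg_cst _) (cvg_comp _ _ yl (@continuous_cos R _)).
have lQ : power_im (y_ j) (ln 2) s @[j --> \oo] --> power_im 0 (ln 2) s.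
  exact: cvgM (cvg_cst _) (cvgN (cvg_comp _ _ yl (@continuous_sin R _))).
have h : eta_zeta (y_ j) s @[j --> \oo] -->
    complex.Re (zeta s%:C) - 2 * power_re 0 (ln 2) s * complex.Re (zeta s%:C)
    + 2 * power_im 0 (ln 2) s * complex.Im (zeta s%:C) - eta_re s 0.
  exact: (cvgB (cvgD (cvgB lr (cvgM (cvgM (cvg_cst (2 : R)) lP) lr))
    (cvgM (cvgM (cvg_cst (2 : R)) lQ) li)) le).
have h0 : eta_zeta (y_ j) s @[j --> \oo] --> (0 : R).
  apply: (cvg_eqfun (cvg_cst (0 : R))) => j.
  by rewrite eta_zeta_eq0// gt_eqF.
have e0 := cvg_seq_unique h h0.
move: e0; rewrite /power_re /power_im mul0r cos0 sin0 oppr0 => e0.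
by apply/eqP; rewrite -subr_eq0 -[X in _ == X]e0; apply/eqP; ring.
Unshelve. all: by end_near.
Qed.

End CriticalInterval.

(** * Midpoint sums of inverse powers *)

Section MidpointSums.
Variables (R : realType) (s : R).
Hypotheses (s0 : 0 < s) (s1 : s < 1).
Implicit Types (x y : R) (n k K : nat).

Definition primitive x : R := x `^ (1 - s) / (1 - s).

Let s1' : 0 < 1 - s.
Proof. by rewrite subr_gt0. Qed.

Lemma is_derive_primitive x : 0 < x -> is_derive x 1 primitive (x `^ (- s)).
Proof.
move=> x0; have h := is_derive1_powR (1 - s) x0.
have -> : x `^ (- s) = (1 - s)^-1 *: ((1 - s) * x `^ (1 - s - 1)).
  by rewrite /GRing.scale/= mulKf ?gt_eqF//; congr (_ `^ _); ring.
have -> : primitive = (1 - s)^-1 \*: (fun t => t `^ (1 - s)).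
  by apply/funext => t; rewrite /primitive /GRing.scale/= mulrC.
exact: is_deriveZ.
Qed.

Lemma primitive_bounds x y : 0 < x -> x < y ->
  (y - x) * y `^ (- s) <= primitive y - primitive x <= (y - x) * x `^ (- s).
Proof.
move=> x0 xy.
have [c /andP[xc cy] ->] : exists2 c, c \in `]x, y[ &
    primitive y - primitive x = c `^ (- s) * (y - x).
  apply: (@MVT _ primitive (fun t => t `^ (- s))) => // [t|].
    by rewrite in_itv/= => /andP[xt _]; apply: is_derive_primitive; exact: lt_trans xt.
  apply: derivable_within_continuous => t; rewrite in_itv/= => /andP[xt _].
  have := is_derive_primitive (lt_le_trans x0 xt).
  by move=> h; exact: ex_derive.
have c0 := lt_trans x0 xc; have yx : 0 <= y - x by rewrite subr_ge0 ltW.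
by rewrite [_ * (y - x)]mulrC !ler_wpM2l// powRN_decr// ltW.
Qed.

Definition power_sum : nat -> R := series (fun k => k.+1%:R `^ (- s)).

Definition odd_sum : nat -> R := series (fun k => k.*2.+1%:R `^ (- s)).

Lemma series_recr (f : nat -> R) K : series f K.+1 = series f K + f K.
Proof. by rewrite /series/= big_nat_recr. Qed.

Lemma power_sum_double K :
  power_sum K.*2 = odd_sum K + 2 `^ (- s) * power_sum K.
Proof.
rewrite /power_sum /odd_sum; elim: K => [|K IH].
  by rewrite /series/= !big_geq// mulr0 addr0.
rewrite doubleS !series_recr IH.
have -> : K.*2.+2%:R = 2 * K.+1%:R :> R by rewrite -natrM mul2n.
by rewrite powRM//; ring.
Qed.

(** Comparing a sum with an integral: the differences decrease and stay above
    [- primitive 1]. *)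
Lemma power_sum_cvg : exists l : R,
  power_sum K - primitive K%:R @[K --> \oo] --> l.
Proof.
pose u K := power_sum K.+1 - primitive K.+1%:R.
have st K : (0 < K)%N -> K.+1%:R `^ (- s) <= primitive K.+1%:R - primitive K%:R <= K%:R `^ (- s).
  move=> K0; have K1 : (0 : R) < K%:R by rewrite ltr0n.
  have := @primitive_bounds K%:R K.+1%:R K1; rewrite ltr_nat ltnSn => /(_ isT).
  have -> : K.+1%:R - K%:R = 1 :> R by rewrite -natr1 addrAC subrr add0r.
  by rewrite !mul1r.
have /cvg_ex[l ul] : cvgn u.
  apply: nonincreasing_is_cvgn.
    apply/nonincreasing_seqP => K; rewrite /u [power_sum K.+2]series_recr.
    rewrite -/(power_sum K.+1).
    by have /andP[h _] := st K.+1 isT; lra.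
  exists (- primitive 1) => _ [K _ <-]; rewrite /u.
  suff : primitive K.+1%:R - primitive 1 <= power_sum K.
    rewrite /power_sum [X in _ -> _ <= X - _]series_recr.
    by have := @powR_ge0 R K.+1%:R (- s); lra.
  rewrite /power_sum; elim: K => [|K IH]; first by rewrite subrr /series/= big_geq.
  rewrite series_recr; have /andP[_ h] := st K.+1 isT; lra.
by exists l; rewrite -cvg_shiftS.
Qed.

Lemma eta_term_real n :
  eta_term 0 n s = n.*2.+1%:R `^ (- s) - n.*2.+2%:R `^ (- s).
Proof.
rewrite /eta_term /power_re !mul0r cos0 !mulr1 /powR !pnatr_eq0/=.
by rewrite !mulNr.
Qed.

Lemma eta_partial_sum K :
  series (fun n => eta_term 0 n s) K = odd_sum K - 2 `^ (- s) * power_sum K.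
Proof.
rewrite /power_sum /odd_sum; elim: K => [|K IH].
  by rewrite /series/= !big_geq// mulr0 subr0.
rewrite !series_recr IH eta_term_real.
have -> : K.*2.+2%:R = 2 * K.+1%:R :> R by rewrite -natrM mul2n.
by rewrite powRM//; ring.
Qed.

Lemma eta_real_gt0 : 0 < eta_re s 0.
Proof.
have cv := @eta_re_cvg R s 0 s0.
have t0 n : 0 < eta_term 0 n s.
  rewrite eta_term_real subr_gt0; apply: powRN_sdecr => //.
  by rewrite ltr_nat.
apply: lt_le_trans (t0 0%N) _.
have -> : eta_term 0 0 s = series (fun n => eta_term 0 n s) 1.
  by rewrite /series/= big_nat1.
apply: nondecreasing_cvgn_le; last by apply/cvg_ex; eexists; exact: cv.
by apply/nondecreasing_series => n _ _; exact: ltW.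
Qed.

Variable zeta : R[i] -> R[i].
Hypothesis zetaP : is_riemann_zeta zeta.

Let zs := complex.Re (zeta s%:C).

Lemma two_power : 2 * 2 `^ (- s) = 2 `^ (1 - s) :> R.
Proof. by rewrite powRD ?pnatr_eq0 ?implybT// powRr1. Qed.

Lemma eta_zeta_powR : (1 - 2 * 2 `^ (- s)) * zs = eta_re s 0.
Proof.
rewrite -(@eta_zeta_real _ _ zetaP s s0) ?lt_eqF// /powR pnatr_eq0/=.
by rewrite mulNr.
Qed.

Lemma two_power_gt1 : 1 < 2 * 2 `^ (- s).
Proof.
have -> : 2 * 2 `^ (- s) = expR ((1 - s) * ln 2).
  by rewrite two_power /powR pnatr_eq0.
by rewrite expR_gt1 mulr_gt0// ln_gt0// ltr1n.
Qed.

Lemma zeta_lt0 : zs < 0.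
Proof. by have := eta_real_gt0; have := two_power_gt1; rewrite -eta_zeta_powR; nra. Qed.

(** The partial sums of [eta] are [power_sum K.*2 - 2 ^ (1 - s) * power_sum K], in
    which the terms [primitive] cancel; so the limit [l] given by [power_sum_cvg]
    satisfies [(1 - 2 ^ (1 - s)) l = eta s]. *)
Lemma power_sum_zeta : power_sum K - primitive K%:R @[K --> \oo] --> zs.
Proof.
have [l hl] := power_sum_cvg; suff -> : zs = l by [].
have t1 := two_power_gt1.
have h2 : power_sum K.*2 - primitive K.*2%:R @[K --> \oo] --> l.
  have -> : (fun K => power_sum K.*2 - primitive K.*2%:R) =
      (fun K => power_sum K - primitive K%:R) \o muln 2.
    by apply/funext => K /=; rewrite mul2n.
  exact: (cvg_comp _ _ (@cvg_mulnl 2 isT) hl).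
have h : power_sum K.*2 - primitive K.*2%:R -
    2 * 2 `^ (- s) * (power_sum K - primitive K%:R) @[K --> \oo] -->
    l - 2 * 2 `^ (- s) * l.
  exact: (cvgB h2 (cvgM (cvg_cst (2 * 2 `^ (- s))) hl)).
have : (1 - 2 * 2 `^ (- s)) * zs = l - 2 * 2 `^ (- s) * l.
  rewrite eta_zeta_powR; apply: (cvg_seq_unique (@eta_re_cvg R s 0 s0)).
  apply: (cvg_eqfun h) => K.
  rewrite eta_partial_sum power_sum_double /primitive.
  have -> : K.*2%:R = 2 * K%:R :> R by rewrite -natrM mul2n.
  by rewrite powRM// -two_power; ring.
have t2 : 1 - 2 * 2 `^ (- s) != 0 by rewrite subr_eq0 lt_eqF.
by rewrite -[X in _ = X - _]mul1r -mulrBl => /(mulfI t2).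
Qed.

Definition midpoint_sum : nat -> R := series (fun k => (k%:R + 2^-1) `^ (- s)).

(** [midpoint_sum K] is [2 ^ s] times the sum over odd integers, that is
    [2 ^ s * power_sum K.*2 - power_sum K]. *)
Lemma midpoint_sum_cvg :
  midpoint_sum K - primitive K%:R @[K --> \oo] --> (2 `^ s - 1) * zs.
Proof.
have hl := power_sum_zeta.
have h2 : power_sum K.*2 - primitive K.*2%:R @[K --> \oo] --> zs.
  have -> : (fun K => power_sum K.*2 - primitive K.*2%:R) =
      (fun K => power_sum K - primitive K%:R) \o muln 2.
    by apply/funext => K /=; rewrite mul2n.
  exact: (cvg_comp _ _ (@cvg_mulnl 2 isT) hl).
have h : 2 `^ s * (power_sum K.*2 - primitive K.*2%:R) -
    (power_sum K - primitive K%:R) @[K --> \oo] --> 2 `^ s * zs - zs.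
  exact: (cvgB (cvgM (cvg_cst (2 `^ s)) h2) hl).
rewrite mulrBl mul1r; apply: (cvg_eqfun h) => K.

have -> : midpoint_sum K = 2 `^ s * odd_sum K.
  rewrite -partial_sumZ; apply: eq_bigr => k _.
  have -> : k%:R + 2^-1 = 2^-1 * k.*2.+1%:R :> R.
    have -> : k.*2.+1%:R = 2 * k%:R + 1 :> R by rewrite -natrM mul2n natr1.
    by field.
  rewrite powRM//; congr (_ * _).
  by rewrite -powR_inv1// -powRrM; congr (_ `^ _); ring.
rewrite power_sum_double /primitive.
have -> : K.*2%:R = 2 * K%:R :> R by rewrite -natrM mul2n.
have e1 : 2 `^ s * 2 `^ (- s) = 1 :> R by rewrite powRN mulfV// gt_eqF// powR_gt0.
rewrite powRM// -two_power.
transitivity (2 `^ s * odd_sum K + 2 `^ s * 2 `^ (- s) * power_sum K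
  - 2 * (2 `^ s * 2 `^ (- s)) * (K%:R `^ (1 - s) / (1 - s)) - power_sum K
  + K%:R `^ (1 - s) / (1 - s)).
  by ring.
by rewrite e1; ring.
Qed.

End MidpointSums.

(** * The energy of the circle as a one-dimensional integral *)

Section Reflection.
Local Open Scope ereal_scope.
Variables (R : realType) (c : R).

Let refl (t : measurableTypeR R) : measurableTypeR R := (c - t)%R.

Let measurable_refl : measurable_fun [set: measurableTypeR R] refl.
Proof.
by apply: measurable_funB => //; exact: measurable_id.
Qed.

Let refl_measure : {measure set (measurableTypeR R) -> \bar R} :=
  measure_function_pushforward__canonical__measure_function_Measure
    (@lebesgue_measure R) measurable_refl.

(** Lebesgue measure is determined by the lengths of the intervals. *)
Lemma lebesgue_measure_reflection (A : set (measurableTypeR R)) :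
  measurable A -> lebesgue_measure (refl @^-1` A) = lebesgue_measure A.
Proof.
move=> mA; apply/esym/(@lebesgue_measure_unique R refl_measure) => // {mA A}.
move=> _ [[a b] _ <-] /=; rewrite /refl_measure/= /pushforward.
have -> : refl @^-1` `]a, b]%classic = `[(c - b)%R, (c - a)%R[%classic.
  apply/seteqP; split => t /=; rewrite !in_itv/= /refl => /andP[h1 h2];
  by apply/andP; split; lra.
rewrite !lebesgue_measure_itv/= !lte_fin ltrD2l ltrN2.
by case: ifPn => // ab; rewrite -!EFinB; congr EFin; ring.
Qed.

Lemma integral_reflection (f : measurableTypeR R -> \bar R) (D : set (measurableTypeR R)) :
  measurable D -> measurable_fun setT f -> (forall t, 0 <= f t) ->
  \int[lebesgue_measure]_(t in refl @^-1` D) f (c - t)%R =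
  \int[lebesgue_measure]_(t in D) f t.
Proof.
move=> mD mf f0.
rewrite -(@ge0_integral_pushforward _ _ _ _ _ _ measurable_refl lebesgue_measure D f)//.
- apply: (@eq_measure_integral _ _ _ _ lebesgue_measure) => A mA _.
  exact: lebesgue_measure_reflection.
- exact: measurable_funTS.
Qed.

End Reflection.

Lemma reflection_itv (R : realType) (a b : R) :
  (fun t => a + b - t) @^-1` `[a, b]%classic = `[a, b]%classic.
Proof.
apply/seteqP; split => t /=; rewrite !in_itv/= => /andP[h1 h2];
by apply/andP; split; lra.
Qed.

Lemma integral_itv_reflection (R : realType) (a b : R) (f : measurableTypeR R -> \bar R) :
  measurable_fun setT f -> (forall t, (0 <= f t)%E) ->
  (\int[lebesgue_measure]_(t in `[a, b]) f (a + b - t)%R =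
   \int[lebesgue_measure]_(t in `[a, b]) f t)%E.
Proof.
move=> mf f0; rewrite -(@integral_reflection R (a + b) f `[a, b]%classic)//.
by rewrite reflection_itv.
Qed.

Lemma integral_itv_split (R : realType) (a b c : R) (f : measurableTypeR R -> \bar R) :
  a <= b -> b <= c -> measurable_fun setT f -> (forall t, (0 <= f t)%E) ->
  (\int[lebesgue_measure]_(t in `[a, c]) f t =
   \int[lebesgue_measure]_(t in `[a, b]) f t +
   \int[lebesgue_measure]_(t in `[b, c]) f t)%E.
Proof.
move=> ab bc mf f0.
have -> : `[a, c]%classic = `[a, b]%classic `|` `]b, c]%classic.
  by apply: itv_bndbnd_setU; rewrite bnd_simp.
rewrite ge0_integral_setU//; first last.
- by rewrite disj_set2E; apply/eqP/seteqP; split => t //=;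
    rewrite !in_itv/= => -[/andP[_ h1] /andP[h2 _]]; lra.
- exact: measurable_funTS.
congr (_ + _)%E; apply: integral_itv_obnd_cbnd; exact: measurable_funTS.
Qed.

Section Kernel.
Variables (R : realType) (s : R).
Implicit Types (x y z w : R[i]).

Lemma normc_sub_le z w : `|normc z - normc w| <= normc (z - w).
Proof.
have tri (x y : R[i]) : normc x - normc y <= normc (x - y).
  by rewrite lerBlDr -{1}(subrK y x); exact: le_normcD.
rewrite ler_norml tri andbT lerNl opprB -(normcN (z - w)) opprB.
exact: tri.
Qed.

Lemma continuous_dist z : continuous (fun w : R[i]^o => normc (z - w)).
Proof.
move=> w; have Fw : Filter (nbhs (w : R[i]^o)) by exact: nbhs_filter.
apply/(@cvgrPdist_lt _ _ _ _ Fw) => e e0.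
have e0' : (0 : R[i]) < e%:C by rewrite ltcR.
exists (e%:C : R[i]) => //= u /=; rewrite norm_normc ltcR; apply: le_lt_trans.
apply: le_trans (normc_sub_le _ _) _.
have -> : z - w - (z - u) = - (w - u) by ring.
by rewrite normcN.
Qed.

Lemma measurable_dist z :
  measurable_fun [set: borelC R] (fun w : borelC R => normc (z - w) : measurableTypeR R).
Proof.
apply: (measurability _ (RGenOpens.measurableE R)) => _ [_ [a [b ->] <-]].
rewrite setTI; apply: sub_sigma_algebra.
by apply: open_comp; [move=> w _; exact: continuous_dist|exact: interval_open].
Qed.

Lemma measurable_riesz z : measurable_fun [set: borelC R] (riesz s z : borelC R -> \bar R).
Proof.
pose h (r : measurableTypeR R) : \bar R := if r <= 0 then +oo%E else (r `^ (- s))%:E.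
have -> : (riesz s z : borelC R -> \bar R) = h \o (fun w => normc (z - w)).
  apply/funext => w; rewrite /riesz /h /=; have := normc_ge0 (z - w).
  case: eqVneq => [->|zw n0]; first by rewrite subrr normc0 lexx.
  rewrite ifF//; apply/negbTE; rewrite -ltNge lt_neqAle n0 andbT eq_sym.
  by apply: contra_neq zw => /eq0_normc/eqP; rewrite subr_eq0 => /eqP.
apply: measurableT_comp (measurable_dist z).
apply: measurable_fun_ifT => //.
- by apply: measurable_realfun.measurable_fun_ler.
- by apply/measurable_EFinP; exact: measurable_realfun.measurable_powR.
Qed.

Lemma measurable_circle : measurable (@circle R : set (borelC R)).
Proof.
have -> : (@circle R : set (borelC R)) = (fun w => normc (0 - w)) @^-1` [set 1].
  by apply/seteqP; split => w; rewrite /circle /= sub0r normcN.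
rewrite -[X in measurable X]setTI; exact: measurable_dist.
Qed.

Lemma riesz_sym z w : riesz s z w = riesz s w z.
Proof. by rewrite /riesz eq_sym -normcN opprB. Qed.

(** The kernel seen from the point [1], as a function of the angle in turns. *)
Definition circle_kernel (t : measurableTypeR R) : \bar R := riesz s 1 (circle_param t).

Lemma measurable_circle_kernel : measurable_fun setT circle_kernel.
Proof. exact: (measurableT_comp (measurable_riesz 1) (@measurable_circle_param R)). Qed.

Lemma circle_kernel_ge0 t : (0 <= circle_kernel t)%E.
Proof. exact: riesz_ge0. Qed.

Lemma riesz_param u t :
  riesz s (expi (2 * pi * u)) (expi (2 * pi * t)) = circle_kernel (t - u).
Proof.
rewrite /circle_kernel /circle_param.
have -> : 2 * pi * (t - u) = 2 * pi * t + - (2 * pi * u) by ring.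
rewrite -(@riesz_rot _ s (expi (- (2 * pi * u))) (expi (2 * pi * u))) ?normc_expi//.
by rewrite mulrC expiN mulrC -expiD.
Qed.

Lemma circle_kernelN t : circle_kernel (- t) = circle_kernel t.
Proof.
have := riesz_param t 0; rewrite sub0r => <-.
by rewrite mulr0 expi0 riesz_sym.
Qed.

Lemma circle_kernelD1 t : circle_kernel (t + 1) = circle_kernel t.
Proof. by rewrite /circle_kernel /circle_param mulrDr mulr1 expiD expi_2pi mulr1. Qed.

Lemma integral_arclength (f : borelC R -> \bar R) :
  measurable_fun setT f -> (forall w, (0 <= f w)%E) ->
  (\int[@arclength R]_(w in @circle R) f w =
   \int[lebesgue_measure]_(t in `[0%R, 1%R]) f (circle_param t))%E.
Proof.
move=> mf f0.
rewrite integral_mkcond ge0_integral_distribution//=; last 2 first.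
- apply/(measurable_restrictT f); first exact: measurable_circle.
  exact: measurable_funTS.
- by move=> w; apply: erestrict_ge0 => *; exact: f0.
rewrite (eq_integral (f \o @circle_param R)); last first.
  by move=> t _ /=; rewrite patchE mem_set//; exact: circle_expi.
rewrite integral_uniform//=; last first.
- exact: (measurableT_comp mf (@measurable_circle_param R)).
by rewrite subr0 invr1 mul1e.
Qed.

(** Rotation invariance: cut the interval at the angle of the point and reflect
    each half. *)
Lemma inner_energy z : circle z ->
  (\int[@arclength R]_(w in @circle R) riesz s z w =
   \int[lebesgue_measure]_(t in `[0%R, 1%R]) circle_kernel t)%E.
Proof.
move=> /expi_surj[al /andP[al0 al1] ->].
have pp : 0 < 2 * pi :> R by rewrite mulr_gt0// pi_gt0.
pose u : R := al / (2 * pi); have alE : al = 2 * pi * u.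
  by rewrite /u mulrC divfK// gt_eqF.
have u0 : 0 <= u by rewrite divr_ge0// ltW.
have u1 : u <= 1 by rewrite ler_pdivrMr// mul1r ltW.
clearbody u; rewrite {al al0 al1}alE integral_arclength; last 2 first.
- exact: measurable_riesz.
- by move=> w; exact: riesz_ge0.
have mk := measurable_circle_kernel; have k0 := circle_kernel_ge0.
have msh v : measurable_fun setT (fun t : measurableTypeR R => circle_kernel (t - v)).
  apply: measurableT_comp mk _; apply: measurable_funB => //.
have e1 := @integral_itv_split _ 0 u 1 _ u0 u1 mk k0.
have e2 := @integral_itv_split _ 0 u 1 _ u0 u1 (msh u) (fun t => k0 (t - u)).
transitivity (\int[lebesgue_measure]_(t in `[0%R, 1%R]) circle_kernel (t - u)%R)%E.
  by apply: eq_integral => t _; rewrite riesz_param.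
refine (etrans e2 (etrans _ (esym e1))); apply: (congr2 (fun a b => a + b)%E).
- transitivity (\int[lebesgue_measure]_(t in `[0%R, u]) circle_kernel (0 + u - t)%R)%E.
    apply: eq_integral => t _; rewrite -circle_kernelN; congr circle_kernel; ring.
  exact: integral_itv_reflection.
- transitivity (\int[lebesgue_measure]_(t in `[u, 1%R]) circle_kernel (u + 1 - t)%R)%E.
    apply: eq_integral => t _; rewrite -circle_kernelN -circle_kernelD1.
    by congr circle_kernel; ring.
  exact: integral_itv_reflection.
Qed.

Lemma arclength_circle : arclength R (@circle R) = 1%E.
Proof.
have mC := measurable_circle.
have -> : arclength R (@circle R) = (\int[@arclength R]_(w in @circle R) cst 1 w)%E.
  by rewrite integral_cst// mul1e.
rewrite (@integral_arclength (cst 1%E))//.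
transitivity (1 * lebesgue_measure (`[0%R, 1%R]%classic : set (measurableTypeR R)))%E.
  by rewrite -integral_cst.
by rewrite mul1e lebesgue_measure_itv/= lte_fin ltr01 oppr0 adde0.
Qed.

Lemma energy_circle_kernel : (energy_I s =
  2%:E * \int[lebesgue_measure]_(t in `[0%R, 2^-1%R]) circle_kernel t)%E.
Proof.
have mC := measurable_circle.
transitivity (\int[lebesgue_measure]_(t in `[0%R, 1%R]) circle_kernel t)%E.
  rewrite /energy_I (eq_integral (cst (\int[lebesgue_measure]_(t in `[0%R, 1%R]) circle_kernel t)%E)).
    set J := (X in cst X); transitivity (J * arclength R (@circle R))%E.
      exact: integral_cst.
    by rewrite arclength_circle mule1.
  by move=> z; rewrite inE => cz; exact: inner_energy.
have mk := measurable_circle_kernel; have k0 := circle_kernel_ge0.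
have h0 : 0 <= 2^-1 :> R by rewrite invr_ge0.
have h1 : 2^-1 <= 1 :> R by rewrite invf_le1// ler1n.
rewrite (@integral_itv_split _ 0 2^-1 1 _ h0 h1 mk k0).
rewrite (_ : 2%:E = 1 + 1)%E; last by rewrite -EFinD.
rewrite ge0_muleDl// mul1e; apply: (congr2 (fun a b => a + b)%E) => //.
have mD : measurable (`[0, 2^-1]%classic : set (measurableTypeR R)).
  exact: measurable_itv.
have hr := @integral_reflection R 1 circle_kernel _ mD mk k0.
apply: (etrans _ hr).
have -> : (fun t => 1 - t) @^-1` `[0, 2^-1]%classic = `[2^-1, 1]%classic :> set R.
  apply/seteqP; split => t /=; rewrite !in_itv/= => /andP[? ?];
  by apply/andP; split; lra.
apply: eq_integral => t _.
by rewrite -circle_kernelN -circle_kernelD1; congr circle_kernel; ring.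
Qed.

End Kernel.

(** * The cumulative integral of the kernel *)

(** The mean value theorem, with the continuity of the cosine at 0. *)
Lemma sin_bounds (R : realType) (k : R) : 0 < k < 1 ->
  exists2 d : R, 0 < d & forall x, 0 < x <= d -> k * x <= sin x.
Proof.
move=> /andP[k0 k1].
have : cos x @[x --> (0 : R)] --> (1 : R) by rewrite -[X in _ --> X]cos0; exact: continuous_cos.
move=> /cvgrPdist_lt/(_ (1 - k)); rewrite subr_gt0 => /(_ k1)[d /= d0 hd].
exists (d / 2); first by rewrite divr_gt0.
move=> x /andP[x0 xd].
have [c] : exists2 c, c \in `]0, x[ & sin x - sin 0 = cos c * (x - 0).
  apply: (@MVT _ sin cos) => //.
  by apply: continuous_subspaceT => t; exact: continuous_sin.
rewrite in_itv/= sin0 !subr0 => /andP[c0 cx] ->.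
rewrite ler_wpM2r ?(ltW x0)//; have := hd c; rewrite /ball_/= sub0r normrN gtr0_norm//.
have cd : c < d by apply: lt_trans cx _; lra.
by move=> /(_ cd); have := ler_norm (1 - cos c); lra.
Qed.

Lemma sin_le_id (R : realType) (x : R) : 0 < x -> sin x <= x.
Proof.
move=> x0.
have [c _] : exists2 c, c \in `]0, x[ & sin x - sin 0 = cos c * (x - 0).
  apply: (@MVT _ sin cos) => //.
  by apply: continuous_subspaceT => t; exact: continuous_sin.
by rewrite sin0 !subr0 => ->; rewrite ler_piMl ?(ltW x0)// cos_le1.
Qed.

Section Cumulative.
Variables (R : realType) (s : R).
Hypotheses (s0 : 0 < s) (s1 : s < 1).
Implicit Types (x y t : R).

Definition half_kernel t : R := kern s (pi * t).

Lemma pi_half t : 0 < t <= 2^-1 -> 0 < (pi * t : R) <= pi / 2.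
Proof.
move=> /andP[t0 t1]; rewrite mulr_gt0 ?pi_gt0//=.
by rewrite ler_wpM2l ?pi_ge0.
Qed.

Lemma half_kernel_sin_gt0 t : 0 < t <= 2^-1 -> 0 < sin (pi * t).
Proof.
move=> /pi_half /andP[h1 h2]; apply: sin_gt0_pi; rewrite h1/=.
by have := @pi_gt0 R; lra.
Qed.

Lemma circle_kernelE t : 0 < t <= 2^-1 -> circle_kernel s t = (half_kernel t)%:E.
Proof.
move=> /pi_half /andP[h1 h2].
have e : (2 * pi * t - 0) / 2 = pi * t by field.
rewrite /circle_kernel riesz_sym /circle_param -(expi0 R) riesz_expi e//.
by rewrite h1/=; have := @pi_gt0 R; lra.
Qed.

Lemma half_kernel_decr x y : 0 < x -> x <= y -> y <= 2^-1 ->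
  half_kernel y <= half_kernel x.
Proof.
move=> x0 xy y1; have xx : 0 < x <= 2^-1 by rewrite x0 (le_trans xy).
have yy : 0 < y <= 2^-1 by rewrite (lt_le_trans x0 xy).
apply: powRN_decr; first exact: ltW.
  by rewrite mulr_gt0// half_kernel_sin_gt0.
rewrite ler_wpM2l//.
have /andP[a1 a2] := pi_half xx; have /andP[b1 b2] := pi_half yy.
have := @pi_gt0 R => pp.
move: xy; rewrite le_eqVlt => /orP[/eqP->//|xy].
apply/ltW; rewrite ltr_sin ?in_itv/= ?ltr_pM2l//; apply/andP; split=> //; lra.
Qed.

Lemma half_kernel_ge t : 0 < t <= 2^-1 ->
  (2 * pi) `^ (- s) * t `^ (- s) <= half_kernel t.
Proof.
move=> /[dup] ht /andP[t0 _].
have pp : 0 <= 2 * pi :> R by rewrite mulr_ge0// pi_ge0.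
rewrite -powRM// ?(ltW t0)//; apply: powRN_decr; first exact: ltW.
  by rewrite mulr_gt0// half_kernel_sin_gt0.
by rewrite -mulrA ler_wpM2l// sin_le_id// mulr_gt0// pi_gt0.
Qed.

(** [k] is chosen so that [k ^ (- s) = B]; near 0 the sine is at least [k] times its
    argument. *)
Lemma half_kernel_le (B : R) : 1 < B -> exists2 d : R, 0 < d <= 2^-1 &
  forall t, 0 < t <= d -> half_kernel t <= B * (2 * pi) `^ (- s) * t `^ (- s).
Proof.
move=> B1; have pp := @pi_gt0 R; pose k := B `^ (- s^-1).
have B0 : 0 < B by lra.
have k0 : 0 < k by rewrite powR_gt0.
have kB : k `^ (- s) = B.
  rewrite /k -powRrM mulrNN mulVf ?gt_eqF// powRr1//; exact: ltW.
have k1 : k < 1.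
  rewrite ltNge; apply/negP => k1; have : k `^ (- s) <= 1 `^ (- s).
    by apply: powRN_decr => //; exact: ltW.
  by rewrite kB powR1; lra.
have [|d d0 hd] := @sin_bounds R k; first by rewrite k0.
exists (Num.min 2^-1 (d / pi)).
  by rewrite ge_min lexx andbT lt_min (divr_gt0 d0 pp) andbT invr_gt0.
move=> t /andP[t0]; rewrite le_min => /andP[t1 td].
have ht : 0 < pi * t <= d by rewrite mulr_gt0//= mulrC -ler_pdivlMr.
rewrite -kB -!powRM ?mulr_ge0// ?(ltW k0) ?(ltW t0) ?(ltW pp)//.
apply: powRN_decr; first exact: ltW.
  by rewrite !mulr_gt0.
by have := hd _ ht; nra.
Qed.

Lemma integral_cst_itv (c x y : R) : x <= y ->
  (\int[lebesgue_measure]_(t in `[x, y]) (cst c%:E t) = (c * (y - x))%:E)%E.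
Proof.
move=> xy; have mI : measurable (`[x, y]%classic : set (measurableTypeR R)).
  exact: measurable_itv.
have L : lebesgue_measure (`[x, y]%classic : set (measurableTypeR R)) = (y - x)%:E.
  rewrite lebesgue_measure_itv/= lte_fin; case: ltP => // yx.
  have -> : y = x by lra.
  by rewrite subrr.
transitivity (c%:E * lebesgue_measure (`[x, y]%classic : set (measurableTypeR R)))%E.
  exact: integral_cst.
by rewrite L.
Qed.

Definition slice x y : \bar R :=
  (\int[lebesgue_measure]_(t in `[x, y]) circle_kernel s t)%E.

Lemma slice_ge0 x y : (0 <= slice x y)%E.
Proof. by apply: integral_ge0 => t _; exact: circle_kernel_ge0. Qed.

Lemma slice_bounds x y : 0 < x -> x <= y -> y <= 2^-1 ->
  ((half_kernel y * (y - x))%:E <= slice x y <= (half_kernel x * (y - x))%:E)%E.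
Proof.
move=> x0 xy y1; rewrite -!integral_cst_itv//; apply/andP; split;
  apply: ge0_le_integral => //=.
- by move=> t _; rewrite lee_fin powR_ge0.
- exact: (measurable_funTS (measurable_circle_kernel s)).
- move=> t; rewrite in_itv/= => /andP[xt ty].
  have t0 := lt_le_trans x0 xt.
  by rewrite circle_kernelE ?t0 ?(le_trans ty)// lee_fin half_kernel_decr.
- by move=> t _; exact: circle_kernel_ge0.
- exact: (measurable_funTS (measurable_circle_kernel s)).
- move=> t; rewrite in_itv/= => /andP[xt ty].
  have t0 := lt_le_trans x0 xt; have t1 := le_trans ty y1.
  by rewrite circle_kernelE ?t0// lee_fin half_kernel_decr.
Qed.

Let power (t : measurableTypeR R) : \bar R := (t `^ (- s))%:E.

Let measurable_power : measurable_fun setT power.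
Proof. by apply/measurable_EFinP; exact: measurable_realfun.measurable_powR. Qed.

Lemma integral_power_away x y : 0 < x -> x < y ->
  (\int[lebesgue_measure]_(t in `[x, y]) (t `^ (- s))%:E =
   (primitive s y - primitive s x)%:E)%E.
Proof.
move=> x0 xy.
have dP t : 0 < t -> is_derive t 1 (primitive s) (t `^ (- s)).
  exact: is_derive_primitive.
have cP t : 0 < t -> {for t, continuous (primitive s)}.
  by move=> /dP h; apply/differentiable_continuous/derivable1_diffP; exact: ex_derive.
rewrite (continuous_FTC2 (F := primitive s))//.
- apply: derivable_within_continuous => t; rewrite in_itv/= => /andP[xt _].
  have := is_derive1_powR (- s) (lt_le_trans x0 xt) => h; exact: ex_derive.
- split.
  + move=> t; rewrite in_itv/= => /andP[xt _].
    by have := dP t (lt_trans x0 xt) => h; exact: ex_derive.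
  + exact/cvg_at_right_filter/cP.
  + by apply/cvg_at_left_filter/cP; exact: lt_trans xy.
- move=> t; rewrite in_itv/= => /andP[xt _].
  by have := dP t (lt_trans x0 xt) => h; rewrite derive1E derive_val.
Qed.

(** The integrand is unbounded at 0: exhaust the interval by the [e i, x] with
    [e i] tending to 0. *)
Lemma integral_power x : 0 < x ->
  (\int[lebesgue_measure]_(t in `]0%R, x]) (t `^ (- s))%:E = (primitive s x)%:E)%E.
Proof.
move=> x0; pose e (i : nat) := x / i.+2%:R.
have e0 i : 0 < e i by rewrite divr_gt0.
have ex i : e i < x by rewrite ltr_pdivrMr// ltr_pMr// ltr1n.
pose F (i : nat) : set (measurableTypeR R) := `[e i, x]%classic.
have FE : \bigcup_i F i = `]0, x]%classic.
  apply/seteqP; split => t /=.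
    move=> [i _]; rewrite /F/= !in_itv/= => /andP[h ->]; rewrite andbT.
    exact: lt_le_trans (e0 i) h.
  rewrite in_itv/= => /andP[t0 tx]; exists (Num.truncn (x / t)) => //.
  rewrite /F/= in_itv/= tx andbT /e ler_pdivrMr// mulrC -ler_pdivrMr//.
  apply: ltW; apply: (lt_trans (truncnS_gt _)).
  by rewrite ltr_nat.
have nd : nondecreasing_seq F.
  move=> i j ij; rewrite subsetEset => t; rewrite /F/= !in_itv/= => /andP[h ->].
  rewrite andbT; apply: le_trans h; rewrite /e ler_pM2l// lef_pV2 ?posrE//.
  by rewrite ler_nat.
have cv : (\int[lebesgue_measure]_(t in F i) power t @[i --> \oo] -->
    \int[lebesgue_measure]_(t in `]0%R, x]) power t)%E.
  rewrite -FE; apply: ge0_nondecreasing_set_cvg_integral => //.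
  - by move=> i; exact: measurable_itv.
  - by move=> i; exact: (measurable_funTS measurable_power).
  - by move=> i t _; rewrite lee_fin powR_ge0.
have cv2 : (primitive s x - primitive s (e i))%:E @[i --> \oo] --> (primitive s x)%:E.
  apply: cvg_EFin; first exact: nearW.
  rewrite -[X in _ --> X]subr0; apply: cvgB; first exact: cvg_cst.
  rewrite -[X in _ --> X](mul0r (1 - s)^-1); apply: cvgM; last exact: cvg_cst.
  have s1' : 0 < 1 - s by rewrite subr_gt0.
  have el0 : e i @[i --> \oo] --> (0 : R).
    rewrite -(mulr0 x); apply: cvgM; first exact: cvg_cst.
    by have := @cvg_harmonic R; rewrite -cvg_shiftS.
  have el : e i @[i --> \oo] --> 0^'+.
    move=> A hA; pose B : set R := [set u | 0 < u -> A u].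
    have hB : nbhs (0 : R) B by exact: hA.
    have [N _ hN] : \forall i \near \oo, B (e i) by exact: el0 _ hB.
    by exists N => // i /hN; apply; exact: e0.
  exact: (cvg_comp _ _ el (powR_cvg0 s1')).
have cv1 : (\int[lebesgue_measure]_(t in F i) power t @[i --> \oo] --> (primitive s x)%:E)%E.
  apply: cvg_trans cv2; apply: near_eq_cvg; apply: nearW => i.
  by rewrite -integral_power_away.
by have := cvg_unique _ cv cv1; apply.
Qed.

Lemma slice0E x : slice 0 x = (\int[lebesgue_measure]_(t in `]0%R, x]) circle_kernel s t)%E.
Proof.
apply/esym; apply: integral_itv_obnd_cbnd.
exact: (measurable_funTS (measurable_circle_kernel s)).
Qed.

Lemma slice0_ge x : 0 < x <= 2^-1 -> (((2 * pi) `^ (- s) * primitive s x)%:E <= slice 0 x)%E.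
Proof.
move=> /andP[x0 x1]; rewrite EFinM -integral_power// slice0E.
rewrite -ge0_integralZl//=; last 3 first.
- exact: (measurable_funTS measurable_power).
- by move=> t _; rewrite lee_fin powR_ge0.
- by rewrite lee_fin ?powR_ge0.
apply: ge0_le_integral => //=.
- by move=> t _; rewrite -EFinM lee_fin mulr_ge0// powR_ge0.
- by apply: measurable_funeM; exact: (measurable_funTS measurable_power).
- exact: (measurable_funTS (measurable_circle_kernel s)).
- move=> t; rewrite in_itv/= => /andP[t0 tx].
  rewrite circle_kernelE ?t0 ?(le_trans tx)// -EFinM lee_fin.
  by apply: half_kernel_ge; rewrite t0 (le_trans tx).
Qed.

Lemma slice0_le (B x : R) : 0 <= B -> 0 < x <= 2^-1 ->
  (forall t, 0 < t <= x -> half_kernel t <= B * t `^ (- s)) ->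
  (slice 0 x <= (B * primitive s x)%:E)%E.
Proof.
move=> B0 /andP[x0 x1] hB; rewrite EFinM -integral_power// slice0E.
rewrite -ge0_integralZl//=; last 2 first.
- exact: (measurable_funTS measurable_power).
- by move=> t _; rewrite lee_fin powR_ge0.
apply: ge0_le_integral => //=.
- by move=> t _; exact: circle_kernel_ge0.
- exact: (measurable_funTS (measurable_circle_kernel s)).
- by apply: measurable_funeM; exact: (measurable_funTS measurable_power).
- move=> t; rewrite in_itv/= => /andP[t0 tx].
  rewrite circle_kernelE ?t0 ?(le_trans tx)// -EFinM lee_fin.
  by apply: hB; rewrite t0.
Qed.

Lemma slice_split x y : 0 <= x -> x <= y -> (slice 0 y = slice 0 x + slice x y)%E.
Proof.
move=> x0 xy; apply: integral_itv_split => //.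
  exact: measurable_circle_kernel.
exact: circle_kernel_ge0.
Qed.

(** Near 0 the kernel is at most an integrable power, and on the rest of the
    interval it is bounded. *)
Lemma slice0_fin x : 0 < x <= 2^-1 -> slice 0 x \is a fin_num.
Proof.
move=> /andP[x0 x1]; rewrite ge0_fin_numE ?slice_ge0//.
have [d /andP[d0 d1] hd] := @half_kernel_le 2 (ltr1n _ 2).
pose m := Num.min d x.
have m0 : 0 < m by rewrite lt_min d0.
have mx : m <= x by rewrite ge_min lexx orbT.
have md : m <= d by rewrite ge_min lexx.
rewrite (slice_split (ltW m0) mx); apply: lte_add_pinfty.
  apply: le_lt_trans (ltry _); apply: slice0_le; last first.
  - by move=> t /andP[t0 tm]; apply: hd; rewrite t0 (le_trans tm).
  - by rewrite m0 (le_trans mx).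
  - by rewrite mulr_ge0// powR_ge0.
by have /andP[_ /le_lt_trans] := slice_bounds m0 mx x1; apply; exact: ltry.
Qed.

Definition cumul_kernel x : R := fine (slice 0 x).

Lemma energy_cumulative : energy_I s = (2 * cumul_kernel 2^-1)%:E.
Proof.
have h : 0 < (2^-1 : R) <= 2^-1 by rewrite lexx andbT invr_gt0.
by rewrite energy_circle_kernel EFinM fineK// slice0_fin.
Qed.

Lemma cumulative_bounds x y : 0 < x -> x <= y -> y <= 2^-1 ->
  half_kernel y * (y - x) <= cumul_kernel y - cumul_kernel x <= half_kernel x * (y - x).
Proof.
move=> x0 xy y1.
have fx : slice 0 x \is a fin_num by rewrite slice0_fin// x0 (le_trans xy).
have fy : slice 0 y \is a fin_num by rewrite slice0_fin// (lt_le_trans x0 xy).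
have := slice_bounds x0 xy y1.
have -> : slice x y = (cumul_kernel y - cumul_kernel x)%:E.
  rewrite EFinB !fineK// (slice_split (ltW x0) xy) addeAC subee// add0e//.
by rewrite !lee_fin.
Qed.

Lemma cumulative_ge x : 0 < x <= 2^-1 ->
  (2 * pi) `^ (- s) * primitive s x <= cumul_kernel x.
Proof. by move=> hx; rewrite -lee_fin /cumul_kernel fineK ?slice0_fin// slice0_ge. Qed.

Lemma cumulative_le (B x : R) : 0 <= B -> 0 < x <= 2^-1 ->
  (forall t, 0 < t <= x -> half_kernel t <= B * t `^ (- s)) ->
  cumul_kernel x <= B * primitive s x.
Proof. by move=> B0 hx hB; rewrite -lee_fin /cumul_kernel fineK ?slice0_fin// slice0_le. Qed.

End Cumulative.

(** * Asymptotics of the minimal potential of equally spaced points *)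

Lemma cvg_natr_powRN (R : realType) (s : R) : 0 < s ->
  (K.+1%:R : R) `^ (- s) @[K --> \oo] --> 0.
Proof.
move=> s0; pose e (K : nat) : R := K.+1%:R^-1.
have e0 K : 0 < e K by rewrite invr_gt0.
have el : e K @[K --> \oo] --> 0^'+.
  move=> A hA; pose B : set R := [set u | 0 < u -> A u].
  have hB : nbhs (0 : R) B by exact: hA.
  have [N _ hN] : \forall i \near \oo, B (e i) by exact: (@cvg_harmonic R _ hB).
  by exists N => // i /hN; apply; exact: e0.
apply: (cvg_eqfun (cvg_comp _ _ el (powR_cvg0 s0))) => K /=.
by rewrite /e -powR_inv1// -powRrM mulN1r.
Qed.

Section Asymptotics.
Variables (R : realType) (s : R).
Hypotheses (s0 : 0 < s) (s1 : s < 1).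

Local Notation f := (half_kernel s).
Local Notation Phi := (cumul_kernel s).

Lemma midpot_half m : (0 < m)%N ->
  midpot s m.*2 = 2 * series (fun k => f ((k%:R + 2^-1) / m.*2%:R)) m.
Proof.
move=> m0; rewrite /midpot -addnn big_split_ord /= addnn.
have m2 : (m.*2%:R : R) != 0 by rewrite pnatr_eq0 double_eq0 -lt0n.
rewrite [X in _ + X](reindex_inj rev_ord_inj)/=.
have E (k : 'I_m) : kern s (pi * (2 * (m + (m - k.+1))%:R + 1) / (2 * m.*2%:R)) =
    kern s (pi * (2 * k%:R + 1) / (2 * m.*2%:R)).
  rewrite -kernB; congr kern.
  rewrite addnBA// addnn natrB; last by rewrite -addnn (leq_trans (ltn_ord k))// leq_addr.
  by rewrite -natr1; field.
under [X in _ + X]eq_bigr do rewrite E.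
transitivity (2 * \sum_(k < m) kern s (pi * (2 * k%:R + 1) / (2 * m.*2%:R))).
  by ring.
rewrite /series/= big_mkord; congr (_ * _).
apply: eq_bigr => k _; rewrite /half_kernel; congr kern; field.
by rewrite m2.
Qed.

(** On each cell the kernel at the midpoint and its average lie between its values
    at the endpoints, so the errors telescope. *)
Lemma tail_error (m K : nat) : (0 < K <= m)%N ->
  `|\sum_(K <= k < m) f ((k%:R + 2^-1) / m.*2%:R)
     - m.*2%:R * (Phi 2^-1 - Phi (K%:R / m.*2%:R))| <= f (K%:R / m.*2%:R).
Proof.
move=> /andP[K0 Km]; have m0 : (0 < m)%N by exact: leq_trans Km.
set N : R := m.*2%:R.
have N0 : 0 < N by rewrite ltr0n double_gt0.
have NE : N = 2 * m%:R by rewrite /N -natrM mul2n.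
have mN : m%:R / N = 2^-1.
  rewrite NE; field; by rewrite pnatr_eq0 -lt0n.
have term k : (K <= k < m)%N ->
    `|f ((k%:R + 2^-1) / N) - N * (Phi (k.+1%:R / N) - Phi (k%:R / N))| <=
    f (k%:R / N) - f (k.+1%:R / N).
  move=> /andP[Kk km]; have k0 : 0 < k%:R / N.
    by rewrite divr_gt0// ltr0n (leq_trans K0).
  have k1 : k.+1%:R / N <= 2^-1 by rewrite -mN ler_pM2r ?invr_gt0// ler_nat.
  have kE : k.+1%:R / N = k%:R / N + N^-1 by rewrite -natr1 mulrDl mul1r.
  have hE : (k%:R + 2^-1) / N = k%:R / N + N^-1 / 2 by ring.
  have V0 : 0 < N^-1 by rewrite invr_gt0.
  have kk : k%:R / N <= k.+1%:R / N by rewrite kE; lra.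
  have h1 : f ((k%:R + 2^-1) / N) <= f (k%:R / N).
    by apply: half_kernel_decr => //; rewrite hE; rewrite kE in k1; lra.
  have h2 : f (k.+1%:R / N) <= f ((k%:R + 2^-1) / N).
    by apply: half_kernel_decr => //; rewrite hE ?kE; lra.
  have /andP[h3 h4] := cumulative_bounds s0 s1 k0 kk k1.
  have dE : k.+1%:R / N - k%:R / N = N^-1 by rewrite kE; ring.
  rewrite dE !ler_pdivlMr ?ler_pdivrMr// in h3 h4.
  by rewrite ler_norml; apply/andP; split; rewrite [N * _]mulrC; lra.
have -> : Phi 2^-1 - Phi (K%:R / N) =
    \sum_(K <= k < m) (Phi (k.+1%:R / N) - Phi (k%:R / N)).
  by rewrite (telescope_sumr (fun k => Phi (k%:R / N)))// mN.
rewrite mulr_sumr -sumrB; apply: le_trans (ler_norm_sum _ _ _) _.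
apply: (@le_trans _ _ (\sum_(K <= k < m) (f (k%:R / N) - f (k.+1%:R / N)))).
  exact: ler_sum_nat.
rewrite -(eq_bigr _ (fun k _ => opprB (f (k.+1%:R / N)) (f (k%:R / N)))) sumrN.
rewrite (telescope_sumr (fun k => f (k%:R / N)))// opprB gerBl.
exact: powR_ge0.
Qed.

(** On the first [K] cells the kernel is between [c t ^ (- s)] and [B c t ^ (- s)],
    for which both the sum and the integral scale by [N ^ s]. *)
Lemma head_error (m K : nat) (B : R) : (0 < K <= m)%N -> 1 <= B ->
  (forall t, 0 < t <= K%:R / m.*2%:R -> f t <= B * (2 * pi) `^ (- s) * t `^ (- s)) ->
  `|series (fun k => f ((k%:R + 2^-1) / m.*2%:R)) K - m.*2%:R * Phi (K%:R / m.*2%:R)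
    - m.*2%:R `^ s * ((2 * pi) `^ (- s) * (midpoint_sum s K - primitive s K%:R))| <=
  m.*2%:R `^ s * ((B - 1) * (2 * pi) `^ (- s) * (midpoint_sum s K + primitive s K%:R)).
Proof.
move=> /andP[K0 Km] B1 hB; have m0 : (0 < m)%N by exact: leq_trans Km.
set N : R := m.*2%:R; set c := (2 * pi) `^ (- s); rewrite -/N -/c in hB.
have N0 : 0 < N by rewrite ltr0n double_gt0.
have NE : N = 2 * m%:R by rewrite /N -natrM mul2n.
have c0 : 0 <= c by exact: powR_ge0.
have B0 : 0 <= B by lra.
have K0' : (0 : R) < K%:R by rewrite ltr0n.
have KN : 0 < (K%:R / N : R) <= 2^-1.
  rewrite divr_gt0//= NE ler_pdivrMr ?mulr_gt0 ?ltr0n//.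
  have : (K%:R : R) <= m%:R by rewrite ler_nat.
  lra.
have sE x : 0 <= x -> (x / N) `^ (- s) = N `^ s * x `^ (- s).
  move=> x0; rewrite powRM ?invr_ge0 ?(ltW N0)// mulrC; congr (_ * _).
  by rewrite -powR_inv1 ?(ltW N0)// -powRrM mulN1r opprK.
have pE : N * primitive s (K%:R / N) = N `^ s * primitive s K%:R.
  rewrite /primitive powRM ?invr_ge0 ?(ltW N0)//.
  have -> : N^-1 `^ (1 - s) = N `^ s / N.
    rewrite -powR_inv1 ?(ltW N0)// -powRrM.
    have -> : -1 * (1 - s) = s + -1 by ring.
    by rewrite powRD ?powR_inv1 ?(ltW N0)// (gt_eqF N0) implybT.
  by field; rewrite !gt_eqF// subr_gt0.
have mid k : (0 : R) < k%:R + 2^-1 by rewrite ltr_wpDl// invr_gt0.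
have midK k : (k < K)%N -> 0 < ((k%:R + 2^-1) / N : R) <= K%:R / N.
  move=> kK; rewrite divr_gt0//= ler_pM2r ?invr_gt0//.
  have : (k.+1%:R : R) <= K%:R by rewrite ler_nat.
  by rewrite -natr1; lra.
have low : N `^ s * (c * midpoint_sum s K) <= series (fun k => f ((k%:R + 2^-1) / N)) K.
  rewrite /midpoint_sum /series/= !mulr_sumr.
  apply: ler_sum_nat => k /andP[_ kK]; have /andP[t0 tK] := midK _ kK.
  rewrite mulrCA -sE ?(ltW (mid k))//; apply: half_kernel_ge => //.
  by rewrite t0 (le_trans tK)//; case/andP: KN.
have upp : series (fun k => f ((k%:R + 2^-1) / N)) K <= N `^ s * (B * c * midpoint_sum s K).
  rewrite /midpoint_sum /series/= !mulr_sumr.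
  apply: ler_sum_nat => k /andP[_ kK].
  by rewrite mulrCA -sE ?(ltW (mid k))//; apply: hB; exact: midK.
have lowP : N `^ s * (c * primitive s K%:R) <= N * Phi (K%:R / N).
  have -> : N `^ s * (c * primitive s K%:R) = N * (c * primitive s (K%:R / N)).
    by rewrite mulrCA -pE; ring.
  by rewrite ler_pM2l// cumulative_ge.
have uppP : N * Phi (K%:R / N) <= N `^ s * (B * c * primitive s K%:R).
  have -> : N `^ s * (B * c * primitive s K%:R) = N * (B * c * primitive s (K%:R / N)).
    by rewrite mulrCA -pE; ring.
  rewrite ler_pM2l//; apply: cumulative_le => //.
  exact: mulr_ge0.
set n := N `^ s in low upp lowP uppP *.
have n0 : 0 <= n by exact: powR_ge0.
set sg := midpoint_sum s K in low upp *; set p := primitive s K%:R in lowP uppP *.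
have sg0 : 0 <= sg by apply: sumr_ge0 => k _; exact: powR_ge0.
have p0 : 0 <= p by rewrite /p /primitive divr_ge0 ?powR_ge0// ltW// subr_gt0.
have B1' : 0 <= B - 1 by rewrite subr_ge0.
have h1 : 0 <= n * ((B - 1) * c * sg) by do 3 apply: mulr_ge0 => //.
have h2 : 0 <= n * ((B - 1) * c * p) by do 3 apply: mulr_ge0 => //.
have e1 : n * ((B - 1) * c * sg) = n * (B * c * sg) - n * (c * sg) by ring.
have e2 : n * ((B - 1) * c * p) = n * (B * c * p) - n * (c * p) by ring.
have -> : n * (c * (sg - p)) = n * (c * sg) - n * (c * p) by ring.
have -> : n * ((B - 1) * c * (sg + p)) = n * ((B - 1) * c * sg) + n * ((B - 1) * c * p).
  by ring.
rewrite ler_norml; apply/andP; split; lra.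
Qed.

(** The choices are made in this order: [K], so that the sum is close to its limit
    and the tail is small; then [B] close to 1, depending on [K]; then [m], so that
    the first [K] cells are in the range where [B] is valid. *)
Theorem midpot_asymptotics (l : R) :
  midpoint_sum s K - primitive s K%:R @[K --> \oo] --> l ->
  (midpot s m.*2 - m.*2%:R * (2 * Phi 2^-1)) / m.*2%:R `^ s @[m --> \oo] -->
  2 * ((2 * pi) `^ (- s) * l).
Proof.
move=> hl; set c := (2 * pi) `^ (- s).
have c0 : 0 < c by rewrite powR_gt0// mulr_gt0// pi_gt0.
apply/cvgrPdist_lt => e e0.
pose e' := e / 8 / c.
have e'0 : 0 < e' by rewrite !divr_gt0.
have [K1 _ hK1] := (iffLR (cvgrPdist_lt _ _) hl) _ e'0.
have [K2 _ hK2] := (iffLR (cvgrPdist_lt _ _) (cvg_natr_powRN s0)) _ e'0.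
pose K := (maxn K1 K2).+1.
have hT : `|l - (midpoint_sum s K - primitive s K%:R)| < e'.
  by apply: hK1; rewrite /= /K; lia.
have hP : K%:R `^ (- s) < e'.
  have := hK2 (maxn K1 K2); rewrite /= sub0r normrN ger0_norm ?powR_ge0//; apply.
  by lia.
set T := midpoint_sum s K - primitive s K%:R in hT.
pose S := midpoint_sum s K + primitive s K%:R.
have S0 : 0 <= S.
  rewrite addr_ge0//; first by apply: sumr_ge0 => k _; exact: powR_ge0.
  by rewrite /primitive divr_ge0 ?powR_ge0// ltW// subr_gt0.
pose B := 1 + Num.min 1 (e' / (S + 1)).
have b0 : 0 < Num.min 1 (e' / (S + 1)) by rewrite lt_min ltr01 divr_gt0// ltr_wpDl.
have B1 : 1 < B by rewrite ltrDl.
have B2 : B <= 2 by rewrite /B -[leRHS]/(1 + 1) lerD2l ge_min lexx.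
have BS : (B - 1) * S <= e'.
  rewrite /B addrAC subrr add0r; apply: (@le_trans _ _ (e' / (S + 1) * S)).
    by rewrite ler_wpM2r// ge_min lexx orbT.
  by rewrite mulrAC ler_pdivrMr; nra.
have [d /andP[d0 d1] hd] := half_kernel_le s0 B1.
near=> m.
have Km : (K <= m)%N by near: m; exact: nbhs_infty_ge.
have m0 : (0 < m)%N by exact: leq_trans Km.
set N : R := m.*2%:R.
have N0 : 0 < N by rewrite ltr0n double_gt0.
have Nd : K%:R / N <= d.
  rewrite ler_pdivrMr// mulrC -ler_pdivrMr//.
  have : K%:R / d <= m%:R by near: m; exact: nbhs_infty_ger.
  by move/le_trans; apply; rewrite ler_nat -addnn leq_addr.
have hK : (0 < K <= m)%N by rewrite Km.
have hd' t : 0 < t <= K%:R / N -> f t <= B * c * t `^ (- s).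
  by move=> /andP[t0 tK]; apply: hd; rewrite t0 (le_trans tK).
have h1 := head_error hK (ltW B1) hd'.
have h2 := tail_error hK.
rewrite -/N -/T -/S -/c in h1 h2.
have KN0 : 0 < K%:R / N by rewrite divr_gt0// ltr0n.
have h3 : f (K%:R / N) <= N `^ s * (2 * c * K%:R `^ (- s)).
  apply: (le_trans (hd' _ _)); first by rewrite KN0 lexx.
  have -> : (K%:R / N) `^ (- s) = N `^ s * K%:R `^ (- s).
    rewrite powRM ?invr_ge0 ?(ltW N0)// mulrC; congr (_ * _).
    by rewrite -powR_inv1 ?(ltW N0)// -powRrM mulN1r opprK.
  rewrite mulrCA ler_wpM2l ?powR_ge0// ler_wpM2r ?powR_ge0// ler_wpM2r//.
  exact: ltW.
have n0 : 0 < N `^ s by exact: powR_gt0.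
set n := N `^ s in h1 h3 n0 *.
have ser : series (fun k => f ((k%:R + 2^-1) / N)) m =
  series (fun k => f ((k%:R + 2^-1) / N)) K + \sum_(K <= k < m) f ((k%:R + 2^-1) / N).
  by rewrite /series/= (big_cat_nat _ (n := K)).
rewrite midpot_half// -/N ser.
set X := series _ K in h1 *; set Y := \sum_(K <= k < m) _ in h2 *.
set q := Phi (K%:R / N) in h1 h2 *; set w := Phi 2^-1 in h2 *.
have bound : `|n * (c * l) - (X + Y - N * w)| < n * (c * (4 * e')).
  have -> : n * (c * l) - (X + Y - N * w) = n * (c * (l - T))
      - (X - N * q - n * (c * T)) - (Y - N * (w - q)) by ring.
  apply: le_lt_trans (ler_normB _ _) _.
  apply: (@le_lt_trans _ _ (n * (c * `|l - T|) + n * ((B - 1) * c * S)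
     + n * (2 * c * K%:R `^ (- s)))).
    apply: lerD; last exact: le_trans h2 h3.
    apply: le_trans (ler_normB _ _) _; apply: lerD => //.
    by rewrite !normrM (gtr0_norm n0) (gtr0_norm c0).
  have -> : n * (c * `|l - T|) + n * ((B - 1) * c * S) + n * (2 * c * K%:R `^ (- s)) =
    n * (c * (`|l - T| + (B - 1) * S + 2 * K%:R `^ (- s))) by ring.
  by rewrite !ltr_pM2l//; lra.
have -> : 2 * (c * l) - (2 * (X + Y) - N * (2 * w)) / n =
    2 * (n * (c * l) - (X + Y - N * w)) / n by field; rewrite gt_eqF.
rewrite normrM normfV (gtr0_norm n0) ltr_pdivrMr// normrM ger0_norm//.
have ee : c * (4 * e') = e / 2 by rewrite /e'; field; rewrite gt_eqF.
rewrite ee in bound; lra.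
Unshelve. all: by end_near.
Qed.

End Asymptotics.

(** * Binary expansions and the quantity [G] *)

(** The leading power exceeds the sum of the others, so binary expansions are
    unique; this is what [bit_sum_digits] rests on. *)
Lemma expn2_digits_lt p (e : 'I_p -> nat) n :
  (forall k l : 'I_p, (k < l)%N -> (e l < e k)%N) -> (forall k, (e k < n)%N) ->
  (\sum_(k < p) 2 ^ e k < 2 ^ n)%N.
Proof.
elim: p e n => [|p IH] e n dec lt; first by rewrite big_ord0 expn_gt0.
rewrite big_ord_recl /=.
have : (\sum_(i < p) 2 ^ e (lift ord0 i) < 2 ^ e ord0)%N.
  by apply: IH => [k l kl|k]; apply: dec.
have : (2 ^ (e ord0).+1 <= 2 ^ n)%N by rewrite leq_exp2l.
rewrite expnS mul2n -addnn => h1 h2; apply: leq_trans h1.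
by rewrite ltn_add2l.
Qed.

Lemma bit_sum_digits (R : nzRingType) (f : nat -> R) p (e : 'I_p -> nat) n N :
  (forall k l : 'I_p, (k < l)%N -> (e l < e k)%N) ->
  N = (\sum_(k < p) 2 ^ e k)%N -> (N < 2 ^ n)%N ->
  bit_sum f n N = \sum_(k < p) f (e k).
Proof.
elim: p e n N => [|p IH] e n N dec.
  rewrite !big_ord0 => -> _; rewrite /bit_sum big1// => i _.
  by rewrite div0n mul0r.
rewrite !big_ord_recl => NE Nn.
pose e' i := e (lift ord0 i); pose N' := (\sum_(i < p) 2 ^ e' i)%N.
have dec' (k l : 'I_p) : (k < l)%N -> (e' l < e' k)%N by move=> kl; apply: dec.
have N'lt : (N' < 2 ^ e ord0)%N.
  by apply: expn2_digits_lt => // k; apply: dec.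
have en : (e ord0 < n)%N.
  by rewrite -(ltn_exp2l (m := 2))//; apply: leq_ltn_trans Nn; rewrite NE leq_addr.
rewrite (@bit_sum_small _ _ (e ord0).+1)//; last first.
  by rewrite NE expnS mul2n -addnn ltn_add2l.
by rewrite NE bit_sum_top// (IH e').
Qed.

Lemma binary_expansion N : exists (p : nat) (e : 'I_p -> nat),
  (forall k l : 'I_p, (k < l)%N -> (e l < e k)%N) /\ N = (\sum_(k < p) 2 ^ e k)%N.
Proof.
elim/ltn_ind: N => N IH.
have [->|N0] := posnP N; first by exists 0%N, (fun=> 0%N); rewrite big_ord0; split => // -[].
have /andP[h1 h2] := trunc_log_bounds (isT : (1 < 2)%N) N0.
set n := trunc_log 2 N in h1 h2.
have pn : (0 < 2 ^ n)%N by rewrite expn_gt0.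
have [|p [e [dec NE]]] := IH (N - 2 ^ n)%N; first by rewrite ltn_subrL pn N0.
exists p.+1, (fun k => if unlift ord0 k is Some j then e j else n).
have en j : (e j < n)%N.
  rewrite -(ltn_exp2l (m := 2))//; apply: (@leq_ltn_trans (N - 2 ^ n)%N).
    by rewrite NE (bigD1 j)//= leq_addr.
  by rewrite expnS in h2; lia.
split.
  move=> k l; case: (unliftP ord0 k) => [k'|] ->; case: (unliftP ord0 l) => [l'|] -> //.
  exact: dec.
rewrite big_ord_recl unlift_none /=; under eq_bigr do rewrite liftK.
by rewrite -NE subnKC.
Qed.

Lemma tau_b_digits p (e : 'I_p -> nat) :
  (forall k l : 'I_p, (k < l)%N -> (e l < e k)%N) ->
  tau_b (\sum_(k < p) 2 ^ e k) = p.
Proof.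
move=> dec; set N := (\sum_(k < p) _)%N; apply/eqP; rewrite -(eqr_nat int).
have -> : (tau_b N)%:R = bit_sum (fun=> 1 : int) N N.
  by rewrite /tau_b natr_sum; apply: eq_bigr => i _; rewrite mulr1.
have NE : N = (\sum_(k < p) 2 ^ e k)%N by [].
clearbody N; rewrite (bit_sum_digits _ dec NE); last exact: ltn_expl.
by rewrite sumr_const card_ord.
Qed.

Section Weights.
Variables (R : realType) (s : R).
Hypotheses (s0 : 0 < s) (s1 : s < 1).

(** [G] at the vector of the ratios [2 ^ n_k / N]. *)
Definition weight (N : nat) : R :=
  bit_sum (fun i => (2 ^ i)%:R `^ s) N N / N%:R `^ s.

Lemma weight_digits p (e : 'I_p -> nat) N :
  (forall k l : 'I_p, (k < l)%N -> (e l < e k)%N) ->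
  N = (\sum_(k < p) 2 ^ e k)%N ->
  weight N = \sum_(k < p) (2 ^+ e k / N%:R) `^ s.
Proof.
move=> dec NE; rewrite /weight (bit_sum_digits _ dec NE (@ltn_expl 2 N isT)).
rewrite mulr_suml; apply: eq_bigr => k _.
rewrite powRM ?exprn_ge0 ?invr_ge0// natrX; congr (_ * _).
by rewrite -[N%:R^-1]powR_inv1// -powRrM mulN1r powRN.
Qed.

Lemma bit_le N i : odd (N %/ 2 ^ i) -> (2 ^ i <= N)%N.
Proof. by case: leqP => // /divn_small ->. Qed.

Lemma bit_sum_nat N : bit_sum (fun i => (2 ^ i)%:R : R) N N = N%:R.
Proof.
have [p [e [dec NE]]] := binary_expansion N.
rewrite (bit_sum_digits _ dec NE (@ltn_expl 2 N isT)).
by rewrite NE natr_sum.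
Qed.

(** [x <= x ^ s] on the unit interval. *)
Lemma weight_ge1 N : (0 < N)%N -> 1 <= weight N.
Proof.
move=> N0; have NR : (0 : R) < N%:R by rewrite ltr0n.
have Ns : 0 < N%:R `^ s :> R by exact: powR_gt0.
rewrite /weight ler_pdivlMr// mul1r.
have -> : N%:R `^ s = \sum_(i < N) (odd (N %/ 2 ^ i))%:R * ((2 ^ i)%:R * N%:R `^ (s - 1)) :> R.
  under eq_bigr do rewrite mulrA.
  rewrite -mulr_suml -/(bit_sum (fun i => (2 ^ i)%:R) N N) bit_sum_nat.
  by rewrite -{2}(powRr1 (ltW NR)) -powRD ?subrKC// gt_eqF// implybT.
apply: ler_sum => i _; case: (boolP (odd _)) => [/bit_le h|_]; last by rewrite !mul0r.
rewrite !mul1r; have i0 : (0 : R) < (2 ^ i)%:R by rewrite ltr0n expn_gt0.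
have -> : (2 ^ i)%:R `^ s = (2 ^ i)%:R * (2 ^ i)%:R `^ (s - 1) :> R.
  by rewrite -{2}(powRr1 (ltW i0)) -powRD ?subrKC// gt_eqF// implybT.
rewrite ler_wpM2l ?(ltW i0)//.
have -> : s - 1 = - (1 - s) by ring.
by apply: powRN_decr; rewrite ?subr_ge0 ?(ltW s1)// ler_nat.
Qed.

Definition weight_bound : R := 2 `^ s / (2 `^ s - 1).

Lemma pow2s_gt1 : 1 < 2 `^ s :> R.
Proof.
have h : (1 : R) `^ s < 2 `^ s by apply: gt0_ltr_powR; rewrite ?nnegrE ?ltr1n.
by rewrite powR1 in h.
Qed.

Lemma pow2sX i : (2 ^ i)%:R `^ s = (2 `^ s) ^+ i :> R.
Proof.
by rewrite natrX -powR_mulrn// -powRrM mulrC powRrM powR_mulrn ?powR_ge0.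
Qed.

(** A geometric sum whose last term [q ^ n] is at most [N ^ s]. *)
Lemma weight_le N : (0 < N)%N -> weight N <= weight_bound.
Proof.
move=> N0; have NR : (0 : R) < N%:R by rewrite ltr0n.
have /andP[h1 h2] := trunc_log_bounds (isT : (1 < 2)%N) N0.
set n := trunc_log 2 N in h1 h2; have q1 := pow2s_gt1; set q := 2 `^ s in q1.
have nN : (n < N)%N by apply: leq_trans h1; exact: ltn_expl.
rewrite /weight ler_pdivrMr ?powR_gt0// (@bit_sum_small _ _ n.+1)//.
apply: (@le_trans _ _ (\sum_(i < n.+1) q ^+ i)).
  apply: ler_sum => i _; rewrite pow2sX -/q.
  by case: odd; rewrite ?mul1r// mul0r exprn_ge0// (le_trans _ (ltW q1)).
have qX : q ^+ n <= N%:R `^ s.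
  rewrite -pow2sX; apply: ge0_ler_powR; rewrite ?nnegrE ?(ltW s0)//.
  by rewrite ler_nat.
apply: (@le_trans _ _ (weight_bound * q ^+ n)); last first.
  by rewrite ler_wpM2l// divr_ge0 ?powR_ge0// subr_ge0 ltW.
rewrite /weight_bound -/q; have q0 : q - 1 != 0 by rewrite subr_eq0 gt_eqF.
have -> : q / (q - 1) * q ^+ n = q ^+ n.+1 / (q - 1) by rewrite exprS; ring.
rewrite ler_pdivlMr ?subr_gt0// mulrC -subrX1 gerBl//.
Qed.

(** Multiplying [N] by a power of 2 shifts the digits and keeps the ratios
    [2 ^ n_k / N]. *)
Lemma weight_shift N j : weight (N * 2 ^ j) = weight N.
Proof.
have [->|N0] := posnP N; first by rewrite mul0n.
have [p [e [dec NE]]] := binary_expansion N.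
pose e' k := (e k + j)%N.
have dec' (k l : 'I_p) : (k < l)%N -> (e' l < e' k)%N.
  by move=> kl; rewrite ltn_add2r; exact: dec.
have NE' : (N * 2 ^ j)%N = (\sum_(k < p) 2 ^ e' k)%N.
  by rewrite {1}NE big_distrl /=; apply: eq_bigr => k _; rewrite expnD.
rewrite (weight_digits dec NE) (weight_digits dec' NE').
apply: eq_bigr => k _; congr (_ `^ _).
rewrite exprD natrM natrX; field.
by rewrite expf_neq0// pnatr_eq0 -lt0n N0.
Qed.

Lemma weight1 : weight 1 = 1.
Proof.
by rewrite /weight /bit_sum big_ord1 expn0 divn1 mul1r !powR1 divr1.
Qed.

(** [3 = 2 + 1] is the first integer with two digits. *)
Lemma weight3_gt1 : 1 < weight 3.
Proof.
have h (x : R) : 0 < x -> x `^ s = x * x `^ (- (1 - s)).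
  move=> x0; have xn : x != 0 by rewrite gt_eqF.
  by rewrite -{2}(powRr1 (ltW x0)) -powRD ?xn ?implybT//; congr (_ `^ _); ring.
rewrite /weight ltr_pdivlMr ?powR_gt0// mul1r.
have -> : bit_sum (fun i => (2 ^ i)%:R `^ s) 3 3 = 1 + 2 `^ s :> R.
  by rewrite /bit_sum !big_ord_recl big_ord0 /= !mul1r mul0r !addr0 expn0 powR1.
have s1' : 0 < 1 - s by rewrite subr_gt0.
have l1 : 3 `^ (- (1 - s)) < 2 `^ (- (1 - s)) :> R by apply: powRN_sdecr; rewrite ?ltr_nat.
have l2 : 3 `^ (- (1 - s)) < 1 `^ (- (1 - s)) :> R by apply: powRN_sdecr; rewrite ?ltr1n.
have h3 := h 3 (ltr0Sn R 2); have h2 := h 2 (ltr0Sn R 1).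
by rewrite powR1 in l2; rewrite h3 h2; lra.
Qed.

Lemma cvg_powR_ge0 (x : nat -> R) (t : R) : (forall j, 0 <= x j) ->
  x @ \oo --> t -> x j `^ s @[j --> \oo] --> t `^ s.
Proof.
move=> x0 xt; have t0 : 0 <= t.
  by apply: (ler_cvg_to (cvg_cst 0) xt); exact: nearW.
move: t0; rewrite le_eqVlt => /orP[/eqP t0|t0].
  rewrite -t0 in xt *; rewrite powR0 ?gt_eqF//.
  apply/cvgrPdist_lt => e e0.
  have [N _ hN] := (iffLR (cvgrPdist_lt _ _) xt) _ (powR_gt0 s^-1 e0).
  exists N => // j /hN /=; rewrite !sub0r !normrN !ger0_norm ?powR_ge0// => h.
  have := gt0_ltr_powR s0 (x0 j : x j \in Num.nneg) (powR_ge0 _ _) h.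
  by rewrite -powRrM mulVf ?gt_eqF// powRr1// ltW.
have cont : {for t, continuous (fun u : R => u `^ s)}.
  apply/differentiable_continuous/derivable1_diffP.
  by have h := is_derive1_powR s t0; exact: ex_derive.
exact: (cvg_comp _ _ xt cont).
Qed.

Lemma cvg_ord_sum p (F : 'I_p -> nat -> R) (l : 'I_p -> R) :
  (forall k, F k @ \oo --> l k) -> \sum_(k < p) F k j @[j --> \oo] --> \sum_(k < p) l k.
Proof.
elim: p F l => [|p IH] F l Fl.
  by rewrite big_ord0; apply: (cvg_eqfun (cvg_cst (0 : R))) => j; rewrite big_ord0.
have h := IH (fun k => F (lift ord0 k)) _ (fun k => Fl (lift ord0 k)).
rewrite big_ord_recl; apply: (cvg_eqfun (cvgD (Fl ord0) h)) => j.
by rewrite [RHS]big_ord_recl.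
Qed.

Lemma Theta_weight p (theta : 'I_p -> R) : Theta_set theta ->
  exists nu : nat -> nat, [/\ {homo nu : i j / (i < j)%N}, forall j, (0 < nu j)%N
    & weight (nu j) @[j --> \oo] --> G_sum theta s].
Proof.
move=> [nu [e [hnu pos dec nuE lim]]]; exists nu; split => //.
  by move=> j; case: (pos j).
rewrite (_ : (fun j => weight (nu j)) =
    (fun j => \sum_(k < p) (2 ^+ e j k / (nu j)%:R) `^ s)); last first.
  by apply/funext => j; apply: weight_digits; [exact: dec|exact: nuE].
rewrite /G_sum; apply: (cvg_ord_sum (F := fun k j => (2 ^+ e j k / (nu j)%:R) `^ s)) => k.
apply: cvg_powR_ge0; last exact: lim.
by move=> j; rewrite divr_ge0// exprn_ge0.
Qed.

(** The ratios of [N] are those of all the [N * 2 ^ j], which form an infinite set. *)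
Lemma weight_Theta N : (0 < N)%N -> exists (p : nat) (theta : 'I_p -> R),
  [/\ (0 < p)%N, Theta_set theta & weight N = G_sum theta s].
Proof.
move=> N0; have [p [e [dec NE]]] := binary_expansion N.
exists p, (fun k => 2 ^+ e k / N%:R); split.
- by case: p e dec NE => // e _ NE; rewrite NE big_ord0 in N0.
- exists (fun j => N * 2 ^ j)%N, (fun j k => (e k + j)%N); split.
  + by move=> i j ij; rewrite ltn_pmul2l// ltn_exp2l.
  + move=> j; split; first by rewrite muln_gt0 N0 expn_gt0.
    have -> : (N * 2 ^ j)%N = (\sum_(k < p) 2 ^ (e k + j))%N.
      by rewrite {1}NE big_distrl /=; apply: eq_bigr => k _; rewrite expnD.
    by apply: tau_b_digits => k l kl; rewrite ltn_add2r; exact: dec.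
  + by move=> j k l kl; rewrite ltn_add2r; exact: dec.
  + by move=> j; rewrite {1}NE big_distrl /=; apply: eq_bigr => k _; rewrite expnD.
  + move=> k; apply: (cvg_eqfun (cvg_cst (2 ^+ e k / N%:R : R))) => j.
    rewrite exprD natrM natrX; field.
    by rewrite expf_neq0// pnatr_eq0 -lt0n N0.
- exact: weight_digits.
Qed.

Lemma G_sum_bounds p (theta : 'I_p -> R) : Theta_set theta ->
  1 <= G_sum theta s <= weight_bound.
Proof.
move=> /Theta_weight[nu [_ pos lim]]; apply/andP; split.
- apply: (ler_cvg_to (cvg_cst (1 : R)) lim); apply: nearW => j.
  exact: weight_ge1.
- apply: (ler_cvg_to lim (cvg_cst weight_bound)); apply: nearW => j.
  exact: weight_le.
Qed.

Lemma gbar_fin : exists2 gm : R, gbar s = gm%:E &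
  [/\ 1 <= gm, forall N, (0 < N)%N -> weight N <= gm
    & forall e, 0 < e -> exists (p : nat) (theta : 'I_p -> R),
       Theta_set theta /\ gm - e < G_sum theta s].
Proof.
have ub : (gbar s <= weight_bound%:E)%E.
  apply: ge_ereal_sup => _ [p [theta [_ hT ->]]].
  by rewrite lee_fin; case/andP: (G_sum_bounds hT).
have lb N : (0 < N)%N -> ((weight N)%:E <= gbar s)%E.
  move=> /weight_Theta[p [theta [p0 hT E]]]; apply: ereal_sup_ubound.
  by exists p, theta; rewrite E.
have gfin : gbar s \is a fin_num.
  rewrite fin_numE; apply/andP; split.
    by apply/eqP => E; have := lb 1%N isT; rewrite E.
  by apply/eqP => E; move: ub; rewrite E.
exists (fine (gbar s)); first by rewrite fineK.
have lbR N : (0 < N)%N -> weight N <= fine (gbar s).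
  by move=> /lb; rewrite -{1}(fineK gfin) lee_fin.
split => //; first by rewrite -weight1; exact: lbR.
move=> e e0; have [x [p [theta [_ hT ->]]]] := ub_ereal_sup_adherent e0 gfin.
rewrite -/(gbar s) -{1}(fineK gfin) -EFinB lte_fin => h.
by exists p, theta.
Qed.

End Weights.

(** * Upper and lower limits *)

Lemma limn_esup_eq (R : realType) (u : nat -> \bar R) (l : R) :
  (forall e, 0 < e -> \forall N \near \oo, (u N <= (l + e)%:E)%E) ->
  (forall e N, 0 < e -> exists2 n, (N <= n)%N & ((l - e)%:E <= u n)%E) ->
  limn_esup u = l%:E.
Proof.
move=> hu hl; rewrite /limn_esup limf_esupE; apply/eqP; rewrite eq_le; apply/andP; split.
  apply/lee_addgt0Pr => e e0; rewrite -EFinD.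
  pose V : set nat := [set N | (u N <= (l + e)%:E)%E].
  apply: (@le_trans _ _ (ereal_sup (u @` V))).
    by apply: ereal_inf_lbound; exists V => //; exact: hu.
  by apply: ge_ereal_sup => _ [N hN <-].
apply: le_ereal_inf_tmp => _ [V [N _ hV] <-]; apply/lee_addgt0Pr => e e0.
have [n Nn hn] := hl e N e0; rewrite -leeBlDr// -EFinB; apply: le_trans hn _.
by apply: ereal_sup_ubound; exists n => //; exact: hV.
Qed.

Lemma limn_einf_eq (R : realType) (u : nat -> \bar R) (l : R) :
  (forall e, 0 < e -> \forall N \near \oo, ((l - e)%:E <= u N)%E) ->
  (forall e N, 0 < e -> exists2 n, (N <= n)%N & (u n <= (l + e)%:E)%E) ->
  limn_einf u = l%:E.
Proof.
move=> hu hl; rewrite /limn_einf (@limn_esup_eq _ _ (- l)) ?EFinN ?oppeK//.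
- move=> e e0; have := hu e e0; apply: filterS => N h.
  by rewrite leeNl -EFinN opprD opprK.
- move=> e N e0; have [n Nn h] := hl e N e0; exists n => //.
  by rewrite leeNr -EFinN opprB opprK addrC.
Qed.

Lemma homo_ge_id (nu : nat -> nat) : {homo nu : i j / (i < j)%N} ->
  forall j, (j <= nu j)%N.
Proof.
by move=> hnu; elim=> [//|j IH]; apply: leq_ltn_trans IH _; exact: hnu.
Qed.

Lemma homo_cvg (nu : nat -> nat) : {homo nu : i j / (i < j)%N} -> nu @ \oo --> \oo.
Proof.
move=> hnu A [N _ hA]; exists N => // j /= Nj; apply: hA => /=.
exact: leq_trans Nj (homo_ge_id hnu j).
Qed.

(** * The normalized potential *)

Section Conclusion.
Variables (R : realType) (zeta : R[i] -> R[i]).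
Hypothesis zetaP : is_riemann_zeta zeta.
Variable s : R.
Hypotheses (s0 : 0 < s) (s1 : s < 1).

Let C := zeta_const zeta s.
Let I := 2 * cumul_kernel s 2^-1.

Lemma zeta_const_lt0 : C < 0.
Proof.
have q1 := pow2s_gt1 s0; have z0 := zeta_lt0 s0 s1 zetaP.
have P0 : 0 < ((2 * pi) `^ s)^-1 :> R by rewrite invr_gt0 powR_gt0// mulr_gt0// pi_gt0.
rewrite /C /zeta_const pmulr_rlt0 ?subr_gt0// pmulr_llt0//.
by rewrite pmulr_rlt0.
Qed.

(** The normalized potential at the powers of 2. *)
Definition dyadic_defect (i : nat) : R :=
  (midpot s (2 ^ i) - (2 ^ i)%:R * I) / (2 ^ i)%:R `^ s.

Lemma dyadic_defect_cvg : dyadic_defect @ \oo --> C.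
Proof.
have h := midpot_asymptotics s0 s1 (midpoint_sum_cvg s0 s1 zetaP).
have CE : 2 * ((2 * pi) `^ (- s) * ((2 `^ s - 1) * complex.Re (zeta s%:C))) = C.
  by rewrite /C /zeta_const powRN; ring.
rewrite CE in h; rewrite -cvg_shiftS.
have e2 : {homo (fun i => 2 ^ i)%N : i j / (i < j)%N}.
  by move=> i j ij; rewrite ltn_exp2l.
apply: (cvg_eqfun (cvg_comp _ _ (homo_cvg e2) h)) => i /=.
by rewrite /dyadic_defect expnS mul2n.
Qed.

Definition defect (N : nat) : R :=
  (bit_sum (fun i => midpot s (2 ^ i)) N N - N%:R * I) / N%:R `^ s.

Lemma defectE N : defect N =
  \sum_(i < N) (odd (N %/ 2 ^ i))%:R * ((2 ^ i)%:R `^ s / N%:R `^ s) * dyadic_defect i.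
Proof.
rewrite /defect -{1}(bit_sum_nat R N) /bit_sum mulr_suml -sumrB mulr_suml.
apply: eq_bigr => i _; rewrite /dyadic_defect; field.
have P0 m : (0 < m)%N -> m%:R `^ s != 0 :> R.
  by move=> m0; rewrite gt_eqF// powR_gt0// ltr0n.
by rewrite !P0 ?expn_gt0//; exact: leq_ltn_trans (leq0n i) (ltn_ord i).
Qed.

Lemma weightE N : weight s N =
  \sum_(i < N) (odd (N %/ 2 ^ i))%:R * ((2 ^ i)%:R `^ s / N%:R `^ s).
Proof. by rewrite /weight mulr_suml; apply: eq_bigr => i _; rewrite mulrA. Qed.

Let coef_ge0 N i : 0 <= (odd (N %/ 2 ^ i))%:R * ((2 ^ i)%:R `^ s / N%:R `^ s) :> R.
Proof. by rewrite mulr_ge0// divr_ge0// powR_ge0. Qed.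

Lemma dyadic_defect_bounded : exists2 M : R, 0 <= M & forall i, `|dyadic_defect i| <= M.
Proof.
have /cvg_seq_bounded[M [_ hM]] : cvgn dyadic_defect.
  by apply/cvg_ex; exists C; exact: dyadic_defect_cvg.
have h i : `|dyadic_defect i| <= M + 1 by apply: hM => //; rewrite ltrDl.
by exists (M + 1) => //; exact: le_trans (normr_ge0 _) (h 0%N).
Qed.

(** The digits of bounded index carry a vanishing share of the total weight, and the
    defect of the others is close to its limit. *)
Lemma defect_weight : defect N - C * weight s N @[N --> \oo] --> 0.
Proof.
apply/cvgrPdist_lt => e e0.
have [M M0 hM] := dyadic_defect_bounded.
have B0 : 0 < weight_bound s.
  by rewrite divr_gt0 ?powR_gt0// subr_gt0 pow2s_gt1.
pose d := e / 2 / weight_bound s.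
have d0 : 0 < d by apply: divr_gt0 => //; exact: divr_gt0.
have [i0 _ hi0] := (iffLR (cvgrPdist_lt _ _) dyadic_defect_cvg) _ d0.
pose A := (M + `|C|) * \sum_(i < i0) (2 ^ i)%:R `^ s.
have A0 : 0 <= A by rewrite mulr_ge0 ?addr_ge0// sumr_ge0// => i _; exact: powR_ge0.
have smallN : \forall N \near \oo, A * N%:R `^ (- s) < e / 2.
  have e20 : 0 < e / 2 / (A + 1) by rewrite !divr_gt0// ltr_wpDl.
  have [N0 _ hN0] := (iffLR (cvgrPdist_lt _ _) (cvg_natr_powRN s0)) _ e20.
  exists N0.+1 => // -[//|N] /= NN; have := hN0 N NN.
  rewrite /= sub0r normrN ger0_norm ?powR_ge0// ltr_pdivlMr ?ltr_wpDl//.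
  by have := @powR_ge0 R N.+1%:R (- s); nra.
near=> N.
have N0 : (0 < N)%N by near: N; exact: nbhs_infty_gt.
have Ni0 : (i0 <= N)%N by near: N; exact: nbhs_infty_ge.
have hA : A * N%:R `^ (- s) < e / 2 by near: N.
rewrite sub0r normrN defectE weightE mulr_sumr -sumrB.
pose co i : R := (odd (N %/ 2 ^ i))%:R * ((2 ^ i)%:R `^ s / N%:R `^ s).
have -> : \sum_(i < N) (co i * dyadic_defect i - C * co i) =
    \sum_(i < N) co i * (dyadic_defect i - C).
  by apply: eq_bigr => i _; ring.
apply: le_lt_trans (ler_norm_sum _ _ _) _.
apply: (@le_lt_trans _ _ (\sum_(i < N) (d * co i +
    (i < i0)%:R * ((M + `|C|) * ((2 ^ i)%:R `^ s / N%:R `^ s))))).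
  apply: ler_sum => i _; rewrite normrM (ger0_norm (coef_ge0 N i)).
  case: ltnP => ii.
    rewrite mul1r -[leLHS]add0r; apply: lerD.
      by apply: mulr_ge0; [exact: ltW|exact: coef_ge0].
    rewrite mulrC; apply: ler_pM; [exact: normr_ge0|exact: coef_ge0| |].
      by apply: le_trans (ler_normB _ _) _; rewrite lerD2r.
    by rewrite /co ler_piMl ?divr_ge0 ?powR_ge0// lern1 leq_b1.
  rewrite mul0r addr0 mulrC ler_wpM2r ?coef_ge0// distrC; apply: ltW; exact: hi0.
rewrite big_split /= -mulr_sumr -weightE.
have -> : \sum_(i < N) (i < i0)%:R * ((M + `|C|) * ((2 ^ i)%:R `^ s / N%:R `^ s)) =
    A * N%:R `^ (- s).
  rewrite powRN /A -mulrA mulr_suml mulr_sumr.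
  rewrite [RHS](big_ord_widen N (fun i => (M + `|C|) * ((2 ^ i)%:R `^ s / N%:R `^ s)))//.
  rewrite [RHS]big_mkcond; apply: eq_bigr => i _.
  by case: ifP => _; rewrite ?mul1r ?mul0r.
have : d * weight s N <= e / 2.
  by rewrite /d mulrAC ler_pdivrMr// ler_wpM2l ?weight_le// ltW// divr_gt0.
lra.
Unshelve. all: by end_near.
Qed.

Lemma defect_subseq (nu : nat -> nat) (g : R) : {homo nu : i j / (i < j)%N} ->
  weight s (nu j) @[j --> \oo] --> g -> defect (nu j) @[j --> \oo] --> C * g.
Proof.
move=> hnu hg; have h := cvg_comp _ _ (homo_cvg hnu) defect_weight.
have h2 : C * weight s (nu j) + (defect (nu j) - C * weight s (nu j))
    @[j --> \oo] --> C * g + 0.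
  exact: (cvgD (cvgM (cvg_cst C) hg) h).
rewrite addr0 in h2; apply: (cvg_eqfun h2) => j; ring.
Qed.

Variable a : nat -> R[i].
Hypothesis ga : greedy s a.

Lemma normalized_potentialE N : (0 < N)%N ->
  normalized_potential s a N = (defect N)%:E.
Proof.
by move=> N0; rewrite /normalized_potential greedy_potential// energy_cumulative.
Qed.

Lemma normalized_potential_subseq (nu : nat -> nat) (g : R) :
  {homo nu : i j / (i < j)%N} -> (forall j, (0 < nu j)%N) ->
  weight s (nu j) @[j --> \oo] --> g ->
  normalized_potential s a (nu j) @[j --> \oo] --> (C * g)%:E.
Proof.
move=> hnu pos hg; have h := defect_subseq hnu hg.
rewrite (_ : (fun j => _) = EFin \o (defect \o nu)).
  by apply: cvg_EFin => //; exact: nearW.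
by apply/funext => j /=; rewrite normalized_potentialE.
Qed.

Lemma dyadic_subseq N : (0 < N)%N ->
  normalized_potential s a (N * 2 ^ j) @[j --> \oo] --> (C * weight s N)%:E.
Proof.
move=> N0; apply: normalized_potential_subseq.
- by move=> i j ij; rewrite ltn_pmul2l// ltn_exp2l.
- by move=> j; rewrite muln_gt0 N0 expn_gt0.
- by apply: (cvg_eqfun (cvg_cst (weight s N))) => j; rewrite weight_shift.
Qed.

Lemma frequently_close (nu : nat -> nat) (g e : R) N :
  {homo nu : i j / (i < j)%N} -> (forall j, (0 < nu j)%N) ->
  weight s (nu j) @[j --> \oo] --> g -> 0 < e ->
  exists n, [/\ (N <= n)%N, (0 < n)%N & `|C * g - defect n| < e].
Proof.
move=> hnu pos hg e0.
have [J _ hJ] := (iffLR (cvgrPdist_lt _ _) (defect_subseq hnu hg)) _ e0.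
exists (nu (maxn J N)); split => //.
  by apply: leq_trans (homo_ge_id hnu _); exact: leq_maxr.
by apply: hJ => /=; exact: leq_maxl.
Qed.

End Conclusion.

Theorem theorem1p4 (R : realType) (zeta : R[i] -> R[i])
    (hzeta : is_riemann_zeta zeta) (s : R) (s0 : 0 < s) (s1 : s < 1)
    (a : nat -> R[i]) (ha : greedy s a) :
  [/\ exists M : R, forall N : nat, (1 <= N)%N ->
        (`|normalized_potential s a N| <= M%:E)%E,
      ~ (exists l : R, normalized_potential s a N @[N --> \oo] --> l%:E),
      limn_esup (normalized_potential s a) = (zeta_const zeta s)%:E,
      limn_einf (normalized_potential s a) =
        (gbar s * (zeta_const zeta s)%:E)%E
    & forall (p : nat) (theta : 'I_p -> R), (0 < p)%N -> Theta_set theta ->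
        subseq_limit_point (normalized_potential s a)
          (G_sum theta s * zeta_const zeta s)%:E].
Proof.
have C0 := zeta_const_lt0 hzeta s0 s1; set C := zeta_const zeta s in C0 *.
have dw := defect_weight hzeta s0 s1; rewrite -/C in dw.
have npE N (N0 : (0 < N)%N) := normalized_potentialE s0 s1 ha N0.
have near_dw e : 0 < e -> \forall N \near \oo, (0 < N)%N /\ `|defect s N - C * weight s N| < e.
  move=> e0; have [N0 _ h] := (iffLR (cvgrPdist_lt _ _) dw) _ e0.
  exists N0.+1 => // N /= NN; split; first exact: leq_ltn_trans NN.
  by have := h N (ltnW NN); rewrite /= sub0r normrN.
have pow2 : {homo (fun j => 1 * 2 ^ j)%N : i j / (i < j)%N}.
  by move=> i j ij; rewrite !mul1n ltn_exp2l.
have w2 : weight s (1 * 2 ^ j) @[j --> \oo] --> (1 : R).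
  by apply: (cvg_eqfun (cvg_cst (1 : R))) => j; rewrite weight_shift weight1.
have p2 j : (0 < 1 * 2 ^ j)%N by rewrite mul1n expn_gt0.
have [gm gE [gm1 wg adh]] := gbar_fin s0 s1.
split.
- have [M M0 hM] := dyadic_defect_bounded hzeta s0 s1.
  exists (M * weight_bound s) => N N0; rewrite npE//= lee_fin defectE.
  apply: le_trans (ler_norm_sum _ _ _) _.
  apply: (@le_trans _ _ (M * weight s N)); last by rewrite ler_wpM2l// weight_le.
  rewrite weightE mulr_sumr; apply: ler_sum => i _.
  have c0 : 0 <= (odd (N %/ 2 ^ i))%:R * ((2 ^ i)%:R `^ s / N%:R `^ s) :> R.
    by rewrite mulr_ge0// divr_ge0// powR_ge0.
  by rewrite normrM (ger0_norm c0) mulrC ler_wpM2r.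
- move=> [l hl].
  have lim N : (0 < N)%N -> C * weight s N = l.
    move=> N0; have h1 := dyadic_subseq hzeta s0 s1 ha N0.
    have h : {homo (fun j => N * 2 ^ j)%N : i j / (i < j)%N}.
      by move=> i j ij; rewrite ltn_pmul2l// ltn_exp2l.
    have h2 := cvg_comp _ _ (homo_cvg h) hl.
    have : (C * weight s N)%:E = l%:E by apply: cvg_unique h1 h2.
    by case.
  have := lim 3 isT; rewrite -(lim 1%N isT) weight1 => /(mulfI (ltr0_neq0 C0)).
  by have := weight3_gt1 s1; lra.
- apply: limn_esup_eq => [e e0|e N e0].
    have := near_dw e e0; apply: filterS => N [N0 h].
    have w1 := weight_ge1 s0 s1 N0.
    have := ler_norm (defect s N - C * weight s N).
    by rewrite npE// lee_fin; nra.
  have [n [Nn n0 h]] := frequently_close hzeta s0 s1 N pow2 p2 w2 e0.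
  exists n => //; rewrite npE// lee_fin; rewrite mulr1 -/C in h.
  by have := ler_norm (C - defect s n); lra.
- rewrite gE -EFinM; apply: limn_einf_eq => [e e0|e N e0].
    have := near_dw e e0; apply: filterS => N [N0 h].
    have w1 := wg N N0.
    have := ler_norm (- (defect s N - C * weight s N)); rewrite normrN.
    by rewrite npE// lee_fin; nra.
  pose d := e / 2 / - C; have d0 : 0 < d by rewrite !divr_gt0// oppr_gt0.
  have [p [theta [hT hd]]] := adh d d0.
  have [nu [hnu pos hw]] := Theta_weight s0 hT.
  have e20 : 0 < e / 2 by rewrite divr_gt0.
  have [n [Nn n0 h]] := frequently_close hzeta s0 s1 N hnu pos hw e20.
  exists n => //; rewrite npE// lee_fin; rewrite -/C in h.
  have := ler_norm (- (C * G_sum theta s - defect s n)); rewrite normrN.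
  have dC : d * - C = e / 2 by rewrite /d divfK// oppr_eq0 lt_eqF.
  by nra.
- move=> p theta p0 hT; have [nu [hnu pos hw]] := Theta_weight s0 hT.
  exists nu; split => //; rewrite mulrC.
  exact: (normalized_potential_subseq hzeta s0 s1 ha hnu pos hw).
Qed.
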